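(* Let $L_1$ and $L_2$ be two complex solvable finite dimensional Lie algebras, $X_1$ and $X_2$ two complex Banach spaces, and $\rho_i\colon L_i\to \mathrm{L}(X_i)$, $i=1,2$, two representations of Lie algebras. Suppose that there is a tensor product $X_1\tilde{\otimes}X_2$ of $X_1$ and $X_2$ relative to $\langle X_1,X_1'\rangle$ and $\langle X_2,X_2'\rangle$. Let $L=L_1\times L_2$ and let $\rho=\rho_1\times\rho_2\colon L\to \mathrm{L}(X_1\tilde{\otimes}X_2)$, $\rho(l_1,l_2)=\rho_1(l_1)\otimes I+I\otimes\rho_2(l_2)$, be the tensor product representation. Then for every integer $k\ge 0$ (unions over integers $p,q\ge 0$ with $p+q=k$): (i) $\displaystyle \bigcup_{p+q=k}\sigma_{\delta,p}(\rho_1)\times\sigma_{\delta,q}(\rho_2)\subseteq\sigma_{\delta,k}(\rho)\subseteq sp_{\delta,k}(\rho)\subseteq\bigcup_{p+q=k}sp_{\delta,p}(\rho_1)\times sp_{\delta,q}(\rho_2),$ (ii) $\displaystyle \bigcup_{p+q=k}\sigma_{\pi,p}(\rho_1)\times\sigma_{\pi,q}(\rho_2)\subseteq\sigma_{\pi,k}(\rho)\subseteq sp_{\pi,k}(\rho)\subseteq\bigcup_{p+q=k}sp_{\pi,p}(\rho_1)\times sp_{\pi,q}(\rho_2).$ In particular, if $X_1$ and $X_2$ are Hilbert spaces, all the inclusions in (i) and (ii) are equalities.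
   Context: Koszul complex. Let $X$ be a complex Banach space, $\mathrm{L}(X)$ the bounded linear operators on $X$ with Lie bracket $[S,T]=ST-TS$, and $L$ a complex solvable Lie algebra of finite dimension $n$ with dual space $L^*$. A representation $\rho\colon L\to\mathrm{L}(X)$ is a Lie algebra morphism. A character of $L$ is $f\in L^*$ with $f([L,L])=0$; $\rho-f$ denotes the representation $l\mapsto\rho(l)-f(l)I$. The Koszul complex $(X\otimes\wedge L,d(\rho))$ has spaces $X\otimes\wedge^pL$ (zero for $p<0$ or $p>n$) and differentials $d_p(\rho)\colon X\otimes\wedge^pL\to X\otimes\wedge^{p-1}L$, $$d_p(\rho)(x\otimes\langle l_1\wedge\dots\wedge l_p\rangle)=\sum_{k=1}^p(-1)^{k+1}\rho(l_k)(x)\otimes\langle l_1\wedge\dots\wedge\hat{l_k}\wedge\dots\wedge l_p\rangle+\sum_{1\le i<j\le p}(-1)^{i+j-1}x\otimes\langle[l_i,l_j]\wedge l_1\wedge\dots\wedge\hat{l_i}\wedge\dots\wedge\hat{l_j}\wedge\dots\wedge l_p\rangle,$$ where $\hat{\ }$ means deletion. Słodkowski spectra. $\sigma_p(\rho)$ is the set of characters $f$ of $L$ with $H_p(X\otimes\wedge L,d(\rho-f))\ne0$. For integers $k\ge0$, $\sigma_{\delta,k}(\rho)=\bigcup_{p=0}^k\sigma_p(\rho)$ and $\sigma_{\pi,k}(\rho)=\bigcup_{p=n-k}^n\sigma_p(\rho)\cup\{f \text{ character}: R(d_{n-k}(\rho-f))\text{ is not closed}\}$, $R$ denoting range. Split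 spectra. A complex of Banach spaces $(X_p,d_p)$, $d_p\colon X_p\to X_{p-1}$, is split in degree $p$ if there are bounded operators $h_p\colon X_p\to X_{p+1}$, $h_{p-1}\colon X_{p-1}\to X_p$ with $d_{p+1}h_p+h_{p-1}d_p=I$ on $X_p$. $sp_p(\rho)$ is the set of characters $f$ of $L$ such that $(X\otimes\wedge L,d(\rho-f))$ is not split in degree $p$; $sp_{\delta,k}(\rho)=\bigcup_{p=0}^ksp_p(\rho)$, $sp_{\pi,k}(\rho)=\bigcup_{p=n-k}^nsp_p(\rho)$. Tensor product. For a Banach space $X$, $X'$ is its dual and for $y\in X$, $v\in X'$, $f_{y,v}\in\mathrm{L}(X)$ is $x\mapsto\langle x,v\rangle y$. A tensor product of Banach spaces $X$ and $Y$ relative to $\langle X,X'\rangle$ and $\langle Y,Y'\rangle$ is a Banach space $X\tilde\otimes Y$ with continuous bilinear maps $X\times Y\to X\tilde\otimes Y$, $(x,y)\mapsto x\otimes y$, and $\mathrm{L}(X)\times\mathrm{L}(Y)\to\mathrm{L}(X\tilde\otimes Y)$, $(T,S)\mapsto T\otimes S$, such that: (T1) $\|x\otimes y\|=\|x\|\|y\|$; (T2) $(T\otimes S)(x\otimes y)=(Tx)\otimes(Sy)$; (T3) $(T_1\otimes S_1)\circ(T_2\otimes S_2)=(T_1T_2)\otimes(S_1S_2)$, $I\otimes I=I$; (T4) $\mathrm{Im}(f_{x,u}\otimes I)\subseteq\{x\otimes y:y\in Y\}$ for $x\in X,u\in X'$, and $\mathrm{Im}(I\otimes f_{y,v})\subseteq\{x\otimes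 y:x\in X\}$ for $y\in Y,v\in Y'$. Direct sum. $L_1\times L_2$ is the direct sum Lie algebra, with $[l_1,l_2]=0$ for $l_1\in L_1$, $l_2\in L_2$. Characters of $L_1\times L_2$ are identified with pairs (character of $L_1$, character of $L_2$) by restriction. *)

(* Defs.v *)
From HB Require Import structures.
From mathcomp Require Import all_boot all_order all_algebra.
From mathcomp Require Import all_classical all_reals all_analysis.
From mathcomp Require Import complex.

Set Implicit Arguments.
Unset Strict Implicit.
Unset Printing Implicit Defensive.

Import Order.TTheory GRing.Theory Num.Theory.
Import numFieldNormedType.Exports.

Local Open Scope classical_set_scope.
Local Open Scope ring_scope.

(* [{ffun I -> X}] with the sum of the norms of the entries, which induces the
   product topology. *)
Section FfunNormed.
Variables (K : numFieldType) (I : finType) (X : normedModType K).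
Implicit Types f g : {ffun I -> X}.

Definition ffun_norm f : K := \sum_i `|f i|.

Lemma ffun_normD f g : ffun_norm (f + g) <= ffun_norm f + ffun_norm g.
Proof. by rewrite -big_split; apply: ler_sum => i _; rewrite ffunE ler_normD. Qed.

Lemma ffun_normZ (l : K) f : ffun_norm (l *: f) = `|l| * ffun_norm f.
Proof. by rewrite mulr_sumr; apply: eq_bigr => i _; rewrite ffunE normrZ. Qed.

Lemma ffun_norm0_eq0 f : ffun_norm f = 0 -> f = 0.
Proof.
move/eqP; rewrite psumr_eq0 // => /allP f0; apply/ffunP => i.
by rewrite ffunE; apply/eqP; rewrite -normr_eq0; apply: f0; rewrite mem_index_enum.
Qed.

HB.instance Definition _ := @Lmodule_isNormed.Build K {ffun I -> X}
  ffun_norm ffun_normD ffun_normZ ffun_norm0_eq0.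

Lemma ffun_normE f : `|f| = \sum_i `|f i|. Proof. by []. Qed.

Lemma ler_ffun_norm f i : `|f i| <= `|f|.
Proof. by rewrite ffun_normE (bigD1 i) //= lerDl sumr_ge0. Qed.

End FfunNormed.

Section FfunComplete.
Variables (K : numFieldType) (I : finType) (X : completeNormedModType K).

Lemma ffun_cauchy_cvg (F : set_system {ffun I -> X}) :
  ProperFilter F -> cauchy F -> cvg F.
Proof.
move=> FF /cauchyP Fc.
have Fi i : cvg ((fun f : {ffun I -> X} => f i) @ F).
  apply: cauchy_cvg; apply/cauchyP => e e0.
  have [x Fx] := Fc e e0; exists (x i); rewrite /nbhs /=.
  apply: filterS Fx => f; rewrite -!ball_normE /=; apply: le_lt_trans.
  by have := ler_ffun_norm (x - f) i; rewrite !ffunE.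
pose l : {ffun I -> X} := [ffun i => lim ((fun f : {ffun I -> X} => f i) @ F)].
apply/cvg_ex; exists l; apply/cvgrPdist_le => /= e e0.
have d0 : 0 < e / #|I|.+1%:R by rewrite divr_gt0.
have : \forall f \near F, forall i, `|l i - (f : {ffun I -> X}) i| <= e / #|I|.+1%:R.
  apply: filter_forall => i; rewrite ffunE.
  by move/cvgrPdist_le: (Fi i); apply.
apply: filterS => f lf; rewrite ffun_normE.
apply: (@le_trans _ _ (\sum_(i : I) e / #|I|.+1%:R)).
  by apply: ler_sum => i _; have := lf i; rewrite !ffunE.
rewrite sumr_const -[leLHS]mulr_natr -mulrA ler_piMr ?(ltW e0) // mulrC.
by rewrite ler_pdivrMr ?ltr0n // mul1r ler_nat.
Qed.

HB.instance Definition _ :=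
  Uniform_isComplete.Build {ffun I -> X} ffun_cauchy_cvg.

End FfunComplete.

Section BoundedOperators.
Variables (R : realType).
Local Notation C := R[i].

Section Def.
Variables (X Y : normedModType C).

Definition is_blin : {pred X -> Y} :=
  mem [set f | linear f /\ continuous f].

Record blin := BLin {
  blin_fun :> X -> Y;
  blin_subproof : blin_fun \in is_blin }.

HB.instance Definition _ := [isSub for blin_fun].
HB.instance Definition _ := [Choice of blin by <:].

Lemma is_blin_submod : submod_closed is_blin.
Proof.
split=> [|a f g].
  apply/mem_set; split=> [b x y|]; first by rewrite scaler0 addr0.
  exact: cst_continuous.
move=> /set_mem[lf cf] /set_mem[lg cg]; apply/mem_set; split=> [b x y|x].
  rewrite -[LHS]/(a *: f (b *: x + y) + g (b *: x + y)) lf lg.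
  rewrite -[RHS]/(b *: (a *: f x + g x) + (a *: f y + g y)).
  by rewrite !scalerDr !scalerA (mulrC b) addrACA.
by apply: cvgD; [apply: cvgZr; exact: cf|exact: cg].
Qed.

HB.instance Definition _ :=
  GRing.isSubmodClosed.Build C (X -> Y) is_blin is_blin_submod.
HB.instance Definition _ := [SubChoice_isSubLmodule of blin by <:].

Lemma blin_linear (T : blin) : linear T.
Proof. by have /set_mem[] := blin_subproof T. Qed.

Lemma blin_continuous (T : blin) : continuous T.
Proof. by have /set_mem[] := blin_subproof T. Qed.

HB.instance Definition _ (T : blin) :=
  GRing.isLinear.Build C X Y *:%R T (blin_linear T).

Definition mk_blin (f : X -> Y) (lf : linear f) (cf : continuous f) : blin :=
  BLin (mem_set (conj lf cf)).

Lemma blinP (S T : blin) : S =1 T -> S = T.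
Proof. by move=> ST; apply: val_inj; apply: funext. Qed.

(* Norms are valued in the nonnegative reals of [C]; the supremum is taken in
   [R]. *)
Definition opnorm (T : blin) : C :=
  (sup [set complex.Re `|T x| | x in [set x | `|x| <= 1]])%:C%C.

Implicit Types S T : blin.

Lemma ge0_Re (c : C) : 0 <= c -> (complex.Re c)%:C%C = c.
Proof. by case: c => a b; rewrite lecE /= => /andP[/eqP-> _]. Qed.

Lemma blin_bounded T : exists2 c : R, 0 <= c & forall x, `|T x| <= c%:C%C * `|x|.
Proof.
have /linear_boundedP : bounded_near T (nbhs (0 : X)).
  by apply/linear_bounded_continuous; exact: blin_continuous.
move=> /pinfty_ex_gt0[c c0 cT]; exists (complex.Re c).
  by move: c0; rewrite ltcE => /andP[_ /ltW].
by rewrite ge0_Re // ltW.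
Qed.

Let opset T := [set complex.Re `|T x| | x in [set x | `|x| <= 1]].

Let opset_has_sup T : has_sup (opset T).
Proof.
split; first by exists (complex.Re `|T 0|); exists 0 => //=; rewrite normr0 ler01.
have [c c0 cT] := blin_bounded T; exists c => _ [x x1 <-].
have : `|T x| <= c%:C%C.
  by apply: le_trans (cT x) _; rewrite ler_piMr // ler0c.
by rewrite lecE => /andP[].
Qed.

Lemma opnorm_ge0 T : 0 <= opnorm T.
Proof.
rewrite ler0c; apply: (sup_upper_bound (opset_has_sup T)).
by exists 0; [rewrite /= normr0 ler01|rewrite linear0 normr0].
Qed.

Lemma ler_opnorm T x : `|T x| <= opnorm T * `|x|.
Proof.
have [->|x0] := eqVneq x 0; first by rewrite linear0 !normr0 mulr0.
rewrite -ler_pdivrMr ?normr_gt0 // mulrC.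
have <- : `|T (`|x|^-1 *: x)| = `|x|^-1 * `|T x|.
  by rewrite linearZ normrZ ger0_norm // invr_ge0.
rewrite -[leLHS]ge0_Re // lecR; apply: (sup_upper_bound (opset_has_sup T)).
exists (`|x|^-1 *: x) => //=.
by rewrite normrZ ger0_norm ?invr_ge0 // mulVf ?normr_eq0.
Qed.

Lemma opnorm_le T (c : C) :
  0 <= c -> (forall x, `|T x| <= c * `|x|) -> opnorm T <= c.
Proof.
move=> c0 cT; have cE : (complex.Re c)%:C%C = c.
  exact: ge0_Re.
rewrite -cE lecR; apply: ge_sup; first by case: (opset_has_sup T).
move=> _ [x x1 <-]; rewrite -lecR ge0_Re // cE.
by apply: le_trans (cT x) _; rewrite ler_piMr.
Qed.

Lemma opnormD S T : opnorm (S + T) <= opnorm S + opnorm T.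
Proof.
apply: opnorm_le => [|x]; first by rewrite addr_ge0 ?opnorm_ge0.
rewrite mulrDl (le_trans (ler_normD _ _)) //.
by rewrite lerD ?ler_opnorm.
Qed.

Lemma opnormZ (l : C) T : opnorm (l *: T) = `|l| * opnorm T.
Proof.
have le k S : opnorm (k *: S) <= `|k| * opnorm S.
  apply: opnorm_le => [|x]; first by rewrite mulr_ge0 ?opnorm_ge0.
  by rewrite -mulrA -[(k *: S) x]/(k *: S x) normrZ ler_wpM2l ?ler_opnorm.
apply/eqP; rewrite eq_le le /=.
have [->|l0] := eqVneq l 0; first by rewrite normr0 mul0r opnorm_ge0.
rewrite -ler_pdivlMl ?normr_gt0 // -normfV.
by apply: le_trans (le _ _); rewrite scalerK.
Qed.

Lemma opnorm0_eq0 T : opnorm T = 0 -> T = 0.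
Proof.
move=> T0; apply: blinP => x; apply/eqP; rewrite -normr_le0.
by apply: le_trans (ler_opnorm T x) _; rewrite T0 mul0r.
Qed.

HB.instance Definition _ := @Lmodule_isNormed.Build C blin
  opnorm opnormD opnormZ opnorm0_eq0.

End Def.

Section Operations.
Variables (X Y Z : normedModType C).

Program Definition bid : blin X X := @mk_blin X X idfun _ _.
Next Obligation. by []. Qed.
Next Obligation. by move=> x; exact: cvg_id. Qed.

Program Definition bcomp (S : blin Y Z) (T : blin X Y) : blin X Z :=
  @mk_blin X Z (S \o T) _ _.
Next Obligation. by move=> S T a x y /=; rewrite !linearP. Qed.
Next Obligation.
by move=> S T x; apply: continuous_comp; exact: blin_continuous.
Qed.

(* The rank one operator [x |-> <x, v> y]. *)
Program Definition rank1 (y : X) (v : blin X C^o) : blin X X :=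
  @mk_blin X X (fun x => (v x : C) *: y) _ _.
Next Obligation.
by move=> y v a x x' /=; rewrite linearP scalerDl scalerA.
Qed.
Next Obligation.
by move=> y v x; apply: cvgZl; exact: blin_continuous.
Qed.

End Operations.
End BoundedOperators.

Notation "''L' ( X )" := (blin X X) (at level 8, format "''L' ( X )").

HB.mixin Record isLieAlgebra (K : fieldType) L & Vector K L := {
  lie : L -> L -> L;
  lie_linearl : forall z, linear (lie^~ z);
  lie_linearr : forall x, linear (lie x);
  lie_alt : forall x, lie x x = 0;
  lie_jacobi : forall x y z,
    lie x (lie y z) + lie y (lie z x) + lie z (lie x y) = 0 }.

#[short(type="lieAlgType")]
HB.structure Definition LieAlgebra (K : fieldType) :=
  {L of isLieAlgebra K L & Vector K L}.

Section LieTheory.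
Variables (K : fieldType) (L : lieAlgType K).

(* [U, V], the span of all brackets of elements of U and V; by bilinearity it
   is spanned by the brackets of basis vectors. *)
Definition lie_space (U V : {vspace L}) : {vspace L} :=
  <<[seq lie u v | u <- vbasis U, v <- vbasis V]>>%VS.

Definition derived_space (m : nat) : {vspace L} :=
  iter m (fun U => lie_space U U) fullv.

Definition lie_solvable : Prop := exists m, derived_space m = 0%VS.

Definition is_character (f : 'Hom(L, K^o)) : Prop :=
  forall l m, f (lie l m) = 0.

End LieTheory.

Section DirectSum.
Variables (K : fieldType) (L1 L2 : lieAlgType K).
Implicit Types x y z : (L1 * L2)%type.

Definition pair_lie x y : L1 * L2 := (lie x.1 y.1, lie x.2 y.2).

Lemma pair_lie_linearl z : linear (pair_lie^~ z).
Proof. by move=> a x y; congr (_, _); rewrite /= lie_linearl. Qed.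

Lemma pair_lie_linearr x : linear (pair_lie x).
Proof. by move=> a y z; congr (_, _); rewrite /= lie_linearr. Qed.

Lemma pair_lie_alt x : pair_lie x x = 0.
Proof. by rewrite /pair_lie !lie_alt. Qed.

Lemma pair_lie_jacobi x y z :
  pair_lie x (pair_lie y z) + pair_lie y (pair_lie z x)
    + pair_lie z (pair_lie x y) = 0.
Proof. by congr (_, _); rewrite /= lie_jacobi. Qed.

HB.instance Definition _ := isLieAlgebra.Build K (L1 * L2)%type
  pair_lie_linearl pair_lie_linearr pair_lie_alt pair_lie_jacobi.

Definition lie_inl (l : L1) : L1 * L2 := (l, 0).
Definition lie_inr (l : L2) : L1 * L2 := (0, l).

Lemma lie_inl_linear : linear lie_inl.
Proof. by move=> a x y; congr (_, _); rewrite /= scaler0 addr0. Qed.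

Lemma lie_inr_linear : linear lie_inr.
Proof. by move=> a x y; congr (_, _); rewrite /= scaler0 addr0. Qed.

HB.instance Definition _ :=
  GRing.isLinear.Build K L1 (L1 * L2)%type *:%R lie_inl lie_inl_linear.
HB.instance Definition _ :=
  GRing.isLinear.Build K L2 (L1 * L2)%type *:%R lie_inr lie_inr_linear.

(* [A x B], a pair of functionals being identified with the functional on
   [L1 x L2] that restricts to them. *)
Definition char_prod (A : set 'Hom(L1, K^o)) (B : set 'Hom(L2, K^o)) :
    set 'Hom((L1 * L2)%type, K^o) :=
  [set f | A (f \o linfun lie_inl)%VF /\ B (f \o linfun lie_inr)%VF].

End DirectSum.

(* A complex is given by spaces indexed by [int] and maps [d p q] from degree
   [p] to degree [q], of which only [d p (p - 1)] matters; the two indices avoid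
   transports between degrees [p + 1 - 1] and [p]. *)
Section Complexes.
Variables (R : realType) (K : int -> normedModType R[i]).
Variable d : forall p q : int, K p -> K q.

(* The kernel of [d_p] differs from the range of [d_(p + 1)]. *)
Definition homology_neq0 (p : int) : Prop :=
  [set u | @d p (p - 1) u = 0] <> range (@d (p + 1) p).

Definition split_at (p : int) : Prop :=
  exists (h : blin (K p) (K (p + 1))) (h' : blin (K (p - 1)) (K p)),
    forall u, @d (p + 1) p (h u) + h' (@d p (p - 1) u) = u.

End Complexes.

Section Koszul.
Variables (R : realType) (L : lieAlgType R[i]) (X : completeNormedModType R[i]).
Local Notation C := R[i].
Local Notation n := (\dim {:L}).
Local Notation e := (vbasis {:L}).

Definition is_representation (rho : L -> 'L(X)) : Prop :=
  linear rho /\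
  forall l m, rho (lie l m) = bcomp (rho l) (rho m) - bcomp (rho m) (rho l).

Definition rep_shift (rho : L -> 'L(X)) (f : 'Hom(L, C^o)) (l : L) : 'L(X) :=
  rho l - (f l : C) *: bid X.

(* With [e] the chosen basis of [L], the vectors
   [e_A = e_{i_1} /\ ... /\ e_{i_p}], for [A = {i_1 < ... < i_p}], form a basis
   of [/\^p L]; so [X (x) /\^p L] is the space of families of vectors of [X]
   indexed by the subsets of cardinality [p]. It is zero unless
   [0 <= p <= n]. *)
Definition koszul_space (p : int) : completeNormedModType C :=
  {ffun {A : {set 'I_n} | #|A|%:Z == p} -> X}.

(* The coordinate on [e_A] of [l_1 /\ ... /\ l_p], for [s = l_1, ..., l_p]: the
   minor on the columns [A] of the matrix of coordinates of the [l_i]. *)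
Definition wedge_coord (s : seq L) (A : {set 'I_n}) : C :=
  if size s == #|A| then
    \det (\matrix_(i < #|A|, j < #|A|) coord e (enum_val j) s`_i)
  else 0.

(* [x (x) (l_1 /\ ... /\ l_p)] *)
Definition wedge_tensor (p : int) (x : X) (s : seq L) : koszul_space p :=
  [ffun A => wedge_coord s (val A) *: x].

Definition delete (k : nat) (s : seq L) : seq L := take k s ++ drop k.+1 s.

(* The right-hand side of the formula for [d (x (x) (l_1 /\ ... /\ l_p))]; as
   indices start from 0, the signs are [(-1)^k] and [(-1)^(i+j+1)]. *)
Definition koszul_formula (rho : L -> 'L(X)) (q : int) (x : X) (s : seq L) :
    koszul_space q :=
  \sum_(k < size s) (-1) ^+ k *: wedge_tensor q (rho s`_k x) (delete k s)
  + \sum_(j < size s) \sum_(i < j) (-1) ^+ (i + j).+1 *: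
      wedge_tensor q x (lie s`_i s`_j :: delete i (delete j s)).

(* The linear extension of [koszul_formula] from the vectors
   [x (x) e_A]; both sides of the formula being multilinear and alternating in
   the [l_i], it then holds for all of them. Components with [q != p - 1]
   vanish. *)
Definition koszul_d (rho : L -> 'L(X)) (p q : int) (u : koszul_space p) :
    koszul_space q :=
  \sum_(A : {A : {set 'I_n} | #|A|%:Z == p})
    koszul_formula rho q (u A) [seq e`_i | i : 'I_n <- enum (val A)].

Definition sigma (rho : L -> 'L(X)) (p : int) : set 'Hom(L, C^o) :=
  [set f | is_character f /\ homology_neq0 (koszul_d (rep_shift rho f)) p].

Definition sigma_delta (rho : L -> 'L(X)) (k : nat) : set 'Hom(L, C^o) :=
  \bigcup_(p in [set p : int | 0 <= p <= k%:Z]) sigma rho p.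

Definition sigma_pi (rho : L -> 'L(X)) (k : nat) : set 'Hom(L, C^o) :=
  \bigcup_(p in [set p : int | n%:Z - k%:Z <= p <= n%:Z]) sigma rho p
  `|` [set f | is_character f /\
       ~ closed (range (@koszul_d (rep_shift rho f)
                          (n%:Z - k%:Z) (n%:Z - k%:Z - 1)))].

Definition spl (rho : L -> 'L(X)) (p : int) : set 'Hom(L, C^o) :=
  [set f | is_character f /\ ~ split_at (koszul_d (rep_shift rho f)) p].

Definition spl_delta (rho : L -> 'L(X)) (k : nat) : set 'Hom(L, C^o) :=
  \bigcup_(p in [set p : int | 0 <= p <= k%:Z]) spl rho p.

Definition spl_pi (rho : L -> 'L(X)) (k : nat) : set 'Hom(L, C^o) :=
  \bigcup_(p in [set p : int | n%:Z - k%:Z <= p <= n%:Z]) spl rho p.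

End Koszul.

Section TensorProduct.
Variables (R : realType) (X Y Z : completeNormedModType R[i]).
Local Notation C := R[i].

(* [t x y] is [x (x) y] and [tt T S] is [T (x) S]. *)
Record is_tensor_product (t : {bilinear X -> Y -> Z})
    (tt : {bilinear 'L(X) -> 'L(Y) -> 'L(Z)}) : Prop := {
  tensor_continuous : continuous (fun z : X * Y => t z.1 z.2);
  tensor_op_continuous :
    continuous (fun z : 'L(X) * 'L(Y) => tt z.1 z.2);
  tensor_norm : forall x y, `|t x y| = `|x| * `|y|;
  tensor_op_tensor : forall T S x y, tt T S (t x y) = t (T x) (S y);
  tensor_op_comp : forall T1 S1 T2 S2,
    bcomp (tt T1 S1) (tt T2 S2) = tt (bcomp T1 T2) (bcomp S1 S2);
  tensor_op_id : tt (bid X) (bid Y) = bid Z;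
  tensor_rank1l : forall (x : X) (u : blin X C^o),
    range (tt (rank1 x u) (bid Y)) `<=` [set t x y | y in [set: Y]];
  tensor_rank1r : forall (y : Y) (v : blin Y C^o),
    range (tt (bid X) (rank1 y v)) `<=` [set t x y | x in [set: X]] }.

Variables (L1 L2 : lieAlgType C) (tt : 'L(X) -> 'L(Y) -> 'L(Z)).

Definition tensor_rep (rho1 : L1 -> 'L(X)) (rho2 : L2 -> 'L(Y))
    (l : L1 * L2) : 'L(Z) :=
  tt (rho1 l.1) (bid Y) + tt (bid X) (rho2 l.2).

(* The union over [p + q = k] of [S1 p x S2 q]. *)
Definition spectra_prod (S1 : nat -> set 'Hom(L1, C^o))
    (S2 : nat -> set 'Hom(L2, C^o)) (k : nat) :
    set 'Hom((L1 * L2)%type, C^o) :=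
  \bigcup_(pq in [set pq : nat * nat | (pq.1 + pq.2)%N = k])
    char_prod (S1 pq.1) (S2 pq.2).

End TensorProduct.

Definition is_hilbert (R : realType) (X : completeNormedModType R[i]) : Prop :=
  exists dot : {dot X for @Num.conj R[i]}, forall x, `|x| ^+ 2 = dot x x.

(* Main.v *)
(** The Koszul complex of [rho] is the module generated by [X] over the exterior
    algebra of [L], and its differential is determined by Cartan's formula
    [d (l /\ u) + l /\ d u = theta l u]. The total complex of the Koszul
    complexes of [rho1] and [rho2], whose differential is [D1 (x) 1 + s (x) D2]
    with [s] the parity, satisfies the same characterization on [L1 x L2], and
    so is the Koszul complex of [rho]. Everything is then proved degree by degree:
    if [h1], [h2] are homotopies and [pi = 1 - (D h + h D)], then
    [1 - pi1 (x) pi2] is null homotopic, whence splitting in degree [m] as soon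
    as [pi1] or [pi2] vanishes in the degrees [i], [j] whenever [i + j = m].
    Conversely, if [D1] and [D2] are not exact with closed range in
    degrees [p] and [q], Hahn-Banach yields approximate cycles [x], [y] and
    bounded functionals [u], [v] that are small on boundaries but not at [x],
    [y]. The slice operators [f_{x,u} (x) f_{y,v}] then contradict the open
    mapping theorem for the total differential. In Hilbert spaces, exactness with
    closed ranges implies splitting, by orthogonal projections. *)

(* The basis that [vbasis] chooses for [L1 * L2] is unrelated to those chosen for [L1] and [L2], so
   the Koszul complex of [rho] cannot be compared with the total complex coordinate by coordinate.
   This is why both are described by generators and relations that mention no basis: a map that
   respects the generators [eta] and the multiplications [eps] respects everything else, and two
   models are therefore isomorphic. This isomorphism need not be isometric, hence norms are
   controlled up to constants only.

   A second obstacle is that each spectrum tests some degrees only. Homotopies given in separate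
   degrees are unrelated and have to be glued into one operator. In the other direction, a failure
   may lie in the homology or in a range that is not closed. Approximate cycles treat both at once,
   and the flag [strict] retains genuine cycles, with which inexactness alone passes to the tensor
   product. *)
From HB Require Import structures.
Require Import Defs.
From mathcomp Require Import all_boot all_order all_algebra.
From mathcomp Require Import all_classical all_reals all_analysis.
From mathcomp Require Import complex ring lra zify.
Set Implicit Arguments.
Unset Strict Implicit.
Unset Printing Implicit Defensive.
Import Order.TTheory GRing.Theory Num.Theory.
Import numFieldNormedType.Exports.
Local Open Scope classical_set_scope.
Local Open Scope ring_scope.

(** * Real-valued norms and successive approximation *)

Section RealNorm.
Variable R : realType.
Local Notation C := R[i].

(** Norms are complex numbers here. Their real parts give inequalities in [R], where [lra], suprema
    and infima apply. *)
Definition rnorm (X : normedModType C) (x : X) : R := complex.Re `|x|.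

Section Theory.
Variable X : normedModType C.
Implicit Types x y : X.

Lemma normE x : `|x| = (rnorm x)%:C%C.
Proof. by rewrite /rnorm ge0_Re. Qed.

Lemma rnorm_ge0 x : 0 <= rnorm x.
Proof. by rewrite -ler0c -normE. Qed.

Lemma rnorm0 : rnorm (0 : X) = 0.
Proof. by rewrite /rnorm normr0. Qed.

Lemma rnorm_le0 x : rnorm x <= 0 -> x = 0.
Proof. by move=> x0; apply/eqP; rewrite -normr_le0 normE lecR. Qed.

Lemma rnormD x y : rnorm (x + y) <= rnorm x + rnorm y.
Proof. by rewrite -lecR rmorphD /= -!normE ler_normD. Qed.

Lemma rnormN x : rnorm (- x) = rnorm x.
Proof. by rewrite /rnorm normrN. Qed.

Lemma rdistC x y : rnorm (x - y) = rnorm (y - x).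
Proof. by rewrite /rnorm distrC. Qed.

Lemma rnormB x y : rnorm (x - y) <= rnorm x + rnorm y.
Proof. by rewrite -(rnormN y) rnormD. Qed.

Lemma rnorm_dist x y z : rnorm (x - z) <= rnorm (x - y) + rnorm (y - z).
Proof. by apply: le_trans (rnormD _ _); rewrite addrA subrK. Qed.

Lemma rnormZr (a : R) x : rnorm (a%:C%C *: x) = `|a| * rnorm x.
Proof.
by apply: complexI; rewrite rmorphM /= -!normE normrZ normc_def /= expr0n /= addr0 sqrtr_sqr.
Qed.

End Theory.

Lemma rnormZ (X : normedModType C) (a : C) (x : X) :
  rnorm (a *: x) = rnorm (a : C^o) * rnorm x.
Proof. by apply: complexI; rewrite rmorphM /= -!normE normrZ. Qed.

Lemma opnormP (X Y : normedModType C) (T : blin X Y) x :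
  rnorm (T x) <= rnorm T * rnorm x.
Proof. by rewrite -lecR rmorphM /= -!normE; exact: ler_opnorm. Qed.

Lemma rnorm_opnorm_le (X Y : normedModType C) (T : blin X Y) (c : R) :
  0 <= c -> (forall x, rnorm (T x) <= c * rnorm x) -> rnorm T <= c.
Proof.
move=> c0 cT; rewrite -lecR -normE; apply: opnorm_le; first by rewrite ler0c.
by move=> x; rewrite !normE -rmorphM lecR.
Qed.

Lemma linear_bounded_cont (X Y : normedModType C) (f : X -> Y) (c : R) :
  linear f -> (forall x, rnorm (f x) <= c * rnorm x) -> continuous f.
Proof.
move=> lf cf; pose F : {linear X -> Y} := HB.pack f (GRing.isLinear.Build _ _ _ _ f lf).
rewrite -[f]/(F : X -> Y); apply/linear_bounded_continuous/linear_boundedP.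
exists (`|c|%:C%C); split; first by apply: ger0_real; rewrite ler0c normr_ge0.
move=> e ce x; rewrite !normE; apply: le_trans (_ : (`|c|%:C%C * (rnorm x)%:C%C <= _)).
  by rewrite -rmorphM lecR; apply: le_trans (cf x) _; rewrite ler_wpM2r ?rnorm_ge0 ?ler_norm.
by rewrite ler_wpM2r ?ler0c ?rnorm_ge0 // ltW.
Qed.

Definition mk_blin_bounded (X Y : normedModType C) (f : X -> Y) (c : R)
    (lf : linear f) (cf : forall x, rnorm (f x) <= c * rnorm x) : blin X Y :=
  mk_blin lf (linear_bounded_cont lf cf).

(** Stands in for passages to the limit: an inequality follows if it holds up to an error that
    halves at each step. *)
Lemma le_geom_le0 (a c : R) : (forall n, a <= c / 2 ^+ n) -> a <= 0.
Proof.
move=> ac; rewrite leNgt; apply/negP => a0.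
have c0 : 0 < c by have := ac 0; rewrite expr0 divr1; exact: lt_le_trans.
have := archi_boundP (ltW (divr_gt0 c0 a0)); set n := Num.bound _ => hn.
have := ac n; rewrite ler_pdivlMr ?exprn_gt0 // mulrC -ler_pdivlMr // leNgt => /negP; apply.
apply: lt_le_trans hn _; rewrite -natrX ler_nat; exact/ltnW/ltn_expl.
Qed.

End RealNorm.

Section Completeness.
Variable R : realType.
Local Notation C := R[i].

Lemma rnorm_cauchy_cvg (X : completeNormedModType C) (s : nat -> X) (r : nat -> R) :
  (forall n, r n.+1 <= r n / 2) -> (forall n, rnorm (s n.+1 - s n) <= r n) ->
  exists l, forall n, rnorm (l - s n) <= 2 * r n.
Proof.
move=> r2 sr.
have r0 n : 0 <= r n by apply: le_trans (sr n); exact: rnorm_ge0.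
(* A telescoping bound: as [r] at least halves, [r m <= 2 * (r m - r m.+1)]. *)
have tail n k : rnorm (s (n + k)%N - s n) <= 2 * (r n - r (n + k)%N).
  elim: k => [|k IH]; first by rewrite addn0 !subrr rnorm0 mulr0.
  apply: le_trans (rnorm_dist _ (s (n + k)%N) _) _; rewrite addnS.
  by have := sr (n + k)%N; have := r2 (n + k)%N; lra.
have tail' n k : (n <= k)%N -> rnorm (s k - s n) <= 2 * r n.
  by move=> /subnKC <-; apply: le_trans (tail _ _) _; have := r0 (n + (k - n))%N; lra.
have rgeom n : r n <= r 0%N / 2 ^+ n.
  elim: n => [|n IH]; first by rewrite expr0 divr1.
  apply: le_trans (r2 n) _; rewrite exprS invfM; lra.
have rsmall e : 0 < e -> exists n, 2 * r n < e.
  move=> e0; apply: contrapT => /forallNP re.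
  suff : e <= 0 by rewrite leNgt e0.
  apply: (@le_geom_le0 _ _ (2 * r 0%N)) => n; have := re n => /negP; rewrite -leNgt => er.
  by apply: le_trans er _; rewrite -mulrA ler_wpM2l.
have /cvg_ex[l sl] : cvg (s @ \oo).
  apply: cauchy_cvg; apply/cauchyP => e e0.
  have [n ne] := rsmall (complex.Re e) (ltac:(by move: e0; rewrite ltcE => /andP[])).
  exists (s n); exists n => //= k /= nk; rewrite -ball_normE /= normE rdistC.
  by rewrite -(ge0_Re (ltW e0)) ltcR; apply: le_lt_trans ne; exact: tail'.
exists l => n; rewrite leNgt; apply/negP => ln.
have /cvgrPdist_lt/(_ ((rnorm (l - s n) - 2 * r n)%:C%C)) := sl.
rewrite ltcR subr_gt0 => /(_ ln)[m _ /= ml].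
have := ml (maxn m n) (leq_maxl _ _); rewrite normE ltcR.
have := tail' n (maxn m n) (leq_maxr _ _); have := rnorm_dist l (s (maxn m n)) (s n).
lra.
Qed.

(* Successive approximation: solving [T w = y] up to half the norm of [y]
   suffices. *)
Lemma approx_solve (E : completeNormedModType C) (F : normedModType C)
    (T : blin E F) (V : set F) (M : R) :
  0 <= M ->
  (forall y, V y -> exists w, [/\ V (y - T w), rnorm (y - T w) <= rnorm y / 2 &
     rnorm w <= M * rnorm y]) ->
  forall y, V y -> exists2 w, T w = y & rnorm w <= 2 * M * rnorm y.
Proof.
move=> M0 step y Vy.
have /choice[g gP] : forall y, exists w, V y -> [/\ V (y - T w),
    rnorm (y - T w) <= rnorm y / 2 & rnorm w <= M * rnorm y].
  move=> z; have [Vz|nVz] := pselect (V z); last by exists 0 => /nVz.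
  by have [w wP] := step z Vz; exists w.
pose z n := iter n (fun z => z - T (g z)) y.
have Vz n : V (z n) by elim: n => //= n /gP[].
have z2 n : rnorm (z n.+1) <= rnorm (z n) / 2 by case: (gP _ (Vz n)).
have zg n : rnorm (g (z n)) <= M * rnorm (z n) by case: (gP _ (Vz n)).
pose s n := \sum_(i < n) g (z i).
have sE n : y - T (s n) = z n.
  elim: n => [|n IH]; first by rewrite /s big_ord0 linear0 subr0.
  by rewrite /s big_ord_recr /= linearD opprD addrA -/(s n) IH.
have [||l lP] := @rnorm_cauchy_cvg _ s (fun n => M * rnorm (z n)).
- by move=> n; rewrite -mulrA ler_wpM2l.
- by move=> n; rewrite /s big_ord_recr /= addrAC subrr add0r; exact: zg.
exists l; last by have := lP 0%N; rewrite /s big_ord0 subr0 mulrA.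
have zgeom n : rnorm (z n) <= rnorm y / 2 ^+ n.
  elim: n => [|n IH]; first by rewrite expr0 divr1.
  by apply: le_trans (z2 n) _; rewrite exprS invfM; lra.
apply/esym/eqP; rewrite -subr_eq0; apply/eqP/rnorm_le0.
apply: (@le_geom_le0 _ _ ((1 + rnorm T * (2 * M)) * rnorm y)) => n.
apply: le_trans (rnorm_dist _ (T (s n)) _) _; rewrite sE -linearB.
have -> : s n - l = - (l - s n) by rewrite opprB.
rewrite linearN rnormN.
have h1 := le_trans (opnormP T (l - s n)) (ler_wpM2l (rnorm_ge0 T) (lP n)).
have h2 : rnorm T * (2 * (M * rnorm (z n))) <= rnorm T * (2 * M) * (rnorm y / 2 ^+ n).
  rewrite -!mulrA ler_wpM2l ?rnorm_ge0 // ler_wpM2l // ler_wpM2l //.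
have h3 := zgeom n.
rewrite mulrDl mul1r mulrDl -!mulrA in h1 h2 *; lra.
Qed.

Lemma closed_rnormP (F : normedModType C) (V : set F) :
  closed V <-> forall y, (forall e : R, 0 < e -> exists2 v, V v & rnorm (y - v) < e) -> V y.
Proof.
split=> [cV y yV|cV y yV].
  apply: cV => B /nbhs_ballP[e /= e0 eB].
  have [v Vv ve] := yV (complex.Re e) (ltac:(by move: e0; rewrite ltcE => /andP[])).
  exists v; split => //; apply: eB; rewrite -ball_normE /= normE.
  by rewrite -(ge0_Re (ltW e0)) ltcR.
apply: cV => e e0; have e0' : 0 < e%:C%C :> C by rewrite ltcR.
have [v [Vv]] := yV _ (nbhsx_ballx y _ e0').
by rewrite -ball_normE /= normE ltcR => ve; exists v.
Qed.

Lemma rnorm_eq0E (F : normedModType C) (y : F) : y != 0 -> 0 < rnorm y.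
Proof. by move=> y0; rewrite lt_neqAle rnorm_ge0 andbT; apply: contra_neq y0 => /esym h; apply: rnorm_le0; rewrite h. Qed.

(** A converse to the open mapping theorem. A point of the closure lies within half its norm of some
    [T x], and a bounded preimage of [T x] is the correction that [approx_solve] asks for; the
    remainders stay in the closure. *)
Lemma closed_range_of_bounded_preimage (E : completeNormedModType C)
    (F : normedModType C) (T : blin E F) (M : R) :
  0 <= M -> (forall x, exists2 x', T x' = T x & rnorm x' <= M * rnorm (T x)) ->
  closed (range T).
Proof.
move=> M0 TM; pose V := closure (range T).
suff h y : V y -> exists2 w, T w = y & rnorm w <= 2 * (2 * M) * rnorm y.
  by move=> y /h[w <- _]; exists w.
apply: (@approx_solve _ _ T V (2 * M)) => [|{}y Vy]; first by rewrite mulr_ge0.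
have [y0|y0] := eqVneq y 0.
  by exists 0; rewrite linear0 subr0; split => //; rewrite y0 !rnorm0 ?mul0r ?mulr0.
have /(_ (rnorm y / 2)) : forall e : R, 0 < e -> exists2 v, range T v & rnorm (y - v) < e.
  move=> e e0; have e0' : 0 < e%:C%C :> C by rewrite ltcR.
  have [v [Vv]] := Vy _ (nbhsx_ballx y _ e0').
  by rewrite -ball_normE /= normE ltcR => ve; exists v.
have yp := rnorm_eq0E y0.
case=> [|_ [x _ <-] yx]; first by rewrite divr_gt0.
have [x' x'x x'M] := TM x; exists x'; rewrite x'x; split; last 1 first.
- have : M * rnorm (T x) <= M * (2 * rnorm y).
    rewrite ler_wpM2l //; have := rnorm_dist (T x) y 0; rewrite !subr0 rdistC; lra.
  lra.
- move=> B /nbhs_ballP[e /= e0 eB].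
  have [_ [[w _ <-]]] := Vy _ (nbhsx_ballx y _ e0).
  rewrite -ball_normE /= => we; exists (T (w - x)); split; first by exists (w - x).
  by apply: eB; rewrite -ball_normE /= linearB opprB addrA subrK.
- exact: ltW.
Qed.

End Completeness.

(** * The open mapping and Hahn-Banach theorems *)

Section OpenMapping.
Variable R : realType.
Local Notation C := R[i].
Variables (E : completeNormedModType C) (F : completeNormedModType C) (T : blin E F).

(* The seminorms [inf_w (n * |y - T w| + |w|)], equivalent to the norm of [y] for
   each [n]; a gliding hump shows that they are bounded, uniformly in [n], on
   the closed range. *)
Let gauge (n : nat) (y : F) (c : R) :=
  exists w, n%:R * rnorm (y - T w) + rnorm w <= c.

Let gauge_le n y c c' : c <= c' -> gauge n y c -> gauge n y c'.
Proof. by move=> cc [w wc]; exists w; exact: le_trans wc cc. Qed.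

Let gaugeB n y y' c c' : gauge n y c -> gauge n y' c' -> gauge n (y - y') (c + c').
Proof.
move=> [w wc] [w' wc']; exists (w - w'); rewrite linearB.
have := rnormB (y - T w) (y' - T w'); have := rnormB w w'.
have -> : y - y' - (T w - T w') = y - T w - (y' - T w').
  by rewrite !opprD !opprK addrACA.
move=> h1 h2; have : n%:R * rnorm (y - T w - (y' - T w')) <=
  n%:R * (rnorm (y - T w) + rnorm (y' - T w')) by rewrite ler_wpM2l.
rewrite mulrDr; lra.
Qed.

Let gaugeZ n y c (a : R) : gauge n y c -> gauge n (a%:C%C *: y) (`|a| * c).
Proof.
move=> [w wc]; exists (a%:C%C *: w); rewrite linearZ -scalerBr !rnormZr.
by rewrite mulrCA -mulrDr ler_wpM2l.
Qed.

Let gauge0 n y : gauge n y (n%:R * rnorm y).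
Proof. by exists 0; rewrite linear0 subr0 rnorm0 addr0. Qed.

Let gauge_range n w : gauge n (T w) (rnorm w).
Proof. by exists w; rewrite subrr rnorm0 mulr0 add0r. Qed.

(** If the gauges are bounded on the unit ball of the range, uniformly in [n], successive
    approximation applies. Otherwise a gliding hump yields a Cauchy sequence in the range along
    which gauges exceed every bound, whereas all gauges of its limit [T w] are at most [rnorm w]. *)
Lemma open_mapping : closed (range T) ->
  exists2 M : R, 0 <= M &
    forall x, exists2 x', T x' = T x & rnorm x' <= M * rnorm (T x).
Proof.
move=> cT.
have [[M [M0 TM]]|noM] := pselect (exists M : R, 0 <= M /\
    forall n x, rnorm (T x) <= 1 -> gauge n (T x) M).
  have TM' n x : gauge n (T x) (M * rnorm (T x)).
    have [->|Tx0] := eqVneq (T x) 0.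
      by rewrite rnorm0 mulr0 -(linear0 T) -(rnorm0 E); exact: gauge_range.
    have p := rnorm_eq0E Tx0.
    have := TM n ((rnorm (T x))^-1%:C%C *: x); rewrite linearZ rnormZr.
    rewrite ger0_norm ?invr_ge0 ?rnorm_ge0 // mulVf ?gt_eqF // => /(_ (lexx _)).
    move=> /(gaugeZ (rnorm (T x))); rewrite scalerA -rmorphM mulfV ?gt_eqF //.
    by rewrite scale1r ger0_norm ?rnorm_ge0 // mulrC.
  exists (2 * M) => [|x]; first by rewrite mulr_ge0.
  apply: (@approx_solve _ _ _ T (range T)) => // y [v _ <-].
  (* For [n > 2 * M], a gauge of at most [M * rnorm (T v)] forces the remainder [T v - T w] below
     half the norm of [T v]. *)
  pose n := Num.bound (2 * M); have := archi_boundP (mulr_ge0 (ler0n R 2) M0).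
  rewrite -/n => nM; have n0 : 0 < n%:R :> R by apply: le_lt_trans nM; rewrite mulr_ge0.
  have [w wM] := TM' n v; exists w; split.
  - by exists (v - w); rewrite ?linearB.
  - rewrite -(ler_pM2l n0).
    have := rnorm_ge0 w; have : 2 * M * rnorm (T v) <= n%:R * rnorm (T v).
      by rewrite ler_wpM2r ?rnorm_ge0 // ltW.
    lra.
  - by apply: le_trans wM; rewrite lerDr mulr_ge0 ?rnorm_ge0.
have bad (M : R) : 0 <= M -> exists n x, rnorm (T x) <= 1 /\ ~ gauge n (T x) M.
  move=> M0; apply: contrapT => h; apply: noM; exists M; split => // n x Tx1.
  by apply: contrapT => g; apply: h; exists n, x.
(* One hump: [v.1] is a preimage of the current point and [v.2] the distance by which the next point
   may move. *)
have step (k : nat) (v : E * R) : exists w : E * R, 0 < v.2 ->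
    [/\ 0 < w.2, w.2 <= v.2 / 2, rnorm (T w.1 - T v.1) <= v.2 &
     exists2 n, n%:R * (2 * w.2) <= 1 & ~ gauge n (T w.1) k%:R].
  case: v => x r /=; have [r0|] := pselect (0 < r); last by exists (0, 0).
  have [n [y [y1 yM]]] := bad (k%:R / r) (divr_ge0 (ler0n _ _) (ltW r0)).
  have [x' [xx' gx']] : exists x', rnorm (T x' - T x) <= r /\ ~ gauge n (T x') k%:R.
    apply: contrapT => h; apply: yM.
    have g (s : R) : `|s| = r -> gauge n (T x + s%:C%C *: T y) k%:R.
      move=> sr; apply: contrapT => gn; apply: h; exists (x + s%:C%C *: y).
      rewrite linearD linearZ; split => //; rewrite addrAC subrr add0r rnormZr sr.
      by rewrite ler_piMr // ltW.
    (* If [T x + r T y] and [T x - r T y] both had gauge at most [k], then [T y], their difference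
       divided by [2 * r], would have gauge at most [k / r]. *)
    have := gaugeB (g r (gtr0_norm r0)) (g (- r) (etrans (normrN r) (gtr0_norm r0))).
    have -> : T x + r%:C%C *: T y - (T x + (- r)%:C%C *: T y) = (2 * r)%:C%C *: T y.
      by rewrite opprD addrACA subrr add0r rmorphN scaleNr opprK -scalerDl mulrDl !mul1r rmorphD.
    move=> /(gaugeZ (2 * r)^-1); rewrite scalerA -rmorphM mulVf ?scale1r; last first.
      by rewrite gt_eqF ?mulr_gt0.
    rewrite ger0_norm ?invr_ge0 ?mulr_ge0 ?(ltW r0) //; apply: gauge_le.
    by rewrite -mulr2n -[(k%:R *+ 2)]mulr_natl invfM mulrCA !mulrA mulfV ?mul1r ?pnatr_eq0 // mulrC.
  (* The second bound on the radius keeps the [n]-th gauge of the limit within 1 of that of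
     [T x']. *)
  exists (x', Num.min (r / 2) (2 * n.+1%:R)^-1) => _ /=; split => //.
  - by rewrite lt_min divr_gt0 //= invr_gt0 mulr_gt0 // ltr0n.
  - by rewrite ge_min lexx.
  - exists n => //; apply: (@le_trans _ _ (n%:R * (2 * (2 * n.+1%:R)^-1))).
      by rewrite ler_wpM2l // ler_wpM2l // ge_min lexx orbT.
    by rewrite invfM (mulrA 2) mulfV ?pnatr_eq0 // mul1r ler_pdivrMr ?ltr0n // mul1r ler_nat.
have [f fP] := choice (fun kv : nat * (E * R) => step kv.1 kv.2).
pose z := fix z n : E * R := if n is m.+1 then f (m, z m) else (0, 1).
have z0 n : 0 < (z n).2 by elim: n => //= n /(fP (n, z n))[].
have zP n := fP (n, z n) (z0 n).
have [||l lP] := @rnorm_cauchy_cvg _ F (fun n => T (z n).1) (fun n => (z n).2).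
- by move=> n; case: (zP n).
- by move=> n; case: (zP n).
have [w _ wl] : range T l.
  have /closed_rnormP clT := cT; apply: clT => e e0; apply: contrapT => h.
  suff : e <= 0 by rewrite leNgt e0.
  apply: (@le_geom_le0 _ _ 2) => n; rewrite leNgt; apply/negP => ne; apply: h.
  exists (T (z n).1); first by exists (z n).1.
  apply: le_lt_trans (lP n) _; apply: le_lt_trans ne; rewrite ler_wpM2l //.
  elim: n => [|n IH]; first by rewrite expr0 invr1.
  by case: (zP n) => _ /= + _ _; rewrite exprS invfM; lra.
(* At stage [k] the gauge exceeds [k], hence exceeds [rnorm w] by more than the 1 lost in the
   limit. *)
pose k := Num.bound (rnorm w + 1).
have kw : rnorm w + 1 < k%:R by apply: archi_boundP; have := rnorm_ge0 w; lra.
have [_ _ _ [n nz ng]] := zP k; exfalso; apply: ng.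
have := gaugeB (gauge_range n w) (gauge0 n (T w - T (z k.+1).1)).
rewrite opprB addrC subrK wl; apply: gauge_le.
have h := lP k.+1; have : n%:R * rnorm (l - T (z k.+1).1) <= n%:R * (2 * (z k.+1).2).
  by rewrite ler_wpM2l.
have -> : z k.+1 = f (k, z k) by [].
move: nz; lra.
Qed.

End OpenMapping.

Section HahnBanach.
Variable R : realType.
Local Notation C := R[i].
Variables (E : lmodType C) (p : E -> R).
Hypothesis pD : forall x y, p (x + y) <= p x + p y.
Hypothesis pZ : forall (a : C) x, p (a *: x) = rnorm (a : C^o) * p x.

Let p0 : p 0 = 0.
Proof. by rewrite -(scale0r 0) pZ rnorm0 mul0r. Qed.

Let pZr (a : R) x : p (a%:C%C *: x) = `|a| * p x.
Proof. by rewrite pZ; congr (_ * _); rewrite /rnorm normc_def /= expr0n /= addr0 sqrtr_sqr. Qed.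

Let pN x : p (- x) = p x.
Proof. by rewrite -scaleN1r pZ /rnorm normrN1 mul1r. Qed.

Let p_ge0 x : 0 <= p x.
Proof. by have := pD x (- x); rewrite subrr p0 pN; lra. Qed.

(** Zorn's lemma is applied to graphs of real-linear functionals dominated by [p]; single-valuedness
    follows from the domination, as [p 0 = 0]. *)
Lemma real_hahn_banach z : exists g : E -> R,
  [/\ forall (s t : R) x y, g (s%:C%C *: x + t%:C%C *: y) = s * g x + t * g y,
      forall x, g x <= p x & g z = p z].
Proof.
(* The point [(z, p z)] is demanded of nonempty graphs only, since the union of the empty chain is
   empty. *)
pose good (A : set (E * R)) := [/\ A !=set0 -> A (z, p z),
  forall (s t : R) u v, A u -> A v ->
    A (s%:C%C *: u.1 + t%:C%C *: v.1, s * u.2 + t * v.2) &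
  forall u, A u -> u.2 <= p u.1].
have [|A [[Az Alin Ap] Amax]] := @Zorn_bigcup _ good.
  move=> FF FFgood FFtot; split.
  - by move=> [u [X XF Xu]]; exists X => //; case: (FFgood _ XF) => + _ _; apply; exists u.
  - move=> s t u v [X XF Xu] [Y YF Yv].
    have [XY|YX] := FFtot _ _ XF YF.
      by exists Y => //; case: (FFgood _ YF) => _ + _; apply => //; exact: XY.
    by exists X => //; case: (FFgood _ XF) => _ + _; apply => //; exact: YX.
  - by move=> u [X XF Xu]; case: (FFgood _ XF) => _ _; apply.
have {}Az : A (z, p z).
  apply: Az; apply: contrapT => A0.
  (* The real line through [z] would properly extend an empty graph. *)
  pose B : set (E * R) := [set u | exists t : R, u = (t%:C%C *: z, t * p z)].
  apply: (Amax B).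
    split=> [u Au|BA]; first by exfalso; apply: A0; exists u.
    by apply: A0; exists (1%:C%C *: z, 1 * p z); apply: BA; exists 1.
  split=> [_|s t _ _ [a ->] [b ->]|_ [t ->]] /=.
  - by exists 1; rewrite rmorph1 scale1r mul1r.
  - exists (s * a + t * b); rewrite rmorphD !rmorphM scalerDl !scalerA; congr (_, _).
    by rewrite mulrDl !mulrA.
  - by rewrite pZr ler_wpM2r ?p_ge0 ?ler_norm.
have AZ (s : R) u : A u -> A (s%:C%C *: u.1, s * u.2).
  by move=> Au; have := Alin s 0 u u Au Au; rewrite rmorph0 scale0r mul0r !addr0.
have AD u v : A u -> A v -> A (u.1 + v.1, u.2 + v.2).
  by move=> Au Av; have := Alin 1 1 u v Au Av; rewrite rmorph1 !scale1r !mul1r.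
have Afun x a b : A (x, a) -> A (x, b) -> a = b.
  have le a' b' : A (x, a') -> A (x, b') -> a' <= b'.
    move=> Aa Ab; have /Ap := Alin 1 (-1) _ _ Aa Ab; rewrite /= rmorphN rmorph1 scale1r.
    by rewrite scaleN1r subrr p0 mul1r mulN1r subr_le0.
  by move=> Aa Ab; apply/eqP; rewrite eq_le !le.
have Atot x : exists a, A (x, a).
  apply: contrapT => nx.
  (* Extension by one dimension: the value at [x] must lie above all [u.2 - p (u.1 - x)] and below
     all [p (v.1 + x) - v.2]; the supremum of the former will do. *)
  pose S := [set u.2 - p (u.1 - x) | u in A].
  have Sub u : A u -> forall v, A v -> u.2 - p (u.1 - x) <= p (v.1 + x) - v.2.
    move=> Au v Av; have /Ap/= := AD _ _ Au Av.
    have := pD (u.1 - x) (v.1 + x); rewrite addrACA [- x + x]addrC subrr addr0; lra.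
  have Ssup : has_sup S.
    split; first by exists (p z - p (z - x)), (z, p z).
    by exists (p (z + x) - p z) => _ [u Au <-]; exact: (Sub u Au (z, p z) Az).
  pose c := sup S.
  have c1 u : A u -> u.2 - p (u.1 - x) <= c.
    by move=> Au; apply: (sup_upper_bound Ssup); exists u.
  have c2 v : A v -> c <= p (v.1 + x) - v.2.
    move=> Av; apply: ge_sup => [|_ [u Au <-]]; first by case: Ssup.
    exact: Sub.
  pose B : set (E * R) := [set w | exists u (t : R), A u /\
    w = (u.1 + t%:C%C *: x, u.2 + t * c)].
  apply: (Amax B).
    split=> [[a b] Au|BA].
      by exists (a, b), 0; rewrite rmorph0 scale0r mul0r !addr0.
    apply: nx; exists c; apply: BA; exists (0%:C%C *: z, 0 * p z), 1; split.
      exact: (AZ 0 (z, p z)).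
    by rewrite rmorph0 scale0r rmorph1 scale1r mul0r mul1r !add0r.
  split=> [_|s t _ _ [u [a [Au ->]]] [v [b [Av ->]]]|_ [u [t [Au ->]]]] /=.
  - by exists (z, p z), 0; rewrite rmorph0 scale0r mul0r !addr0.
  - exists (s%:C%C *: u.1 + t%:C%C *: v.1, s * u.2 + t * v.2), (s * a + t * b).
    split; first exact: Alin.
    congr (_, _) => /=; last by ring.
    by rewrite !scalerDr !scalerA rmorphD !rmorphM scalerDl addrACA.
  - have [t0|t0|->] := ltgtP t 0; last first.
    + by rewrite rmorph0 scale0r mul0r !addr0; exact: Ap.
    + have /c2/= := AZ t^-1 u Au.
      rewrite lerBrDr -(ler_pM2l t0) mulrDr mulrA mulfV ?gt_eqF // mul1r.
      rewrite -{2}(gtr0_norm t0) -pZr scalerDr scalerA -rmorphM mulfV ?gt_eqF //.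
      by rewrite rmorph1 scale1r addrC.
    + have /c1/= := AZ (- t)^-1 u Au; rewrite -oppr_gt0 in t0.
      rewrite lerBlDr -(ler_pM2l t0) mulrDr mulrA mulfV ?gt_eqF // mul1r.
      rewrite -{2}(gtr0_norm t0) -pZr scalerBr scalerA -rmorphM mulfV ?gt_eqF //.
      rewrite rmorph1 scale1r rmorphN scaleNr opprK; lra.
have [g gP] := choice Atot; exists g; split.
- by move=> s t x y; apply: Afun (gP _) _; exact: Alin _ _ _ _ (gP x) (gP y).
- by move=> x; exact: Ap (gP x).
- exact: Afun (gP _) Az.
Qed.

(** A complex-linear functional is determined by its real part [g], through
    [u x = g x - i g (i x)]. *)
Lemma hahn_banach z : exists u : E -> C^o,
  [/\ linear u, forall x, rnorm (u x) <= p x & p z <= rnorm (u z)].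
Proof.
have [g [glin gp gz]] := real_hahn_banach z.
have gD x y : g (x + y) = g x + g y.
  by have := glin 1 1 x y; rewrite rmorph1 !scale1r !mul1r.
have gZ (s : R) x : g (s%:C%C *: x) = s * g x.
  by have := glin s 0 x x; rewrite rmorph0 scale0r mul0r !addr0.
pose u x : C^o := (g x +i* - g ('i%C *: x))%C.
have uRe x : complex.Re (u x) <= rnorm (u x).
  rewrite -lecR -normE; apply: le_trans (_ : `|complex.Re (u x)|%:C%C <= _).
    by rewrite lecR ler_norm.
  exact: normc_ge_Re.
have ulin : linear u.
  move=> [a b] x y; rewrite /u scalerDr !gD.
  have -> : (a +i* b)%C *: x = a%:C%C *: x + b%:C%C *: ('i%C *: x).
    rewrite scalerA -scalerDl; congr (_ *: _); simpc; rewrite //.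
  have -> : 'i%C *: (a%:C%C *: x + b%:C%C *: ('i%C *: x)) = a%:C%C *: ('i%C *: x) + (- b)%:C%C *: x.
    rewrite scalerDr !scalerA [_ * a%:C%C]mulrC; congr (_ + _ *: _); simpc; rewrite //.
  rewrite !gD !gZ /GRing.scale /=; simpc; congr (_ +i* _)%C; ring.
exists u; split => //; last by apply: le_trans (uRe z); rewrite /= gz.
move=> x; have [->|ux] := eqVneq (u x) 0; first by rewrite rnorm0.
have ux0 := rnorm_eq0E ux.
(* A scalar of modulus 1 rotates [u x] onto the positive axis, where [u] coincides with [g]. *)
pose t : C := (rnorm (u x))%:C%C / (u x : C).
have tux : u (t *: x) = (rnorm (u x))%:C%C.
  have g0 : g 0 = 0 by have := gZ 0 0; rewrite scaler0 mul0r.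
  have u0 : u 0 = 0 by rewrite /u scaler0 g0 oppr0.
  have -> : u (t *: x) = t *: u x by have := ulin t x 0; rewrite u0 !addr0.
  by rewrite /t /GRing.scale /= divfK.
have := gp (t *: x); have -> : g (t *: x) = complex.Re (u (t *: x)) by [].
rewrite tux /= pZ => h; apply: le_trans h _.
suff -> : rnorm (t : C^o) = 1 by rewrite mul1r.
apply: complexI; rewrite -normE /t normrM normfV -!normE.
by rewrite normr_id mulfV // normr_eq0.
Qed.

End HahnBanach.

(** * Graded complexes of Banach spaces *)

Lemma sum_single (V : nmodType) (I : finType) (i0 : I) (F : I -> V) :
  (forall i, i != i0 -> F i = 0) -> \sum_i F i = F i0.
Proof. by move=> F0; rewrite (bigD1 i0) //= big1 ?addr0. Qed.

Section BlinMorph.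
Variables (R : realType) (X Y : normedModType R[i]).
Implicit Types S T : blin X Y.
(* Variants of [linearD] etc. that keep the head symbol [blin_fun]. *)
Lemma blinD T x y : T (x + y) = T x + T y. Proof. exact: linearD. Qed.
Lemma blinB T x y : T (x - y) = T x - T y. Proof. exact: linearB. Qed.
Lemma blinZ T (a : R[i]) x : T (a *: x) = a *: T x. Proof. exact: linearZ. Qed.
Lemma blin0 T : T 0 = 0. Proof. exact: linear0. Qed.
Lemma blin_sum T I (r : seq I) (P : pred I) F :
  T (\sum_(i <- r | P i) F i) = \sum_(i <- r | P i) T (F i).
Proof. exact: linear_sum. Qed.
Lemma add_blinE S T x : (S + T) x = S x + T x. Proof. by []. Qed.
Lemma opp_blinE T x : (- T) x = - T x. Proof. by []. Qed.
Lemma sub_blinE S T x : (S - T) x = S x - T x. Proof. by []. Qed.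
Lemma scale_blinE (a : R[i]) T x : (a *: T) x = a *: T x. Proof. by []. Qed.
Lemma zero_blinE x : (0 : blin X Y) x = 0. Proof. by []. Qed.
Lemma sum_blinE I (r : seq I) (P : pred I) (F : I -> blin X Y) x :
  (\sum_(i <- r | P i) F i) x = \sum_(i <- r | P i) F i x.
Proof. by elim/big_rec2: _ => // i y T _ <-. Qed.
End BlinMorph.

Lemma comp_blinE (R : realType) (X Y Z : normedModType R[i]) (S : blin Y Z)
    (T : blin X Y) x : bcomp S T x = S (T x).
Proof. by []. Qed.

Section BlinRing.
Variables (R : realType) (X : normedModType R[i]).
Lemma blin_mulA : associative (fun S T : 'L(X) => bcomp S T).
Proof. by move=> S T U; exact: blinP. Qed.
Lemma blin_mul1 : left_id (bid X) (fun S T : 'L(X) => bcomp S T).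
Proof. by move=> S; exact: blinP. Qed.
Lemma blin_mulr1 : right_id (bid X) (fun S T : 'L(X) => bcomp S T).
Proof. by move=> S; exact: blinP. Qed.
Lemma blin_mulDl : left_distributive (fun S T : 'L(X) => bcomp S T) +%R.
Proof. by move=> S T U; exact: blinP. Qed.
Lemma blin_mulDr : right_distributive (fun S T : 'L(X) => bcomp S T) +%R.
Proof. by move=> S T U; apply: blinP => x; rewrite /= blinD. Qed.
(** Composition becomes a product, so that operator identities are ring identities; [1 = 0] is
    allowed because [X] may be zero. *)
HB.instance Definition _ := GRing.Zmodule_isPzRing.Build 'L(X)
  blin_mulA blin_mul1 blin_mulr1 blin_mulDl blin_mulDr.
Lemma mul_blinE (S T : 'L(X)) x : (S * T) x = S (T x). Proof. by []. Qed.
Lemma one_blinE x : (1 : 'L(X)) x = x. Proof. by []. Qed.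
Lemma scaler_blinAl (a : R[i]) (S T : 'L(X)) : a *: (S * T) = (a *: S) * T.
Proof. exact: blinP. Qed.
Lemma scaler_blinAr (a : R[i]) (S T : 'L(X)) : a *: (S * T) = S * (a *: T).
Proof. by apply: blinP => x; rewrite mul_blinE !scale_blinE blinZ. Qed.
End BlinRing.

Section SeminormOfOperator.
Variables (R : realType) (E F : normedModType R[i]) (T : blin E F) (e : R).
Hypothesis e_gt0 : 0 < e.

Let costs (y : F) := [set rnorm (y - T w) + e * rnorm w | w in [set: E]].

(* The largest seminorm below the norm that is at most [e * rnorm w] at [T w]. *)
Definition cost (y : F) : R := inf (costs y).

Let costs_lb y : lbound (costs y) 0.
Proof. by move=> _ [w _ <-]; rewrite addr_ge0 ?mulr_ge0 ?rnorm_ge0 // ltW. Qed.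

Let costs_n0 y : costs y !=set0.
Proof. by exists (rnorm (y - T 0) + e * rnorm (0 : E)), 0. Qed.

Lemma cost_le y w : cost y <= rnorm (y - T w) + e * rnorm w.
Proof. by apply: ge_inf; [exists 0; exact: costs_lb|exists w]. Qed.

Lemma le_cost c y :
  (forall w, c <= rnorm (y - T w) + e * rnorm w) -> c <= cost y.
Proof. by move=> h; apply: lb_le_inf => // _ [w _ <-]. Qed.

Lemma cost_le_norm y : cost y <= rnorm y.
Proof. by have := cost_le y 0; rewrite blin0 subr0 rnorm0 mulr0 addr0. Qed.

Lemma cost_range w : cost (T w) <= e * rnorm w.
Proof. by have := cost_le (T w) w; rewrite subrr rnorm0 add0r. Qed.

Lemma cost_ge0 y : 0 <= cost y.
Proof. by apply: lb_le_inf => //; exact: costs_lb. Qed.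

Lemma costD x y : cost (x + y) <= cost x + cost y.
Proof.
rewrite -lerBlDr; apply: le_cost => w; rewrite lerBlDr addrC -lerBlDl.
apply: le_cost => v; rewrite lerBlDl.
apply: le_trans (cost_le _ (v + w)) _; rewrite blinD opprD addrACA.
have := rnormD (y - T v) (x - T w); have := rnormD v w.
move=> h1 h2; have := ler_wpM2l (ltW e_gt0) h1; lra.
Qed.

Lemma costZ (a : R[i]) x : cost (a *: x) = rnorm (a : R[i]^o) * cost x.
Proof.
have le b y : cost (b *: y) <= rnorm (b : R[i]^o) * cost y.
  have [->|b0] := eqVneq b 0.
    by rewrite scale0r rnorm0 mul0r -(rnorm0 F); exact: cost_le_norm.
  have bp := @rnorm_eq0E R R[i]^o b b0.
  rewrite mulrC -ler_pdivrMr //; apply: le_cost => w; rewrite ler_pdivrMr // mulrC.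
  apply: le_trans (cost_le _ (b *: w)) _.
  by rewrite blinZ -scalerBr !rnormZ mulrDr mulrCA.
apply/eqP; rewrite eq_le le /=.
have [->|a0] := eqVneq a 0; first by rewrite rnorm0 mul0r cost_ge0.
have ap := @rnorm_eq0E R R[i]^o a a0.
rewrite mulrC -ler_pdivlMr // mulrC.
have := le a^-1 (a *: x); rewrite scalerK //; congr (_ <= _ * _).
by apply: complexI; rewrite -normE normfV normE fmorphV.
Qed.

End SeminormOfOperator.

Section GradedComplexes.
Variable R : realType.
Local Notation C := R[i].

Section Def.
Variables (G : completeNormedModType C) (N : nat) (D : 'L(G)) (P : int -> 'L(G)).

(** All degrees are gathered in one space [G] with projections [P p], so that differentials and
    homotopies are endomorphisms and no transport between degrees occurs. Degrees outside
    [0, ..., N - 1] vanish by [gr_sum]. *)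
Record graded_complex : Prop := {
  gr_idem : forall p, P p * P p = P p;
  gr_orth : forall p q, p != q -> P p * P q = 0;
  gr_sum : \sum_(q < N) P q%:Z = 1;
  gr_diff : forall p, D * P p = P (p - 1) * D;
  gr_square0 : D * D = 0 }.

(** The degree of [v] is left free: its component of degree [p + 1] has the same image in degree
    [p]. *)
Definition gexact (p : int) : Prop :=
  forall u, P p u = u -> D u = 0 -> exists v, D v = u.

Definition gclosed (p : int) : Prop := closed (range (D * P p)).

(** One operator stands for both [h_p] and [h_(p-1)], as these act on different components. It may
    fail to be homogeneous; [gr_homotopy] repairs this. *)
Definition gsplit (p : int) : Prop :=
  exists H : 'L(G), forall u, P p u = u -> D (H u) + H (D u) = u.

(* Approximate cycles [x] of degree [p] and functionals [u] that nearly vanish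
   on boundaries but not at [x]; genuine cycles if [strict]. *)
Definition approx_cycles (strict : bool) (p : int) : Prop :=
  exists2 c : R, 0 <= c & forall e : R, 0 < e -> exists x (u : blin G C^o),
    [/\ P p x = x, rnorm x = 1, 2^-1 <= rnorm (u x) & rnorm u <= c] /\
    [/\ rnorm (D x) <= e, forall w, rnorm (u (D w)) <= e * rnorm w &
        strict -> D x = 0].

End Def.

Section Theory.
Variables (G : completeNormedModType C) (N : nat) (D : 'L(G)) (P : int -> 'L(G)).
Hypothesis gc : graded_complex N D P.

Lemma gr_diffE p u : D (P p u) = P (p - 1) (D u).
Proof. by have /(congr1 (fun T : 'L(G) => T u)) := gr_diff gc p. Qed.

Lemma gr_diffS p u : D (P (p + 1) u) = P p (D u).
Proof. by rewrite gr_diffE addrK. Qed.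

Lemma gr_idemE p u : P p (P p u) = P p u.
Proof. by have /(congr1 (fun T : 'L(G) => T u)) := gr_idem gc p. Qed.

Lemma gr_orthE p q u : p != q -> P p (P q u) = 0.
Proof. by move=> /(gr_orth gc)/(congr1 (fun T : 'L(G) => T u)). Qed.

Lemma gr_square0E u : D (D u) = 0.
Proof. by have /(congr1 (fun T : 'L(G) => T u)) := gr_square0 gc. Qed.

Lemma gr_out p : (forall i : 'I_N, p <> i%:Z) -> P p = 0.
Proof.
move=> pN; rewrite -[P p]mulr1 -(gr_sum gc) mulr_sumr big1 // => i _.
by apply: (gr_orth gc); apply/eqP.
Qed.

Lemma gr_ext (S T : 'L(G)) : (forall p, S * P p = T * P p) -> S = T.
Proof.
move=> ST; rewrite -[S]mulr1 -[T]mulr1 -(gr_sum gc) !mulr_sumr.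
by apply: eq_bigr => i _.
Qed.

Lemma gr_closed_ker (T : 'L(G)) : closed [set u | T u = 0].
Proof.
apply/closed_rnormP => y yV; apply: rnorm_le0; rewrite leNgt; apply/negP => y0.
have Tp : 0 < rnorm T + 1 by rewrite ltr_wpDl ?rnorm_ge0.
have [v /= Tv vy] := yV _ (divr_gt0 y0 Tp).
move: vy; rewrite ltr_pdivlMr // mulrC; have := opnormP T (y - v).
rewrite blinB Tv subr0; have := rnorm_ge0 (y - v); lra.
Qed.

Lemma gsplit_exact p : gsplit D P p -> gexact D P p.
Proof. by move=> [H HP] u uP Du; exists (H u); have := HP u uP; rewrite Du blin0 addr0. Qed.

(** Applying [D] to the homotopy identity gives [D H D = D] in degree [p], so that the range
    consists of the fixed points of [D * P p * H]. *)
Lemma gsplit_closed p : gsplit D P p -> gclosed D P p.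
Proof.
move=> [H HP]; rewrite /gclosed.
suff -> : range (D * P p) = [set u | (D * P p * H - 1) u = 0] by exact: gr_closed_ker.
apply/seteqP; split => [_ [u _ <-]|y].
  have := HP (P p u) (gr_idemE _ _); move/(congr1 D); rewrite blinD gr_square0E add0r.
  move=> h; change ((D * P p * H - 1) ((D * P p) u) = 0).
  rewrite sub_blinE !mul_blinE one_blinE.
  by rewrite [D (P p (H _))]gr_diffE h gr_diffE gr_idemE subrr.
move=> h; move: (h : (D * P p * H - 1) y = 0); rewrite sub_blinE one_blinE => /eqP.
by rewrite subr_eq0 => /eqP yE; exists (H y).
Qed.

Lemma gr_next p w : P p ((D * P (p + 1)) w) = (D * P (p + 1)) w.
Proof. by rewrite -[(D * P (p + 1)) w]/(D (P (p + 1) w)) gr_diffS gr_idemE. Qed.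

Lemma gr_diff_next p w : D ((D * P (p + 1)) w) = 0.
Proof. exact: gr_square0E. Qed.

(** Exactness identifies the range with the cycles of degree [p], which form an intersection of
    kernels. *)
Lemma gexact_closed p : gexact D P p -> gclosed D P (p + 1).
Proof.
move=> ex; rewrite /gclosed.
suff -> : range (D * P (p + 1)) = [set z | (P p - 1) z = 0] `&` [set z | D z = 0].
  by apply: closedI; exact: gr_closed_ker.
apply/seteqP; split => [_ [w _ <-]|z [Pz Dz]].
  split; last exact: gr_diff_next.
  by change ((P p - 1) ((D * P (p + 1)) w) = 0); rewrite sub_blinE one_blinE gr_next subrr.
move: (Pz : (P p - 1) z = 0) => /eqP; rewrite sub_blinE one_blinE subr_eq0 => /eqP Pz'.
by have [w wz] := ex z Pz' Dz; exists w => //; rewrite mul_blinE gr_diffS wz.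
Qed.

Lemma gexact_neg : gexact D P (-1).
Proof.
by move=> u Pu _; exists 0; rewrite -Pu gr_out ?zero_blinE ?blin0 // => i; lia.
Qed.

(** If [x] is not within half its norm of a boundary with a controlled preimage, its [cost] is at
    least half its norm. Hahn-Banach for the seminorm [cost] then yields a functional that is large
    at [x] and small on boundaries. *)
Lemma not_approx_cycles s p : ~ approx_cycles D P s p ->
  exists2 e : R, 0 < e & forall x, P p x = x -> rnorm (D x) <= e * rnorm x ->
    (s -> D x = 0) -> exists w, rnorm (x - (D * P (p + 1)) w) <= rnorm x / 2 /\
      e * rnorm w <= rnorm x / 2.
Proof.
move=> nc; apply: contrapT => ne; apply: nc; exists (rnorm (P p)); first exact: rnorm_ge0.
move=> e e0; set T := D * P (p + 1) in ne *; apply: contrapT => nxu.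
apply: ne; exists e => // x Px Dx sDx; apply: contrapT => nw.
have x0 : x != 0.
  apply/eqP => x0; apply: nw; exists 0; rewrite x0 blin0 subr0 !rnorm0 mulr0 mul0r lexx //.
have xp := rnorm_eq0E x0.
have [u0 [lu0 u0p u0x]] := hahn_banach (costD T e0) (costZ T e0) x.
have u0b y : rnorm (u0 y) <= 1 * rnorm y.
  by rewrite mul1r; apply: le_trans (u0p y) _; exact: cost_le_norm.
pose u1 : blin G C^o := mk_blin_bounded lu0 u0b.
(* Composition with [P p] replaces [D w] by a value of [T], where [cost] is small; the bound on the
   norm becomes [rnorm (P p)]. *)
pose u := bcomp u1 (P p).
have xc : rnorm x / 2 <= cost T e x.
  apply: le_cost => w; rewrite leNgt; apply/negP => xw; apply: nw; exists w.
  have := rnorm_ge0 (x - T w); have := rnorm_ge0 w; have := mulr_ge0 (ltW e0) (rnorm_ge0 w).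
  by move=> *; split; lra.
have sc1 : `|(rnorm x)^-1| = (rnorm x)^-1 by rewrite ger0_norm // invr_ge0 ltW.
apply: nxu; exists ((rnorm x)^-1%:C%C *: x), u; split; split.
- by rewrite blinZ Px.
- by rewrite rnormZr sc1 mulVf // gt_eqF.
- rewrite blinZ rnormZr sc1 -[u x]/(u0 (P p x)) Px mulrC ler_pdivlMr // mulrC.
  by apply: le_trans u0x.
- apply: rnorm_opnorm_le => [|y]; first exact: rnorm_ge0.
  by apply: le_trans (u0b _) _; rewrite mul1r opnormP.
- by rewrite blinZ rnormZr sc1 mulrC ler_pdivrMr.
- move=> w; rewrite -[u (D w)]/(u0 (P p (D w))) -gr_diffS.
  by apply: le_trans (u0p _) _; exact: (@cost_range _ _ _ T e e0 w).
- by move=> /sDx h; rewrite blinZ h scaler0.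
Qed.

(** A cycle can be halved by subtracting a boundary with a controlled preimage, and the remainder is
    again a cycle, so successive approximation applies. *)
Lemma not_approx_cycles_exact s p : ~ approx_cycles D P s p -> gexact D P p.
Proof.
move=> /not_approx_cycles[e e0 h] u Pu Du.
have [|y [Py Dy]||w <- _] := @approx_solve _ _ _ (D * P (p + 1))
  [set y | P p y = y /\ D y = 0] (e^-1 / 2) _ _ u.
- by rewrite divr_ge0 // invr_ge0 ltW.
- have [||w [w1 w2]] := h y Py; rewrite ?Dy ?rnorm0 ?mulr_ge0 ?rnorm_ge0 // ?ltW //.
  exists w; split => //.
    by split; rewrite blinB ?Py ?gr_next // Dy gr_diff_next subr0.
  by rewrite -(ler_pM2l e0) !mulrA mulfV ?gt_eqF //; move: w2; lra.
- by [].
- by exists (P (p + 1) w).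
Qed.

(** Subtracting boundaries leaves [D y] unchanged and halves [y] as long as [D y] is small relative
    to [y]. Where this stops, a preimage of [D y] of norm at most [rnorm (D y) / e] is reached. *)
Lemma not_approx_cycles_closed p : ~ approx_cycles D P false p -> gclosed D P p.
Proof.
move=> /not_approx_cycles[e e0 h].
have red n : forall y, P p y = y -> e * rnorm y <= 2 ^+ n * rnorm (D y) ->
    exists x, [/\ P p x = x, D x = D y & e * rnorm x <= rnorm (D y)].
  elim: n => [|n IH] y Py yD; first by exists y; move: yD; rewrite expr0 mul1r.
  have [yD'|yD'] := leP (rnorm (D y)) (e * rnorm y); last by exists y; split=> //; exact: ltW.
  have [//|w [w1 _]] := h y Py yD'.
  have DE : D (y - (D * P (p + 1)) w) = D y by rewrite blinB gr_diff_next subr0.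
  have [||x [Px Dx xe]] := IH (y - (D * P (p + 1)) w).
  - by rewrite blinB Py gr_next.
  - by rewrite DE; have := ler_wpM2l (ltW e0) w1; move: yD; rewrite exprS; lra.
  - by exists x; rewrite Px Dx -DE.
apply: (@closed_range_of_bounded_preimage _ _ _ _ e^-1) => [|x]; first by rewrite invr_ge0 ltW.
have [Dx0|Dx0] := eqVneq (D (P p x)) 0.
  by exists 0; rewrite ?blin0 ?rnorm0 -[(D * P p) x]/(D (P p x)) Dx0 // rnorm0 mulr0.
have Dp := rnorm_eq0E Dx0.
(* The number of halvings after which the process has certainly stopped. *)
pose n := Num.bound (e * rnorm (P p x) / rnorm (D (P p x))).
have nP : e * rnorm (P p x) / rnorm (D (P p x)) < n%:R.
  by apply: archi_boundP; rewrite divr_ge0 ?rnorm_ge0 // mulr_ge0 ?rnorm_ge0 // ltW.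
have [|x' [Px' Dx' x'e]] := red n _ (gr_idemE p x).
  rewrite -ler_pdivrMr //; apply: ltW; apply: lt_le_trans nP _.
  by rewrite -natrX ler_nat; exact/ltnW/ltn_expl.
exists x'; first by rewrite -[LHS]/(D (P p x')) Px'.
by rewrite mulrC ler_pdivlMr // mulrC.
Qed.

(** Splittings in two neighbouring degrees may propose different inverses of the differential
    between them. A single degree 1 operator [K] with [D K D = D] is chosen, and [K * (1 - K * D)]
    is a homotopy in every split degree at once. *)
Lemma gr_homotopy : exists h : 'L(G),
  (forall p, h * P p = P (p + 1) * h) /\
  (forall p u, gsplit D P p -> P p u = u -> D (h u) + h (D u) = u).
Proof.
(* A splitting at either end of the differential from degree [q] to degree [q - 1] provides an
   inverse of it in the sense [D H D = D]. *)
have /choice[c cP] : forall q, exists H : 'L(G),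
    gsplit D P q \/ gsplit D P (q - 1) -> forall u, P q u = u -> P (q - 1) (D (H (D u))) = D u.
  move=> q; have [[H HP]|nq] := pselect (gsplit D P q).
    exists H => _ u uP; have /(congr1 D) := HP u uP; rewrite blinD gr_square0E add0r => ->.
    by rewrite -gr_diffE uP.
  have [[H HP]|nq'] := pselect (gsplit D P (q - 1)); last by exists 0; case.
  exists H => _ u uP; have := HP (D u); rewrite gr_square0E blin0 addr0.
  by move=> ->; rewrite -gr_diffE uP.
(* The chosen inverses are cut down to their homogeneous parts and added. *)
pose K : 'L(G) := \sum_(q < N) P q%:Z * c q%:Z * P (q%:Z - 1).
have PK p : P p * K = P p * c p * P (p - 1).
  have [[i pi]|pN] := pselect (exists i : 'I_N, p = i%:Z).
    rewrite mulr_sumr (bigD1 i) //= big1 => [|j ji].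
      by rewrite addr0 !mulrA -pi (gr_idem gc).
    by rewrite !mulrA (gr_orth gc) ?mul0r // pi eqz_nat eq_sym.
  rewrite (gr_out (p := p)) ?mul0r // => i pi; apply: pN; by exists i.
have KP p : K * P p = P (p + 1) * c (p + 1) * P p.
  have [[i pi]|pN] := pselect (exists i : 'I_N, p + 1 = i%:Z).
    rewrite mulr_suml (bigD1 i) //= big1 => [|j ji].
      by rewrite addr0 -pi addrK -!mulrA (gr_idem gc).
    by rewrite -!mulrA (gr_orth gc) ?mulr0 // subr_eq pi eqz_nat.
  rewrite (gr_out (p := p + 1)) ?mul0r => [|i pi]; last by apply: pN; exists i.
  rewrite mulr_suml big1 // => j _; rewrite -!mulrA (gr_orth gc) ?mulr0 //.
  by rewrite subr_eq; apply/eqP => pj; apply: pN; exists j.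
have KPE p u : P p u = u -> K u = P (p + 1) (c (p + 1) u).
  by move=> <-; have /(congr1 (fun T : 'L(G) => T u)) := KP p.
have PKE p u : P p u = u -> P (p + 1) (K u) = K u.
  by move=> uP; rewrite (KPE _ _ uP) gr_idemE.
have DKD q u : gsplit D P q \/ gsplit D P (q - 1) -> P q u = u -> D (K (D u)) = D u.
  move=> qs uP; rewrite (KPE (q - 1)) ?subrK; first by rewrite gr_diffE cP.
  by rewrite -gr_diffE uP.
exists (K * (1 - K * D)); split=> [p|p u ps uP].
  have KP' q : K * P q = P (q + 1) * K by rewrite KP PK addrK.
  rewrite -mulrA mulrBl mul1r -(mulrA K) (gr_diff gc) !mulrBr KP'.
  by rewrite (mulrA K (P _)) KP' subrK -!mulrA (mulrA K (P _)) KP' mulr1 -!mulrA.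
(* [v] is the cycle part of [u]. Exactness makes it a boundary, and [D K D = D] one degree higher
   gives [D (K v) = v]. *)
pose v := u - K (D u).
have DuP : P (p - 1) (D u) = D u by rewrite -gr_diffE uP.
have vP : P p v = v by rewrite blinB uP; have := PKE _ _ DuP; rewrite subrK => ->.
have Dv : D v = 0 by rewrite blinB (DKD p) ?subrr //; left.
have [w wv] := gsplit_exact ps vP Dv.
have vE : v = D (P (p + 1) w) by rewrite gr_diffS wv.
rewrite -[(K * _) u]/(K v) -[(K * _) (D u)]/(K (D u - K (D (D u)))).
have DKv : D (K v) = v by rewrite vE (DKD (p + 1)) ?gr_idemE //; right; rewrite addrK.
by rewrite gr_square0E blin0 subr0 DKv /v subrK.
Qed.

End Theory.
End GradedComplexes.

(** Meant for operators acting on different tensor factors: the sign in the second one makes the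
    cross terms cancel. *)
Lemma anticommD (A : pzRingType) (a b x y c d : A) :
  a * x + x * a = c -> b * x = - (x * b) -> a * y = - (y * a) ->
  b * y + y * b = d -> (a + b) * (x + y) + (x + y) * (a + b) = c + d.
Proof.
move=> <- bx ay <-; rewrite !mulrDl !mulrDr bx ay.
rewrite (addrACA (a * x)) (addrACA (a * x - x * b)) (addrACA (a * x)).
by rewrite (addrACA (- (y * a))) !addNr addr0 add0r.
Qed.

Section TensorStructure.
Variables (R : realType).
Local Notation C := R[i].

(* What is used of [is_tensor_product], up to equivalent norms. *)
Record tensor_structure (G1 G2 G : completeNormedModType C) (t : G1 -> G2 -> G)
    (tt : 'L(G1) -> 'L(G2) -> 'L(G)) : Prop := {
  ts_linl : forall y, linear (t^~ y);
  ts_linr : forall x, linear (t x);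
  ts_opl : forall S, linear (tt^~ S);
  ts_opr : forall T, linear (tt T);
  ts_op : forall T S x y, tt T S (t x y) = t (T x) (S y);
  ts_mul : forall T1 S1 T2 S2, tt T1 S1 * tt T2 S2 = tt (T1 * T2) (S1 * S2);
  ts_one : tt 1 1 = 1;
  ts_lower : exists2 c : R, 0 < c &
    forall x y, c * (rnorm x * rnorm y) <= rnorm (t x y);
  ts_upper : exists2 c : R, 0 <= c &
    forall x y, rnorm (t x y) <= c * (rnorm x * rnorm y);
  ts_op_upper : exists2 c : R, 0 <= c &
    forall T S, rnorm (tt T S) <= c * (rnorm T * rnorm S) }.

Section Theory.
Variables (G1 G2 G : completeNormedModType C) (t : G1 -> G2 -> G)
  (tt : 'L(G1) -> 'L(G2) -> 'L(G)).
Hypothesis ts : tensor_structure t tt.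

Lemma tsDl T T' S : tt (T + T') S = tt T S + tt T' S.
Proof. by have := ts_opl ts S 1 T T'; rewrite !scale1r. Qed.
Lemma tsDr T S S' : tt T (S + S') = tt T S + tt T S'.
Proof. by have := ts_opr ts T 1 S S'; rewrite !scale1r. Qed.
Lemma ts0l S : tt 0 S = 0.
Proof. by apply: (addrI (tt 0 S)); rewrite -tsDl !addr0. Qed.
Lemma ts0r T : tt T 0 = 0.
Proof. by apply: (addrI (tt T 0)); rewrite -tsDr !addr0. Qed.
Lemma tsZl a T S : tt (a *: T) S = a *: tt T S.
Proof. by have := ts_opl ts S a T 0; rewrite ts0l !addr0. Qed.
Lemma tsZr a T S : tt T (a *: S) = a *: tt T S.
Proof. by have := ts_opr ts T a S 0; rewrite ts0r !addr0. Qed.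
Lemma tsNl T S : tt (- T) S = - tt T S.
Proof. by rewrite -scaleN1r tsZl scaleN1r. Qed.
Lemma tsNr T S : tt T (- S) = - tt T S.
Proof. by rewrite -scaleN1r tsZr scaleN1r. Qed.
Lemma tsBl T T' S : tt (T - T') S = tt T S - tt T' S.
Proof. by rewrite tsDl tsNl. Qed.
Lemma tsBr T S S' : tt T (S - S') = tt T S - tt T S'.
Proof. by rewrite tsDr tsNr. Qed.
Lemma ts_suml I (r : seq I) (Q : pred I) F S :
  tt (\sum_(i <- r | Q i) F i) S = \sum_(i <- r | Q i) tt (F i) S.
Proof. by elim/big_rec2: _ => [|i y T _ <-]; rewrite ?ts0l ?tsDl. Qed.
Lemma ts_sumr I (r : seq I) (Q : pred I) F T :
  tt T (\sum_(i <- r | Q i) F i) = \sum_(i <- r | Q i) tt T (F i).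
Proof. by elim/big_rec2: _ => [|i y S _ <-]; rewrite ?ts0r ?tsDr. Qed.
Lemma tst0l y : t 0 y = 0.
Proof. by have := ts_linl ts y 1 0 0; rewrite !scale1r addr0 => /eqP; rewrite eq_sym -subr_eq0 addrK => /eqP. Qed.
Lemma tst0r x : t x 0 = 0.
Proof. by have := ts_linr ts x 1 0 0; rewrite !scale1r addr0 => /eqP; rewrite eq_sym -subr_eq0 addrK => /eqP. Qed.
Lemma tstZl a x y : t (a *: x) y = a *: t x y.
Proof. by have := ts_linl ts y a x 0; rewrite tst0l !addr0. Qed.
Lemma tstZr a x y : t x (a *: y) = a *: t x y.
Proof. by have := ts_linr ts x a y 0; rewrite tst0r !addr0. Qed.

Section Complexes.
Variables (N1 N2 N : nat) (D1 : 'L(G1)) (P1 : int -> 'L(G1)) (D2 : 'L(G2))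
  (P2 : int -> 'L(G2)) (D : 'L(G)) (P : int -> 'L(G)) (s : 'L(G1)).
Hypotheses (gc1 : graded_complex N1 D1 P1) (gc2 : graded_complex N2 D2 P2)
  (gc : graded_complex N D P).
Hypothesis sP : forall p, s * P1 p = (-1) ^+ absz p *: P1 p.
Hypothesis DE : D = tt D1 1 + tt s D2.
Hypothesis PE : forall i j, P (i + j) * tt (P1 i) (P2 j) = tt (P1 i) (P2 j).

Let sgnS (p : int) : (-1) ^+ absz (p + 1) = - (-1) ^+ absz p :> C.
Proof.
case: p => [n|[|n]]; rewrite ?addr0 //.
- by rewrite -[Posz n + 1]/(Posz (n + 1)) /= addn1 exprS mulN1r.
- by rewrite NegzE /= expr0 expr1 opprK.
- have -> : Negz n.+1 + 1 = Negz n by rewrite !NegzE; lia.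
  by rewrite -[absz (Negz n.+1)]/(n.+2) exprS mulN1r opprK.
Qed.

Lemma sign_square : s * s = 1.
Proof.
apply: (gr_ext gc1) => p; rewrite mul1r -mulrA sP -scaler_blinAr sP scalerA.
by rewrite -exprD addnn -signr_odd odd_double scale1r.
Qed.

Lemma sign_odd (T : 'L(G1)) : (forall p, T * P1 p = P1 (p + 1) * T) -> s * T = - (T * s).
Proof.
move=> TP; apply: (gr_ext gc1) => p; rewrite mulNr -!mulrA TP sP mulrA sP sgnS.
by rewrite -scaler_blinAr TP scaleNr mulNr scaler_blinAl.
Qed.

Lemma sign_diff : s * D1 = - (D1 * s).
Proof.
apply: (gr_ext gc1) => p; rewrite mulNr -!mulrA (gr_diff gc1) sP mulrA sP.
have := sgnS (p - 1); rewrite subrK => ->.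
by rewrite -scaler_blinAr (gr_diff gc1) scaleNr opprK scaler_blinAl.
Qed.

Let unit_sum : 1 = \sum_(i < N1) \sum_(j < N2) tt (P1 i%:Z) (P2 j%:Z).
Proof.
rewrite -(ts_one ts) -(gr_sum gc1) -(gr_sum gc2) ts_suml; apply: eq_bigr => i _.
exact: ts_sumr.
Qed.

Let tensorP (i j m : int) : i + j != m -> P m * tt (P1 i) (P2 j) = 0.
Proof.
by move=> ijm; rewrite -PE mulrA (gr_orth gc) ?mul0r // eq_sym.
Qed.

(** [PE] controls [P] on the left only; expanding the identity into bidegrees transfers this to the
    right. *)
Let Ptensor (i j m : int) : i + j != m -> tt (P1 i) (P2 j) * P m = 0.
Proof.
move=> ijm; rewrite -[LHS]mulr1 unit_sum mulr_sumr big1 // => k _.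
rewrite mulr_sumr big1 // => l _.
have [klm|klm] := eqVneq (k%:Z + l%:Z) m; last by rewrite -mulrA tensorP ?mulr0.
rewrite -mulrA -klm PE (ts_mul ts).
have [ik|ik] := eqVneq i k%:Z; last by rewrite (gr_orth gc1) // ts0l.
have [jl|jl] := eqVneq j l%:Z; last by rewrite (gr_orth gc2) // ts0r.
by move: ijm; rewrite ik jl klm eqxx.
Qed.

Lemma tensor_not_split (m : int) : ~ gsplit D P m ->
  exists i j : int, [/\ 0 <= i < N1%:Z, 0 <= j < N2%:Z, i + j = m,
    ~ gsplit D1 P1 i & ~ gsplit D2 P2 j].
Proof.
move=> nm; apply: contrapT => h; apply: nm.
have [h1 [h1P h1s]] := gr_homotopy gc1; have [h2 [_ h2s]] := gr_homotopy gc2.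
pose pi1 := 1 - (D1 * h1 + h1 * D1); pose pi2 := 1 - (D2 * h2 + h2 * D2).
have pi10 i : gsplit D1 P1 i -> pi1 * P1 i = 0.
  move=> si; apply: blinP => x; rewrite mul_blinE sub_blinE one_blinE add_blinE !mul_blinE.
  by rewrite (h1s _ _ si) ?(gr_idemE gc1) ?subrr.
have pi20 i : gsplit D2 P2 i -> pi2 * P2 i = 0.
  move=> si; apply: blinP => x; rewrite mul_blinE sub_blinE one_blinE add_blinE !mul_blinE.
  by rewrite (h2s _ _ si) ?(gr_idemE gc2) ?subrr.
have sh1 := sign_odd h1P; have sD := sign_diff; have ss := sign_square.
have spi : s * pi1 = pi1 * s.
  rewrite mulrBr mulrBl mulr1 mul1r mulrDr mulrDl !mulrA sD sh1 !mulNr -!mulrA sD sh1.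
  by rewrite !mulrN !opprK.
have Dpi : D1 * pi1 = pi1 * D1.
  rewrite mulrBr mulrBl mulr1 mul1r mulrDr mulrDl !mulrA (gr_square0 gc1) mul0r add0r.
  by rewrite -[h1 * D1 * D1]mulrA (gr_square0 gc1) mulr0 addr0.
have pi1E : D1 * h1 + h1 * D1 = 1 - pi1 by rewrite subKr.
have pi2E : D2 * h2 + h2 * D2 = 1 - pi2 by rewrite subKr.
(* Since [1 - tt pi1 pi2 = tt (1 - pi1) 1 + tt pi1 (1 - pi2)], the first summand is contracted by
   [h1] and the second by [h2] with [pi1] kept on the left; [s] supplies the sign. *)
clearbody pi1 pi2; pose H := tt h1 1 + tt (s * pi1) h2.
have HE : D * H + H * D = 1 - tt pi1 pi2.
  have -> : 1 - tt pi1 pi2 = tt (1 - pi1) 1 + tt pi1 (1 - pi2).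
    by rewrite tsBl tsBr (ts_one ts) addrA subrK.
  rewrite DE; apply: anticommD; rewrite !(ts_mul ts) ?mul1r ?mulr1.
  - by rewrite -tsDl pi1E.
  - by rewrite sh1 tsNl.
  - by rewrite -mulrA -Dpi !mulrA sD mulNr tsNl opprK.
  - by rewrite mulrA ss mul1r spi -mulrA ss mulr1 -tsDr pi2E.
exists H => u uP; rewrite -!mul_blinE -add_blinE HE sub_blinE one_blinE.
suff -> : tt pi1 pi2 u = 0 by rewrite subr0.
(* Degree [m] is a sum of bidegrees with [i + j = m], in each of which [pi1] or [pi2] vanishes. *)
rewrite -uP -[P m u]one_blinE unit_sum sum_blinE blin_sum big1 // => i _.
rewrite sum_blinE blin_sum big1 // => j _.
have [ijm|ijm] := eqVneq (i%:Z + j%:Z) m; last first.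
  have := congr1 (fun T : 'L(G) => T u) (Ptensor ijm).
  by rewrite mul_blinE zero_blinE => ->; rewrite blin0.
rewrite -mul_blinE (ts_mul ts).
have [si|nsi] := pselect (gsplit D1 P1 i%:Z); first by rewrite pi10 // ts0l.
have [sj|nsj] := pselect (gsplit D2 P2 j%:Z); first by rewrite pi20 // ts0r.
exfalso; apply: h; exists i%:Z, j%:Z; split => //.
all: by rewrite lez_nat ltz_nat ltn_ord.
Qed.

Let rank1_mul (X : completeNormedModType C) (x : X) u (T : 'L(X)) :
  rank1 x u * T = rank1 x (bcomp u T).
Proof. exact: blinP. Qed.

Let rank1_bound (X : completeNormedModType C) (x : X) (u : blin X C^o) (c : R) :
  0 <= c -> (forall y, rnorm (u y) <= c * rnorm y) ->
  rnorm (rank1 x u) <= c * rnorm x.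
Proof.
move=> c0 uc; apply: rnorm_opnorm_le => [|y]; first by rewrite mulr_ge0 ?rnorm_ge0.
by rewrite /= rnormZ mulrAC ler_wpM2r ?rnorm_ge0.
Qed.

(** With [z = t x y], a bounded [z'] solves [D z' = D z] and a bounded [w] solves [D w = z - z'].
    The slice operator [T] is small at [z'] because [D z] is small, and small at [D w] because [u]
    and [v] are small on boundaries; yet [T z] stays away from 0. *)
Lemma tensor_approx_cycles (b1 b2 : bool) (p q : int) :
  approx_cycles D1 P1 b1 p -> approx_cycles D2 P2 b2 q ->
  gclosed D P (p + q) \/ b1 && b2 -> ~ gexact D P (p + q).
Proof.
move=> [c1 c10 ac1] [c2 c20 ac2] bm ex; set m := p + q in bm ex.
(* Exactness already makes the range of [D * P (m + 1)] closed, so cycles of degree [m] have bounded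
   preimages. *)
have [M M0 MP] : exists2 M : R, 0 <= M & forall z, P m z = z -> D z = 0 ->
    exists2 w, D w = z & rnorm w <= M * rnorm z.
  have [|M M0 MP] := @open_mapping _ _ _ (D * P (m + 1)).
    exact: (gexact_closed gc).
  exists (M * rnorm (P (m + 1)) ) => [|z Pz Dz]; first by rewrite mulr_ge0 ?rnorm_ge0.
  have [w wz] := ex z Pz Dz.
  have [w' w'w w'M] := MP w; exists (P (m + 1) w').
    by rewrite -[LHS]/((D * P (m + 1)) w') w'w mul_blinE (gr_diffS gc) wz.
  have := opnormP (P (m + 1)) w'; move: w'M; rewrite mul_blinE (gr_diffS gc) wz Pz => h1 h2.
  by apply: le_trans h2 _; have := ler_wpM2l (rnorm_ge0 (P (m + 1))) h1; lra.
(* If both factors are genuine cycles, so is [z], and [z' = 0] will do; otherwise the closed range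
   in degree [m] is used. *)
have [M' M'0 M'P] : exists2 M' : R, 0 <= M' & forall z, P m z = z -> (b1 && b2 -> D z = 0) ->
    exists z', [/\ P m z' = z', D z' = D z & rnorm z' <= M' * rnorm (D z)].
  have [b12|nb12] := boolP (b1 && b2).
    exists 0 => // z Pz /(_ isT) Dz; exists 0; rewrite Dz !blin0 rnorm0 mul0r; split => //.
  have {bm} : gclosed D P m by case: bm => //; rewrite (negbTE nb12).
  move=> /open_mapping[M' M'0 M'P].
  exists (rnorm (P m) * M') => [|z Pz _]; first by rewrite mulr_ge0 ?rnorm_ge0.
  have [z' z'z z'M] := M'P z; exists (P m z'); rewrite (gr_idemE gc); split => //.
    by rewrite -[LHS]/((D * P m) z') z'z mul_blinE Pz.
  apply: le_trans (opnormP _ _) _; rewrite -mulrA ler_wpM2l ?rnorm_ge0 //.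
  by move: z'M; rewrite mul_blinE Pz.
have [l l0 lP] := ts_lower ts; have [k k0 kP] := ts_upper ts.
have [b b0 oP] := ts_op_upper ts.
pose sn := rnorm s; have sn0 : 0 <= sn by exact: rnorm_ge0.
pose B1 := k * (1 + sn).
pose B2 := b * (c2 + sn * c1).
(* [K * e] bounds [rnorm (T z)], the summands coming from [z'] and from [D w]. The lower bound is
   [l / 4], with a factor [1 / 2] from each functional. *)
pose K := b * c1 * c2 * M' * B1 + B2 * M * (k + M' * B1).
have B10 : 0 <= B1 by rewrite mulr_ge0 // addr_ge0.
have B20 : 0 <= B2 by rewrite mulr_ge0 // addr_ge0 // mulr_ge0.
have h0 : 0 <= k + M' * B1 by rewrite addr_ge0 // mulr_ge0.
have K0 : 0 <= K by apply: addr_ge0; do !apply: mulr_ge0 => //.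
have [e [e0 e1 eK]] : exists e : R, [/\ 0 < e, e <= 1 & K * e < l / 4].
  exists (Num.min 1 (l / 8 / (K + 1))).
  have K1 : 0 < K + 1 by rewrite ltr_wpDl.
  have h : 0 < l / 8 / (K + 1) by rewrite !divr_gt0.
  split; [by rewrite lt_min ltr01|by rewrite ge_min lexx|].
  have : (K + 1) * Num.min 1 (l / 8 / (K + 1)) <= l / 8.
    by rewrite mulrC -ler_pdivlMr // ge_min lexx orbT.
  have : 0 < Num.min 1 (l / 8 / (K + 1)) by rewrite lt_min ltr01.
  lra.
have [x [u [[Px x1 ux uc] [Dx uD sx]]]] := ac1 e e0.
have [y [v [[Py y1 vy vc] [Dy vD sy]]]] := ac2 e e0.
pose z := t x y.
have Pz : P m z = z.
  have := congr1 (fun T : 'L(G) => T z) (PE p q).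
  by rewrite mul_blinE (ts_op ts) Px Py.
have z1 : rnorm z <= k by have := kP x y; rewrite x1 y1 !mulr1.
have Dz : D z = t (D1 x) y + t (s x) (D2 y).
  by rewrite DE add_blinE !(ts_op ts) one_blinE.
have Dze : rnorm (D z) <= B1 * e.
  rewrite Dz; apply: le_trans (rnormD _ _) _.
  have h1 := kP (D1 x) y; have h2 := kP (s x) (D2 y).
  have h3 := ler_wpM2l k0 Dx.
  have h4 : k * (rnorm (s x) * rnorm (D2 y)) <= k * (sn * e).
    apply: ler_wpM2l => //; apply: ler_pM; rewrite ?rnorm_ge0 //.
    by apply: le_trans (opnormP _ _) _; rewrite x1 mulr1.
  move: h1; rewrite y1 mulr1 /B1; lra.
have [|z' [Pz' Dz' z'M]] := M'P z Pz.
  by move=> /andP[b1' b2']; rewrite Dz sx // sy // tst0l tst0r addr0.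
have [||w wz wM] := MP (z - z').
- by rewrite blinB Pz Pz'.
- by rewrite blinB Dz' subrr.
pose T := tt (rank1 x u) (rank1 y v).
have Tz : l / 4 <= rnorm (T z).
  rewrite (ts_op ts) /= tstZl tstZr !rnormZ mulrA; have := lP x y.
  rewrite x1 y1 !mulr1 => ll.
  have h : 2^-1 * 2^-1 <= rnorm (u x) * rnorm (v y) by apply: ler_pM.
  have := ler_pM (mulr_ge0 _ _) (ltW l0) h ll; rewrite !invr_ge0 => /(_ (ler0n _ _) (ler0n _ _)).
  by apply: le_trans; lra.
have r1 : rnorm (rank1 x u) <= c1.
  rewrite -[c1]mulr1 -x1; apply: rank1_bound => // a.
  by apply: le_trans (opnormP _ _) _; rewrite ler_wpM2r ?rnorm_ge0.
have r2 : rnorm (rank1 y v) <= c2.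
  rewrite -[c2]mulr1 -y1; apply: rank1_bound => // a.
  by apply: le_trans (opnormP _ _) _; rewrite ler_wpM2r ?rnorm_ge0.
have Tn : rnorm T <= b * c1 * c2.
  apply: le_trans (oP _ _) _; rewrite -mulrA ler_wpM2l // ler_pM ?rnorm_ge0 //.
have TD : rnorm (T * D) <= B2 * e.
  rewrite DE mulrDr !(ts_mul ts) mulr1 !rank1_mul.
  apply: le_trans (rnormD _ _) _.
  have h1 := oP (rank1 x (bcomp u D1)) (rank1 y v).
  have h2 := oP (rank1 x (bcomp u s)) (rank1 y (bcomp v D2)).
  have h3 : rnorm (rank1 x (bcomp u D1)) <= e.
    by rewrite -[e]mulr1 -x1; apply: rank1_bound => //; exact: ltW.
  have h4 : rnorm (rank1 y (bcomp v D2)) <= e.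
    by rewrite -[e]mulr1 -y1; apply: rank1_bound => //; exact: ltW.
  have h5 : rnorm (rank1 x (bcomp u s)) <= c1 * sn.
    rewrite -[c1 * sn]mulr1 -x1; apply: rank1_bound => [|a]; first by rewrite mulr_ge0.
    apply: le_trans (opnormP u (s a)) _; rewrite -mulrA; apply: ler_pM; rewrite ?rnorm_ge0 //.
    exact: opnormP.
  have h6 := ler_wpM2l b0 (ler_pM (rnorm_ge0 _) (rnorm_ge0 _) h3 r2).
  have h7 := ler_wpM2l b0 (ler_pM (rnorm_ge0 _) (rnorm_ge0 _) h5 h4).
  rewrite /B2; lra.
have zz' : rnorm (z - z') <= k + M' * B1.
  apply: le_trans (rnormB _ _) _; apply: lerD => //.
  apply: le_trans z'M _; apply: ler_wpM2l => //; apply: le_trans Dze _.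
  by rewrite -[leRHS]mulr1 ler_wpM2l.
have E1 : rnorm (T z') <= b * c1 * c2 * (M' * (B1 * e)).
  apply: le_trans (opnormP _ _) _; apply: ler_pM; rewrite ?rnorm_ge0 //.
  by apply: le_trans z'M _; rewrite ler_wpM2l.
have E2 : rnorm (T (z - z')) <= B2 * e * (M * (k + M' * B1)).
  rewrite -wz -mul_blinE; apply: le_trans (opnormP _ _) _; apply: ler_pM; rewrite ?rnorm_ge0 //.
  by apply: le_trans wM _; rewrite ler_wpM2l.
have : rnorm (T z) <= rnorm (T (z - z')) + rnorm (T z').
  by rewrite -{1}[z](subrK z') blinD rnormD.
move: eK; rewrite /K; lra.
Qed.

End Complexes.
End Theory.
End TensorStructure.

(** * Operators on exterior powers *)

Section FfunOperators.
Variables (R : realType).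
Local Notation C := R[i].

Lemma rnorm_ffun (I : finType) (X : normedModType C) (f : {ffun I -> X}) :
  rnorm f = \sum_i rnorm (f i).
Proof.
apply: complexI; rewrite -normE ffun_normE rmorph_sum.
by apply: eq_bigr => i _; rewrite normE.
Qed.

Lemma rnorm_ffun_ge (I : finType) (X : normedModType C) (f : {ffun I -> X}) i :
  rnorm (f i) <= rnorm f.
Proof. by rewrite rnorm_ffun (bigD1 i) //= lerDl sumr_ge0 // => j _; exact: rnorm_ge0. Qed.

Section Operators.
Variables (I : finType) (X : completeNormedModType C).
Local Notation G := {ffun I -> X}.
Implicit Types (f : G) (i : I) (x : X).

Definition delta i x : G := [ffun j => if j == i then x else 0].

Lemma ffun_deltaE f : f = \sum_i delta i (f i).
Proof.
apply/ffunP => j; rewrite sum_ffunE (bigD1 j) //= ffunE eqxx big1 ?addr0 // => i ij.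
by rewrite ffunE eq_sym (negbTE ij).
Qed.

Lemma deltaZ i (a : C) x : delta i (a *: x) = a *: delta i x.
Proof. by apply/ffunP => j; rewrite !ffunE; case: ifP; rewrite ?scaler0. Qed.

Lemma delta0 i : delta i 0 = 0.
Proof. by apply/ffunP => j; rewrite !ffunE; case: ifP. Qed.

Lemma delta_linear i : linear (delta i).
Proof.
by move=> a x y; apply/ffunP => j; rewrite !ffunE; case: ifP; rewrite ?scaler0 ?addr0.
Qed.

Lemma delta_bounded i x : rnorm (delta i x) <= 1 * rnorm x.
Proof.
rewrite rnorm_ffun (bigD1 i) //= ffunE eqxx big1 ?addr0 ?mul1r // => j ji.
by rewrite ffunE (negbTE ji) rnorm0.
Qed.

Definition bdelta i : blin X G := mk_blin_bounded (delta_linear i) (delta_bounded i).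

Lemma coordinate_linear i : linear (fun f : G => f i).
Proof. by move=> a f g; rewrite !ffunE. Qed.

Lemma coordinate_bounded i f : rnorm (f i) <= 1 * rnorm f.
Proof. by rewrite mul1r rnorm_ffun_ge. Qed.

Definition bcoord i : blin G X :=
  mk_blin_bounded (coordinate_linear i) (coordinate_bounded i).

Lemma ffun_blinP (Y : normedModType C) (S T : blin G Y) :
  (forall i x, S (delta i x) = T (delta i x)) -> S = T.
Proof.
move=> ST; apply: blinP => f; rewrite (ffun_deltaE f) !blin_sum.
by apply: eq_bigr => i _.
Qed.

(* The weighted composition operator [f |-> (i |-> c i * f (g i))]. *)
Definition wcomp_fun (c : I -> C) (g : I -> I) (f : G) : G := [ffun i => c i *: f (g i)].

Lemma wcomp_linear c g : linear (wcomp_fun c g).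
Proof. by move=> a f h; apply/ffunP => i; rewrite !ffunE scalerDr !scalerA mulrC. Qed.

Lemma wcomp_bounded c g f :
  rnorm (wcomp_fun c g f) <= (\sum_i rnorm (c i : C^o)) * rnorm f.
Proof.
rewrite rnorm_ffun mulr_suml; apply: ler_sum => i _; rewrite ffunE rnormZ.
by rewrite ler_wpM2l ?rnorm_ge0 ?rnorm_ffun_ge.
Qed.

Definition wcomp c g : 'L(G) := mk_blin_bounded (wcomp_linear c g) (wcomp_bounded c g).

Lemma wcompE c g f i : wcomp c g f i = c i *: f (g i).
Proof. by rewrite [LHS]ffunE. Qed.

Lemma wcompM c g c' g' :
  wcomp c g * wcomp c' g' = wcomp (fun i => c i * c' (g i)) (g' \o g).
Proof. by apply: blinP => f; apply/ffunP => i; rewrite mul_blinE !wcompE scalerA. Qed.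

Lemma wcomp1 : wcomp (fun=> 1) id = 1.
Proof. by apply: blinP => f; apply/ffunP => i; rewrite wcompE scale1r. Qed.

Definition pointwise_fun (T : 'L(X)) (f : G) : G := [ffun i => T (f i)].

Lemma pointwise_linear T : linear (pointwise_fun T).
Proof. by move=> a f g; apply/ffunP => i; rewrite !ffunE blinD blinZ. Qed.

Lemma pointwise_bounded T f : rnorm (pointwise_fun T f) <= rnorm T * rnorm f.
Proof.
rewrite !rnorm_ffun mulr_sumr; apply: ler_sum => i _; rewrite ffunE.
exact: opnormP.
Qed.

Definition pointwise T : 'L(G) :=
  mk_blin_bounded (pointwise_linear T) (pointwise_bounded T).

Lemma pointwiseE T f i : pointwise T f i = T (f i).
Proof. by rewrite [LHS]ffunE. Qed.

Lemma pointwise_opl a S T : pointwise (a *: S + T) = a *: pointwise S + pointwise T.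
Proof. by apply: blinP => f; apply/ffunP => i; rewrite pointwiseE !ffunE. Qed.

Lemma pointwise_delta T i x : pointwise T (delta i x) = delta i (T x).
Proof. by apply/ffunP => j; rewrite pointwiseE !ffunE; case: ifP; rewrite ?blin0. Qed.

Lemma pointwise_wcomp T c g : pointwise T * wcomp c g = wcomp c g * pointwise T.
Proof.
apply: blinP => f; apply/ffunP => i; rewrite !mul_blinE pointwiseE !wcompE.
by rewrite pointwiseE blinZ.
Qed.

End Operators.
End FfunOperators.

(** * Creation and annihilation operators *)

Section ExteriorAlgebra.
Variables (R : realType) (n : nat) (X : completeNormedModType R[i]).
Local Notation C := R[i].
Local Notation G := {ffun {set 'I_n} -> X}.
Implicit Types (A B : {set 'I_n}) (i j k : 'I_n).

(* The sign in [e_i /\ e_A = ext_sign i A e_(i |: A)], for [i \notin A]. *)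
Definition ext_sign i A : C := (-1) ^+ #|[set j in A | (j < i)%N]|.

Lemma ext_sign_sqr i A : ext_sign i A * ext_sign i A = 1.
Proof. by rewrite -expr2 sqrr_sign. Qed.

Lemma ext_signD1 k i A : i \in A ->
  ext_sign k (A :\ i) = (-1) ^+ (i < k)%N * ext_sign k A.
Proof.
move=> iA; rewrite /ext_sign (cardsD1 i [set j in A | _]) inE iA /= exprD mulrA.
rewrite -expr2 sqrr_sign mul1r; congr (_ ^+ _).
by apply: eq_card => j; rewrite !inE; case: eqP.
Qed.

Lemma ext_signU1 k i A : i \notin A ->
  ext_sign k (i |: A) = (-1) ^+ (i < k)%N * ext_sign k A.
Proof.
move=> iA; by rewrite -{2}(setU1K iA) ext_signD1 ?setU11 // mulrA -expr2 sqrr_sign mul1r.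
Qed.

Lemma ext_signD1x i A : ext_sign i (A :\ i) = ext_sign i A.
Proof.
congr (_ ^+ _); apply: eq_card => j; rewrite !inE; case: eqP => //= ->.
by rewrite ltnn andbF.
Qed.

Lemma ext_signU1x i A : ext_sign i (i |: A) = ext_sign i A.
Proof.
congr (_ ^+ _); apply: eq_card => j; rewrite !inE; case: eqP => //= ->.
by rewrite ltnn !andbF.
Qed.

Lemma sign_ltn_neq i j : i != j -> (-1) ^+ (i < j)%N + (-1) ^+ (j < i)%N = 0 :> C.
Proof.
move=> ij; have : (i < j)%N = ~~ (j < i)%N by rewrite -leqNgt ltn_neqAle ij.
by move=> ->; case: (j < i)%N; rewrite ?expr0 ?expr1 ?addrN ?addNr.
Qed.

(** Exterior multiplication by [e_i], read on coefficients: the coefficient at [A] comes from that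
    at [A :\ i], and [i] itself does not affect the sign. *)
Definition creation i : 'L(G) :=
  wcomp X (fun A => if i \in A then ext_sign i A else 0) (fun A => A :\ i).

(** Contraction with the [i]-th coordinate form. *)
Definition annihilation i : 'L(G) :=
  wcomp X (fun A => if i \in A then 0 else ext_sign i A) (fun A => i |: A).

Lemma creationE i f A :
  creation i f A = if i \in A then ext_sign i A *: f (A :\ i) else 0.
Proof. by rewrite wcompE; case: ifP; rewrite ?scale0r. Qed.

Lemma annihilationE i f A :
  annihilation i f A = if i \in A then 0 else ext_sign i A *: f (i |: A).
Proof. by rewrite wcompE; case: ifP; rewrite ?scale0r. Qed.

Lemma creation_anticomm i j : creation i * creation j + creation j * creation i = 0.
Proof.
apply: blinP => f; apply/ffunP => A; rewrite add_blinE !mul_blinE ffunE zero_blinE !creationE ffunE.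
have [<-|ij] := eqVneq i j.
  by rewrite !inE eqxx /= scaler0; case: ifP; rewrite addr0.
rewrite !inE ij eq_sym ij /=.
case: ifP => iA; case: ifP => jA; rewrite ?scaler0 ?addr0 //.
have -> : A :\ j :\ i = A :\ i :\ j by apply/setP => k; rewrite !inE andbCA.
rewrite !scalerA !ext_signD1 // mulrCA [X in _ + X *: _]mulrCA.
by rewrite [ext_sign j A * _]mulrC -scalerDl -mulrDl sign_ltn_neq ?mul0r ?scale0r.
Qed.

(** The canonical anticommutation relations. For [i != j] the two orders differ by whether the
    smaller index is counted in the sign of the larger one. *)
Lemma annihilation_creation i j :
  annihilation i * creation j + creation j * annihilation i =
  (i == j)%:R *: (1 : 'L(G)).
Proof.
apply: blinP => f; apply/ffunP => A; rewrite add_blinE scale_blinE one_blinE !mul_blinE.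
rewrite ffunE annihilationE !creationE annihilationE !inE [RHS]ffunE.
have [<-|ij] := eqVneq i j.
  rewrite scale1r /=; case: ifP => iA.
    by rewrite add0r ext_signD1x scalerA ext_sign_sqr scale1r finset.setD1K.
  by rewrite addr0 ext_signU1x scalerA ext_sign_sqr scale1r setU1K ?iA.
rewrite scale0r /=.
case: ifP => iA; case: ifP => jA; rewrite ?scaler0 ?addr0 //.
rewrite !scalerA ext_signD1 // ext_signU1 ?iA //.
have -> : (i |: A) :\ j = i |: A :\ j.
  by apply/setP => k; rewrite !inE; case: (eqVneq k j) => // ->; rewrite eq_sym (negbTE ij).
rewrite mulrCA [X in _ + X *: _]mulrCA [ext_sign j A * _]mulrC -scalerDl -mulrDl.
by rewrite sign_ltn_neq ?mul0r ?scale0r.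
Qed.

Lemma creation_delta i A x : creation i (delta A x) =
  if i \in A then 0 else ext_sign i A *: delta (i |: A) x.
Proof.
apply/ffunP => B; rewrite creationE; case: ifP => iB; case: ifP => iA; rewrite !ffunE //.
- case: eqP => BA; rewrite ?scaler0 //.
  by move: iA; rewrite -BA !inE eqxx.
- have [->|BA] := eqVneq B (i |: A).
    by rewrite setU1K ?iA // eqxx ext_signU1x.
  case: eqP => BA'; rewrite ?scaler0 //.
  by move: BA; rewrite -BA' finset.setD1K ?eqxx.
- by case: eqP => BA; rewrite ?scaler0 //; move: iB; rewrite BA setU11.
Qed.

Lemma creation_sqr i : creation i * creation i = 0.
Proof.
apply: blinP => f; apply/ffunP => A; rewrite mul_blinE !creationE !inE eqxx /= scaler0.
by rewrite -[RHS]/((0 : G) A) ffunE; case: ifP.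
Qed.

Definition ext_degree (p : int) : 'L(G) := wcomp X (fun A => (#|A|%:Z == p)%:R) id.

Lemma ext_degreeE p f A : ext_degree p f A = if #|A|%:Z == p then f A else 0.
Proof. by rewrite wcompE; case: ifP; rewrite ?scale0r ?scale1r. Qed.

Lemma ext_degree_creation p i : ext_degree p * creation i = creation i * ext_degree (p - 1).
Proof.
apply: blinP => f; apply/ffunP => A; rewrite !mul_blinE ext_degreeE !creationE ext_degreeE.
case: (boolP (i \in A)) => iA; last by case: ifP.
rewrite (cardsD1 i A) iA.
have -> : ((true + #|A :\ i|)%N%:Z == p) = (#|A :\ i|%:Z == p - 1) by apply/eqP/eqP; lia.
by case: ifP; rewrite ?scaler0.
Qed.

Lemma ext_degree_annihilation p i :
  annihilation i * ext_degree p = ext_degree (p - 1) * annihilation i.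
Proof.
apply: blinP => f; apply/ffunP => A; rewrite !mul_blinE ext_degreeE !annihilationE ext_degreeE.
case: (boolP (i \in A)) => iA; first by case: ifP.
rewrite cardsU1 iA.
have -> : ((true + #|A|)%N%:Z == p) = (#|A|%:Z == p - 1) by apply/eqP/eqP; lia.
by case: ifP; rewrite ?scaler0.
Qed.

Lemma ext_degree_idem p : ext_degree p * ext_degree p = ext_degree p.
Proof. by apply: blinP => f; apply/ffunP => A; rewrite mul_blinE !ext_degreeE; case: (#|A|%:Z == p). Qed.

Lemma ext_degree_orth p q : p != q -> ext_degree p * ext_degree q = 0.
Proof.
move=> pq; apply: blinP => f; apply/ffunP => A; rewrite mul_blinE !ext_degreeE zero_blinE ffunE.
by case: eqP => // ->; rewrite (negbTE pq).
Qed.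

Lemma ext_degree_sum : \sum_(q < n.+1) ext_degree q%:Z = 1.
Proof.
apply: blinP => f; apply/ffunP => A; rewrite sum_blinE sum_ffunE one_blinE.
have An : (#|A| < n.+1)%N by rewrite ltnS -[leqRHS]card_ord max_card.
rewrite (bigD1 (Ordinal An)) //= ext_degreeE eqxx big1 ?addr0 // => q qA.
by rewrite ext_degreeE eqz_nat; case: eqP => // Aq; case/eqP: qA; apply: val_inj.
Qed.

Definition ext_parity : 'L(G) := wcomp X (fun A => (-1) ^+ #|A|) id.

Lemma ext_parity_degree p : ext_parity * ext_degree p = (-1) ^+ absz p *: ext_degree p.
Proof.
apply: blinP => f; apply/ffunP => A; rewrite mul_blinE scale_blinE wcompE [RHS]ffunE.
by rewrite ext_degreeE; case: eqP => [<-|]; rewrite ?scaler0.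
Qed.

End ExteriorAlgebra.

(** * Monomials in anticommuting operators *)

Section OrderedProducts.
Variables (R : realType) (n : nat) (Y : normedModType R[i]) (g : 'I_n -> 'L(Y)).
Implicit Types (i : 'I_n) (A : {set 'I_n}).
Hypothesis g_anticomm : forall i j, g i * g j = - (g j * g i).
Hypothesis g_sqr : forall i, g i * g i = 0.

(** The image of [e_A] when [e_i] is sent to [g i]; the enumeration of ['I_n] is increasing, which
    fixes the order of the factors. *)
Definition ordered_prod A : 'L(Y) := \prod_(i in A) g i.

Lemma ordered_prod0 : ordered_prod finset.set0 = 1.
Proof. by rewrite /ordered_prod big_set0. Qed.

(** Generalized to increasing lists containing [i], for induction: [g i] moves to its place past the
    smaller elements of [A]. *)
Let step i A (r : seq 'I_n) : sorted (fun j k : 'I_n => (j < k)%N) r -> i \in r ->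
  g i * \prod_(j <- r | j \in A) g j =
  if i \in A then 0 else
  (-1) ^+ count (fun j : 'I_n => (j \in A) && (j < i)%N) r *:
    \prod_(j <- r | j \in i |: A) g j.
Proof.
elim: r => // h r IH hr; rewrite inE !big_cons.
have srt : sorted (fun j k : 'I_n => (j < k)%N) r := path_sorted hr.
have hlt j : j \in r -> (h < j)%N.
  by move: hr; rewrite /= path_sortedE => [/andP[/allP + _]|? ? ?]; [apply|exact: ltn_trans].
have [-> _|ih /= ir] := eqVneq i h.
  rewrite setU11; case: ifP => hA; first by rewrite mulrA g_sqr mul0r.
  rewrite /= hA /= add0n (_ : count _ r = 0%N); last first.
    by apply/eqP; rewrite -leqn0 leqNgt -has_count; apply/hasPn => j jr; rewrite negb_and -leqNgt (ltnW (hlt j jr)) orbT.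
  rewrite scale1r; congr (_ * _); rewrite [LHS]big_seq_cond [RHS]big_seq_cond.
  apply: eq_bigl => j; rewrite !inE; case: (boolP (j \in r)) => //= /hlt.
  by case: eqP => // ->; rewrite ltnn.
have hi := hlt i ir; rewrite !inE eq_sym (negbTE ih) /= hi andbT.
case: (boolP (h \in A)) => hA; last by rewrite IH.
rewrite mulrA g_anticomm mulNr -mulrA IH //; case: ifP => iA; first by rewrite mulr0 oppr0.
by rewrite -scaler_blinAr exprS mulN1r scaleNr.
Qed.

(** The same rule as [creation_delta], which is what makes maps out of the exterior algebra
    compatible with multiplication. *)
Lemma mul_ordered_prod i A : g i * ordered_prod A =
  if i \in A then 0 else ext_sign R i A *: ordered_prod (i |: A).
Proof.
rewrite /ordered_prod (step A (r := index_enum 'I_n)) ?mem_index_enum //.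
  case: ifP => // iA; congr (_ ^+ _ *: _); rewrite -sum1_count -sum1_card.
  by apply: eq_bigl => j; rewrite inE.
rewrite [index_enum _]unlock -enumT; have := iota_ltn_sorted 0 n; rewrite -val_enum_ord sorted_map.
by [].
Qed.

End OrderedProducts.

(** * Tensor products of finite powers of Banach spaces *)

Section TensorOfProducts.
Variables (R : realType).
Local Notation C := R[i].
Variables (X1 X2 X : completeNormedModType C) (t : X1 -> X2 -> X)
  (tt : 'L(X1) -> 'L(X2) -> 'L(X)).
Hypothesis ts : tensor_structure t tt.
Variables (I J : finType).
Local Notation G1 := {ffun I -> X1}.
Local Notation G2 := {ffun J -> X2}.
Local Notation G := {ffun I * J -> X}.

Definition ffun_tensor (f : G1) (g : G2) : G := [ffun ij => t (f ij.1) (g ij.2)].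

Definition entry (K : finType) (Y : completeNormedModType C) (T : 'L({ffun K -> Y}))
    (i j : K) : 'L(Y) := bcomp (bcoord Y i) (bcomp T (bdelta Y j)).

Lemma entryE (K : finType) (Y : completeNormedModType C) (T : 'L({ffun K -> Y})) i j y :
  entry T i j y = T (delta j y) i.
Proof. by []. Qed.

Lemma entry_linear (K : finType) (Y : completeNormedModType C) i j :
  linear (fun T : 'L({ffun K -> Y}) => entry T i j).
Proof. by move=> a S T; apply: blinP => y; rewrite add_blinE scale_blinE !entryE !ffunE. Qed.

Lemma entryM (K : finType) (Y : completeNormedModType C) (S T : 'L({ffun K -> Y})) i j :
  entry (S * T) i j = \sum_k entry S i k * entry T k j.
Proof.
apply: blinP => y; rewrite entryE mul_blinE sum_blinE (ffun_deltaE (T (delta j y))) blin_sum.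
by rewrite sum_ffunE; apply: eq_bigr => k _; rewrite mul_blinE !entryE.
Qed.

Lemma entry1 (K : finType) (Y : completeNormedModType C) i j :
  entry (1 : 'L({ffun K -> Y})) i j = if i == j then 1 else 0.
Proof. by apply: blinP => y; rewrite entryE one_blinE ffunE; case: ifP. Qed.

Lemma entry_wcomp (K : finType) (Y : completeNormedModType C) c g (i j : K) :
  entry (wcomp Y c g) i j = if g i == j then c i *: (1 : 'L(Y)) else 0.
Proof.
apply: blinP => y; rewrite entryE wcompE ffunE; case: ifP => _; first by [].
by rewrite scaler0 zero_blinE.
Qed.

Lemma entry_bound (K : finType) (Y : completeNormedModType C) (T : 'L({ffun K -> Y})) i j :
  rnorm (entry T i j) <= rnorm T.
Proof.
apply: rnorm_opnorm_le => [|y]; first exact: rnorm_ge0.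
rewrite entryE; apply: le_trans (rnorm_ffun_ge _ _) _; apply: le_trans (opnormP _ _) _.
by rewrite ler_wpM2l ?rnorm_ge0 // -[leRHS]mul1r delta_bounded.
Qed.

(** The Kronecker product of the operator matrices of [T] and [S], with [tt] in place of the product
    of entries. *)
Definition ffun_op (T : 'L(G1)) (S : 'L(G2)) : 'L(G) :=
  \sum_(ij : I * J) \sum_(kl : I * J)
    bcomp (bdelta X ij) (bcomp (tt (entry T ij.1 kl.1) (entry S ij.2 kl.2)) (bcoord X kl)).

Lemma ffun_opE T S f ij :
  ffun_op T S f ij = \sum_(kl : I * J) tt (entry T ij.1 kl.1) (entry S ij.2 kl.2) (f kl).
Proof.
rewrite /ffun_op sum_blinE sum_ffunE (bigD1 ij) //= [X in _ + X]big1 ?addr0 => [|kl klij].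
  by rewrite sum_blinE sum_ffunE; apply: eq_bigr => kl _; rewrite [LHS]ffunE eqxx.
rewrite sum_blinE sum_ffunE big1 // => mn _.
by rewrite [LHS]ffunE eq_sym (negbTE klij).
Qed.

Lemma ffun_op_delta T S kl x ij :
  ffun_op T S (delta kl x) ij = tt (entry T ij.1 kl.1) (entry S ij.2 kl.2) x.
Proof.
rewrite ffun_opE (bigD1 kl) //= ffunE eqxx big1 ?addr0 // => mn mnkl.
by rewrite ffunE (negbTE mnkl) blin0.
Qed.

Lemma ffun_op_tensor T S f g :
  ffun_op T S (ffun_tensor f g) = ffun_tensor (T f) (S g).
Proof.
apply/ffunP => ij; rewrite ffun_opE ffunE.
rewrite {2}(ffun_deltaE f) {2}(ffun_deltaE g) !blin_sum !sum_ffunE.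
have tsum : forall F H, t (\sum_k F k) (\sum_l H l) = \sum_(kl : I * J) t (F kl.1) (H kl.2).
  move=> F H; rewrite -(pair_bigA _ (fun k l => t (F k) (H l))) /=.
  rewrite -[LHS]/((fun x => t x (\sum_l H l)) _).
  have l1 y : linear (t^~ y) := ts_linl ts y.
  have l2 x : linear (t x) := ts_linr ts x.
  elim/big_rec2: _ => [|k x y _ <-].
    exact: (tst0l ts).
  have := l1 (\sum_l H l) 1 (F k) y; rewrite !scale1r => ->; congr (_ + _).
  elim/big_rec2: _ => [|l x' y' _ <-]; first exact: (tst0r ts).
  by have := l2 (F k) 1 (H l) x'; rewrite !scale1r.
by rewrite tsum; apply: eq_bigr => kl _; rewrite ffunE (ts_op ts) !entryE.
Qed.

Lemma ffun_opM T1 S1 T2 S2 :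
  ffun_op T1 S1 * ffun_op T2 S2 = ffun_op (T1 * T2) (S1 * S2).
Proof.
apply: ffun_blinP => kl x; apply/ffunP => ij.
rewrite [RHS]ffun_op_delta !entryM (ts_suml ts) [RHS]sum_blinE mul_blinE ffun_opE.
rewrite [RHS](eq_bigr (fun k => \sum_l tt (entry T1 ij.1 k * entry T2 k kl.1)
    (entry S1 ij.2 l * entry S2 l kl.2) x)); last first.
  by move=> k _; rewrite (ts_sumr ts) sum_blinE.
rewrite (pair_bigA _ (fun k l => tt (entry T1 ij.1 k * entry T2 k kl.1)
    (entry S1 ij.2 l * entry S2 l kl.2) x)) /=.
by apply: eq_bigr => mn _; rewrite ffun_op_delta -(ts_mul ts) mul_blinE.
Qed.

Lemma ffun_op_wcomp c1 g1 c2 g2 :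
  ffun_op (wcomp X1 c1 g1) (wcomp X2 c2 g2) =
  wcomp X (fun ij => c1 ij.1 * c2 ij.2) (fun ij => (g1 ij.1, g2 ij.2)).
Proof.
apply: ffun_blinP => kl x; apply/ffunP => ij.
rewrite ffun_op_delta wcompE ffunE !entry_wcomp -pair_eqE /=.
case: eqP => _ /=; last by rewrite (ts0l ts) zero_blinE scaler0.
case: eqP => _ /=; last by rewrite (ts0r ts) zero_blinE scaler0.
by rewrite (tsZl ts) (tsZr ts) (ts_one ts) scalerA.
Qed.

Lemma ffun_op1 : ffun_op 1 1 = 1.
Proof.
rewrite -(wcomp1 I X1) -(wcomp1 J X2) ffun_op_wcomp -(wcomp1 _ X).
apply: blinP => f; apply/ffunP => -[i j]; rewrite !wcompE mulr1.
by [].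
Qed.

Lemma rnorm_ffun_tensor f g :
  rnorm (ffun_tensor f g) = \sum_i \sum_j rnorm (t (f i) (g j)).
Proof. by rewrite rnorm_ffun pair_bigA; apply: eq_bigr => ij _; rewrite ffunE. Qed.

Lemma ffun_tensor_structure : tensor_structure ffun_tensor ffun_op.
Proof.
split.
- by move=> g a f f'; apply/ffunP => ij; rewrite !ffunE (ts_linl ts).
- by move=> f a g g'; apply/ffunP => ij; rewrite !ffunE (ts_linr ts).
- move=> S a T T'; apply: ffun_blinP => kl x; apply/ffunP => ij.
  rewrite add_blinE scale_blinE [RHS]ffunE [X in _ = X + _]ffunE !ffun_op_delta.
  by rewrite entry_linear (ts_opl ts).
- move=> T a S S'; apply: ffun_blinP => kl x; apply/ffunP => ij.
  rewrite add_blinE scale_blinE [RHS]ffunE [X in _ = X + _]ffunE !ffun_op_delta.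
  by rewrite entry_linear (ts_opr ts).
- exact: ffun_op_tensor.
- exact: ffun_opM.
- exact: ffun_op1.
- have [c c0 cP] := ts_lower ts; exists c => // f g.
  rewrite rnorm_ffun_tensor !rnorm_ffun mulr_suml mulr_sumr.
  by apply: ler_sum => i _; rewrite !mulr_sumr; apply: ler_sum => j _.
- have [c c0 cP] := ts_upper ts; exists c => // f g.
  rewrite rnorm_ffun_tensor !rnorm_ffun mulr_suml mulr_sumr.
  by apply: ler_sum => i _; rewrite !mulr_sumr; apply: ler_sum => j _.
(* Entries are bounded by the norm of the whole operator; the number of rows is the factor lost. *)
- have [c c0 cP] := ts_op_upper ts; exists (#|{: I * J}|%:R * c) => [|T S].
    by rewrite mulr_ge0.
  have TS0 : 0 <= c * (rnorm T * rnorm S) by rewrite !mulr_ge0 ?rnorm_ge0.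
  apply: rnorm_opnorm_le => [|f]; first by rewrite -mulrA mulr_ge0.
  rewrite rnorm_ffun -!mulrA mulr_natl -sumr_const; apply: ler_sum => ij _.
  rewrite ffun_opE; apply: le_trans (_ : \sum_kl rnorm (tt (entry T ij.1 kl.1) (entry S ij.2 kl.2) (f kl)) <= _).
    elim/big_rec2: _ => [|kl x y _ xy]; first by rewrite rnorm0.
    by apply: le_trans (rnormD _ _) _; rewrite lerD2l.
  rewrite rnorm_ffun !mulr_sumr; apply: ler_sum => kl _.
  apply: le_trans (opnormP _ _) _.
  have -> : c * (rnorm T * (rnorm S * rnorm (f kl))) = c * (rnorm T * rnorm S) * rnorm (f kl).
    by rewrite !mulrA.
  rewrite ler_wpM2r ?rnorm_ge0 //; apply: le_trans (cP _ _) _.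
  by rewrite ler_wpM2l // ler_pM ?rnorm_ge0 ?entry_bound.
Qed.

End TensorOfProducts.

(** * Models of the Koszul complex *)

Section LieBracket.
Variables (K : fieldType) (L : lieAlgType K).

HB.instance Definition _ (x : L) :=
  GRing.isLinear.Build K L L *:%R (lie x) (lie_linearr x).

Lemma lieC (x y : L) : lie x y = - lie y x.
Proof.
have lDl z : lie (x + y) z = lie x z + lie y z.
  by have := lie_linearl z 1 x y; rewrite !scale1r.
have := lie_alt (x + y); rewrite lDl !linearD /= !lie_alt add0r addr0.
by move/eqP; rewrite addr_eq0 => /eqP.
Qed.

Lemma lie_lie (x y z : L) : lie (lie x y) z = lie x (lie y z) - lie y (lie x z).
Proof.
have := lie_jacobi x y z; rewrite (lieC z x) linearN (lieC z (lie x y)) /=.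
by move/eqP; rewrite subr_eq0 => /eqP <-.
Qed.

End LieBracket.

Section KoszulModels.
Variables (R : realType).
Local Notation C := R[i].
Variables (L : lieAlgType C) (X : completeNormedModType C) (rho : L -> 'L(X)).

(* The Koszul complex as a cyclic module over the exterior algebra: [eps l] is
   [l /\ _], [eta x] is [x (x) 1], and [theta l] is the Lie derivative. *)
Record koszul_model (G : completeNormedModType C) (eta : blin X G)
    (eps theta : L -> 'L(G)) (D : 'L(G)) (P : int -> 'L(G)) : Prop := {
  km_eps : linear eps;
  km_ind : forall W : G -> Prop, (forall x, W (eta x)) ->
    (forall u v, W u -> W v -> W (u + v)) -> (forall l u, W u -> W (eps l u)) ->
    forall u, W u;
  km_sqr : forall l, eps l * eps l = 0;
  km_cartan : forall l, D * eps l + eps l * D = theta l;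
  km_diff0 : forall x, D (eta x) = 0;
  km_theta_eps : forall l m, theta l * eps m - eps m * theta l = eps (lie l m);
  km_theta0 : forall l x, theta l (eta x) = eta (rho l x);
  km_deg : forall p l, P p * eps l = eps l * P (p - 1);
  km_deg0 : forall p x, P p (eta x) = if p == 0 then eta x else 0 }.

Section Theory.
Variables (G : completeNormedModType C) (eta : blin X G) (eps theta : L -> 'L(G))
  (D : 'L(G)) (P : int -> 'L(G)).
Hypothesis km : koszul_model eta eps theta D P.

Lemma kmD l m : eps (l + m) = eps l + eps m.
Proof. by have := km_eps km 1 l m; rewrite !scale1r. Qed.

Lemma km0 : eps 0 = 0.
Proof. by apply: (addrI (eps 0)); rewrite -kmD !addr0. Qed.

Lemma kmZ a l : eps (a *: l) = a *: eps l.
Proof. by have := km_eps km a l 0; rewrite km0 !addr0. Qed.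

Lemma kmN l : eps (- l) = - eps l.
Proof. by rewrite -scaleN1r kmZ scaleN1r. Qed.

Lemma km_sum I (r : seq I) (Q : pred I) F :
  eps (\sum_(i <- r | Q i) F i) = \sum_(i <- r | Q i) eps (F i).
Proof. by elim/big_rec2: _ => [|i y l _ <-]; rewrite ?km0 ?kmD. Qed.

Lemma km_anticomm l m : eps l * eps m = - (eps m * eps l).
Proof.
have := km_sqr km (l + m); rewrite kmD mulrDl !mulrDr !(km_sqr km) add0r addr0.
by move/eqP; rewrite addr_eq0 => /eqP.
Qed.

(* An operator that (anti)commutes with [eps] is determined by its values on
   [eta]. *)
Lemma km_eq0 (Y : completeNormedModType C) (S : blin G Y) (E : L -> 'L(Y)) :
  (forall x, S (eta x) = 0) -> (forall l u, S (eps l u) = E l (S u)) ->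
  S = 0.
Proof.
move=> S0 SE; apply: blinP => u; rewrite zero_blinE; move: u.
apply: (km_ind km) => // [u v|l u] Su; first by rewrite blinD Su add0r.
by rewrite SE Su blin0.
Qed.

Lemma km_ext (Y : completeNormedModType C) (S T : blin G Y) (E : L -> 'L(Y)) :
  (forall x, S (eta x) = T (eta x)) -> (forall l u, S (eps l u) = E l (S u)) ->
  (forall l u, T (eps l u) = E l (T u)) -> S = T.
Proof.
move=> ST SE TE; apply/eqP; rewrite -subr_eq0; apply/eqP.
apply: (@km_eq0 _ _ E) => [x|l u]; rewrite !sub_blinE ?ST ?subrr //.
by rewrite SE TE -blinB.
Qed.

Lemma km_cartanE l u : D (eps l u) = theta l u - eps l (D u).
Proof. by rewrite -(km_cartan km) add_blinE !mul_blinE addrK. Qed.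

Lemma km_theta_epsE l m u : theta l (eps m u) = eps m (theta l u) + eps (lie l m) u.
Proof. by rewrite -(km_theta_eps km) sub_blinE !mul_blinE addrC subrK. Qed.

Hypothesis rep : is_representation rho.

(** By the Jacobi identity, the difference of the two sides commutes with [eps]; on [eta] it
    vanishes because [rho] is a representation. *)
Lemma km_theta_lie l m : theta l * theta m - theta m * theta l = theta (lie l m).
Proof.
apply/eqP; rewrite -subr_eq0; apply/eqP; apply: (@km_eq0 _ _ eps) => [x|k u].
  rewrite !sub_blinE !mul_blinE !(km_theta0 km) -!blinB.
  by rewrite (rep.2 l m) !sub_blinE /= subrr blin0.
rewrite !sub_blinE !mul_blinE !blinB !km_theta_epsE !blinD !km_theta_epsE.
have -> : eps (lie (lie l m) k) u = eps (lie l (lie m k)) u - eps (lie m (lie l k)) u.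
  by rewrite lie_lie kmD kmN.
set F := eps (lie l _) u; set K := eps (lie m _) u; set B := eps (lie l k) _.
set Q := eps (lie m k) _; set A := eps k _; set A' := eps k _; set T := eps k _.
have -> : A + B + (Q + F) = A + F + (B + Q) by rewrite [Q + F]addrC addrACA.
have -> : A' + Q + (B + K) = A' + K + (B + Q) by rewrite [B + K]addrC addrACA [Q + B]addrC.
rewrite [A' + K + _]addrC addrKA opprD addrACA.
by rewrite [T + _]addrC addrKA.
Qed.

(** The commutator of [theta l] and [D] anticommutes with every [eps m], by Cartan's formula and
    [km_theta_lie]. *)
Lemma km_theta_diff l : theta l * D = D * theta l.
Proof.
apply/eqP; rewrite -subr_eq0; apply/eqP.
apply: (@km_eq0 _ _ (fun m => - eps m)) => [x|m u].
  by rewrite sub_blinE !mul_blinE (km_diff0 km) (km_theta0 km) (km_diff0 km) blin0 subrr.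
rewrite !sub_blinE !mul_blinE opp_blinE !km_cartanE !blinB !km_theta_epsE !blinD.
rewrite !km_cartanE -(km_theta_lie l m) sub_blinE !mul_blinE.
set a := theta l _; set b := theta m _; set c := eps m _; set d := eps m _.
set e := eps (lie l m) _.
have -> : b - d + (a - b - e) = a - (d + e).
  by rewrite addrA [b - d]addrC addrACA subrr addr0 opprD addrA [- d + a]addrC.
rewrite opprB addrC addrA subrK opprB [c + e]addrC [d + e]addrC.
by rewrite opprD addrACA subrr add0r.
Qed.

(** By Cartan's formula, [D * D] commutes with [eps l] exactly when [D] commutes with [theta l]. *)
Lemma km_square0 : D * D = 0.
Proof.
apply: (@km_eq0 _ _ eps) => [x|l u]; rewrite !mul_blinE; first by rewrite (km_diff0 km) blin0.
rewrite !km_cartanE blinB km_cartanE -!mul_blinE km_theta_diff opprB addrCA subrr addr0.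
by [].
Qed.

Section Morphism.
Variables (G' : completeNormedModType C) (eta' : blin X G') (eps' theta' : L -> 'L(G'))
  (D' : 'L(G')) (P' : int -> 'L(G')).
Hypothesis km' : koszul_model eta' eps' theta' D' P'.
Variable Phi : blin G G'.
Hypothesis Phi0 : forall x, Phi (eta x) = eta' x.
Hypothesis PhiE : forall l u, Phi (eps l u) = eps' l (Phi u).

Lemma km_morph_theta l u : Phi (theta l u) = theta' l (Phi u).
Proof.
move: u; apply: (km_ind km) => [x|u v IHu IHv|m u IH].
- by rewrite (km_theta0 km) !Phi0 (km_theta0 km').
- by rewrite !blinD IHu IHv.
- by rewrite km_theta_epsE blinD !PhiE IH -(km_theta_eps km') sub_blinE !mul_blinE addrC subrK.
Qed.

(** Cartan's formula computes [D] on [eps l u] from [D u] and [theta l u], so induction over the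
    generators applies. *)
Lemma km_morph_diff u : Phi (D u) = D' (Phi u).
Proof.
move: u; apply: (km_ind km) => [x|u v IHu IHv|l u IH].
- by rewrite (km_diff0 km) Phi0 (km_diff0 km') blin0.
- by rewrite !blinD IHu IHv.
- rewrite km_cartanE blinB !PhiE IH km_morph_theta -(km_cartan km') add_blinE !mul_blinE.
  by rewrite addrK.
Qed.

Lemma km_morph_deg p u : Phi (P p u) = P' p (Phi u).
Proof.
move: u p; apply: (km_ind km) => [x|u v IHu IHv|l u IH] p.
- by rewrite (km_deg0 km) Phi0 (km_deg0 km'); case: ifP => // _; rewrite ?blin0 ?Phi0.
- by rewrite !blinD IHu IHv.
- rewrite -[P p _]mul_blinE (km_deg km) mul_blinE PhiE IH PhiE.
  by rewrite -!mul_blinE (km_deg km').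
Qed.

End Morphism.

Lemma km_endo_id (Phi : 'L(G)) : (forall x, Phi (eta x) = eta x) ->
  (forall l u, Phi (eps l u) = eps l (Phi u)) -> Phi = 1.
Proof. by move=> Phi0 PhiE; apply: (@km_ext _ _ _ eps). Qed.

End Theory.
End KoszulModels.

(** * The exterior algebra of [L] with coefficients in [X] as a model *)

Section StandardModel.
Variables (R : realType).
Local Notation C := R[i].
Variables (L : lieAlgType C) (X : completeNormedModType C) (rho : L -> 'L(X)).
Local Notation n := (\dim {:L}).
Local Notation e := (vbasis {:L}).
Local Notation G := {ffun {set 'I_n} -> X}.

Definition std_eta : blin X G := bdelta X finset.set0.

Definition std_eps (l : L) : 'L(G) := \sum_i coord e i l *: creation X i.

(** The derivation of the exterior algebra that extends the adjoint action of [l]. *)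
Definition std_ad (l : L) : 'L(G) := \sum_(i < n) std_eps (lie l e`_i) * annihilation X i.

Definition std_theta (l : L) : 'L(G) := pointwise {set 'I_n} (rho l) + std_ad l.

(** The Koszul differential in terms of creation and annihilation. The factor [2^-1] is there
    because the double sum meets each pair of indices twice. *)
Definition std_diff : 'L(G) :=
  \sum_(i < n) pointwise {set 'I_n} (rho e`_i) * annihilation X i +
  \sum_(i < n) \sum_(j < n) 2^-1 *: (std_eps (lie e`_i e`_j) * annihilation X j * annihilation X i).

Definition std_deg : int -> 'L(G) := @ext_degree R n X.

Lemma std_eps_linear : linear std_eps.
Proof.
move=> a l m; rewrite scaler_sumr -big_split; apply: eq_bigr => i _.
by rewrite linearP scalerDl scalerA.
Qed.

Lemma std_epsD l m : std_eps (l + m) = std_eps l + std_eps m.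
Proof. by have := std_eps_linear 1 l m; rewrite !scale1r. Qed.

Lemma std_eps0 : std_eps 0 = 0.
Proof. by apply: (addrI (std_eps 0)); rewrite -std_epsD !addr0. Qed.

Lemma std_epsZ a l : std_eps (a *: l) = a *: std_eps l.
Proof. by have := std_eps_linear a l 0; rewrite std_eps0 !addr0. Qed.

Lemma std_epsN l : std_eps (- l) = - std_eps l.
Proof. by rewrite -scaleN1r std_epsZ scaleN1r. Qed.

Lemma std_eps_basis (i : 'I_n) : std_eps e`_i = creation X i.
Proof.
rewrite /std_eps (bigD1 i) //= big1 => [|j ji].
  by rewrite coord_free ?(basis_free (vbasisP _)) // eqxx scale1r addr0.
by rewrite coord_free ?(basis_free (vbasisP _)) // eq_sym (negbTE ji) scale0r.
Qed.

Lemma std_expand (l : L) : l = \sum_i coord e i l *: e`_i.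
Proof. by apply: coord_vbasis; rewrite memvf. Qed.

Lemma std_eps_lie l m : std_eps (lie l m) = \sum_i coord e i m *: std_eps (lie l e`_i).
Proof.
rewrite {1}(std_expand m) linear_sum.
elim/big_rec2: _ => [|i S k _ <-]; first exact: std_eps0.
by rewrite std_epsD linearZ std_epsZ.
Qed.

Lemma std_anticomm l m : std_eps l * std_eps m = - (std_eps m * std_eps l).
Proof.
apply/eqP; rewrite -addr_eq0; apply/eqP.
have E a b : std_eps a * std_eps b =
    \sum_i \sum_j (coord e i a * coord e j b) *: (creation X i * creation X j).
  rewrite mulr_suml; apply: eq_bigr => i _; rewrite mulr_sumr; apply: eq_bigr => j _.
  by rewrite -scaler_blinAl -scaler_blinAr scalerA.
rewrite !E [X in _ + X]exchange_big -big_split big1 //= => i _.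
rewrite -big_split big1 //= => j _.
by rewrite [coord e j m * _]mulrC -scalerDr creation_anticomm scaler0.
Qed.

Lemma std_sqr l : std_eps l * std_eps l = 0.
Proof.
have : (2 : C) *: (std_eps l * std_eps l) = 0.
  by rewrite scalerDl scale1r {1}std_anticomm addNr.
move/(congr1 (fun T => (2 : C)^-1 *: T)); rewrite scalerA mulVf ?pnatr_eq0 // scale1r.
by rewrite scaler0.
Qed.

Lemma std_annihilation i m :
  annihilation X i * std_eps m = coord e i m *: (1 : 'L(G)) - std_eps m * annihilation X i.
Proof.
apply/eqP; rewrite eq_sym subr_eq; apply/eqP.
rewrite mulr_suml mulr_sumr -big_split /= (bigD1 i) //= big1 => [|j ji].
  by rewrite -scaler_blinAl -scaler_blinAr -scalerDr annihilation_creation eqxx scale1r addr0.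
rewrite -scaler_blinAl -scaler_blinAr -scalerDr annihilation_creation eq_sym.
by rewrite (negbTE ji) scale0r scaler0.
Qed.

Lemma std_pointwise_eps T l :
  pointwise {set 'I_n} T * std_eps l = std_eps l * pointwise {set 'I_n} T.
Proof.
rewrite mulr_sumr mulr_suml; apply: eq_bigr => i _.
by rewrite -scaler_blinAl -scaler_blinAr pointwise_wcomp.
Qed.

Lemma std_ad_eps l m : std_ad l * std_eps m = std_eps m * std_ad l + std_eps (lie l m).
Proof.
rewrite mulr_suml mulr_sumr (std_eps_lie l m) -big_split; apply: eq_bigr => i _ /=.
rewrite -mulrA std_annihilation mulrBr -scaler_blinAr mulr1 [X in _ - X]mulrA.
by rewrite std_anticomm mulNr opprK addrC mulrA.
Qed.

Hypothesis rep : is_representation rho.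

Lemma std_pointwise_lie l : pointwise {set 'I_n} (rho l) =
  \sum_i coord e i l *: pointwise {set 'I_n} (rho e`_i).
Proof.
have rD m k : rho (m + k) = rho m + rho k by have := rep.1 1 m k; rewrite !scale1r.
have r0 : rho 0 = 0 by apply: (addrI (rho 0)); rewrite -rD !addr0.
have rZ a m : rho (a *: m) = a *: rho m by have := rep.1 a m 0; rewrite r0 !addr0.
rewrite {1}(std_expand l); elim/big_rec2: _ => [|i S k _ <-].
  by apply: blinP => f; apply/ffunP => A; rewrite pointwiseE r0 zero_blinE [RHS]ffunE.
by rewrite rD rZ pointwise_opl.
Qed.

(** Moving [std_eps l] across an annihilation operator leaves a coordinate of [l]. The linear part
    thus sums up to [rho l], the quadratic part to the adjoint action. *)
Lemma std_cartan l : std_diff * std_eps l + std_eps l * std_diff = std_theta l.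
Proof.
rewrite /std_diff mulrDl mulrDr addrACA; congr (_ + _).
  rewrite mulr_suml mulr_sumr -big_split std_pointwise_lie; apply: eq_bigr => i _ /=.
  rewrite -mulrA std_annihilation mulrBr -scaler_blinAr mulr1.
  rewrite [std_eps l * (_ * _)]mulrA.
  by rewrite -std_pointwise_eps -!mulrA subrK.
(* [std_eps l] meets both annihilation operators. After summation the two resulting terms are equal,
   by antisymmetry of the bracket, and the factor [2^-1] compensates. *)
have E (i j : 'I_n) : 2^-1 *: (std_eps (lie e`_i e`_j) * annihilation X j * annihilation X i) * std_eps l +
    std_eps l * (2^-1 *: (std_eps (lie e`_i e`_j) * annihilation X j * annihilation X i)) =
    2^-1 *: (coord e i l *: (std_eps (lie e`_i e`_j) * annihilation X j)
      - coord e j l *: (std_eps (lie e`_i e`_j) * annihilation X i)).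
  rewrite -scaler_blinAl -scaler_blinAr -scalerDr; congr (_ *: _).
  rewrite -!mulrA std_annihilation !mulrBr -!scaler_blinAr mulr1 -addrA; congr (_ + _).
  rewrite [annihilation X j * (std_eps l * _)]mulrA std_annihilation mulrBl mulrBr.
  rewrite -scaler_blinAl mul1r -scaler_blinAr opprB addrAC !mulrA.
  by rewrite [std_eps (lie _ _) * std_eps l]std_anticomm !mulNr addNr sub0r.
have E2 : \sum_(i < n) \sum_(j < n)
    coord e i l *: (std_eps (lie e`_i e`_j) * annihilation X j) = std_ad l.
  rewrite exchange_big; apply: eq_bigr => j _ /=.
  rewrite lieC std_epsN std_eps_lie mulNr mulr_suml -sumrN; apply: eq_bigr => i _.
  by rewrite lieC std_epsN mulNr scalerN -scaler_blinAl.
have E3 : \sum_(i < n) \sum_(j < n)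
    coord e j l *: (std_eps (lie e`_i e`_j) * annihilation X i) = - std_ad l.
  rewrite -sumrN; apply: eq_bigr => i _ /=.
  rewrite lieC std_epsN std_eps_lie mulNr opprK mulr_suml; apply: eq_bigr => j _.
  by rewrite -scaler_blinAl.
transitivity (2^-1 *: (std_ad l + std_ad l)); last first.
  by rewrite scalerDr -scalerDl -[2^-1]mul1r -splitr scale1r.
have -> : std_ad l + std_ad l = std_ad l - - std_ad l by rewrite opprK.
rewrite -{1}E2 -E3 -sumrN -big_split /= scaler_sumr.
rewrite mulr_suml mulr_sumr -big_split; apply: eq_bigr => i _ /=.
rewrite -sumrN -big_split /= scaler_sumr mulr_suml mulr_sumr -big_split.
by apply: eq_bigr => j _; exact: E.
Qed.

(** Up to sign, [e_A] is [e_i] times [e_(A :\ i)] for any [i] in [A]; induction on the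
    cardinality. *)
Lemma std_ind (W : G -> Prop) : (forall x, W (std_eta x)) ->
  (forall u v, W u -> W v -> W (u + v)) -> (forall l u, W u -> W (std_eps l u)) ->
  forall u, W u.
Proof.
move=> W0 WD We u; rewrite (ffun_deltaE u).
have W00 : W 0 by rewrite -(blin0 std_eta).
elim/big_ind: _ => // A _.
move: (u A) => x; have [k] := ubnP #|A|; elim: k => // k IH in A x *.
have [->|[i iA]] := finset.set_0Vmem A; first by move=> _; exact: W0.
move=> Ak.
have -> : delta A x = std_eps e`_i (delta (A :\ i) (ext_sign R i A *: x)).
  rewrite std_eps_basis creation_delta !inE eqxx /= finset.setD1K // ext_signD1x.
  by rewrite deltaZ scalerA ext_sign_sqr scale1r.
by apply: We; apply: IH; rewrite (cardsD1 i A) iA in Ak.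
Qed.

Lemma std_deg_eps p l : std_deg p * std_eps l = std_eps l * std_deg (p - 1).
Proof.
rewrite mulr_sumr mulr_suml; apply: eq_bigr => i _.
by rewrite -scaler_blinAr -scaler_blinAl ext_degree_creation.
Qed.

Lemma std_annihilation_eta i x : annihilation X i (std_eta x) = 0.
Proof.
apply/ffunP => A; rewrite annihilationE [RHS]ffunE; case: ifP => // iA.
rewrite ffunE; case: eqP => [h|]; rewrite ?scaler0 //.
by have := setU11 i A; rewrite h inE.
Qed.

Lemma std_ad_eta l x : std_ad l (std_eta x) = 0.
Proof.
rewrite sum_blinE big1 // => i _.
by rewrite mul_blinE std_annihilation_eta blin0.
Qed.

Lemma std_koszul_model :
  koszul_model rho std_eta std_eps std_theta std_diff std_deg.
Proof.
split.
- exact: std_eps_linear.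
- exact: std_ind.
- exact: std_sqr.
- exact: std_cartan.
- move=> x; rewrite add_blinE !sum_blinE !big1 ?addr0 // => i _.
    rewrite sum_blinE big1 // => j _.
    by rewrite scale_blinE mul_blinE std_annihilation_eta blin0 scaler0.
  by rewrite mul_blinE std_annihilation_eta blin0.
- move=> l m; rewrite mulrDl mulrDr std_pointwise_eps std_ad_eps addrA.
  by rewrite [LHS]addrC addrA addNr add0r.
- by move=> l x; rewrite add_blinE std_ad_eta addr0; exact: pointwise_delta.
- exact: std_deg_eps.
- move=> p x; apply/ffunP => A; rewrite ext_degreeE ffunE.
  have [->|A0] := eqVneq A finset.set0.
    by rewrite cards0 eq_sym; case: ifP => _; rewrite ffunE ?eqxx.
  by case: ifP => _ //; case: ifP => _; rewrite ffunE ?(negbTE A0).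
Qed.

Lemma std_diff_deg p : std_diff * std_deg p = std_deg (p - 1) * std_diff.
Proof.
rewrite mulrDl mulrDr !mulr_suml !mulr_sumr; congr (_ + _); apply: eq_bigr => i _.
  by rewrite -mulrA ext_degree_annihilation mulrA pointwise_wcomp mulrA.
rewrite mulr_suml mulr_sumr; apply: eq_bigr => j _.
rewrite -scaler_blinAl -scaler_blinAr; congr (_ *: _).
rewrite -!mulrA ext_degree_annihilation [annihilation X j * _]mulrA.
rewrite ext_degree_annihilation !mulrA std_deg_eps; congr (_ * _ * _ * _).
Qed.

Lemma std_graded_complex : graded_complex n.+1 std_diff std_deg.
Proof.
split.
- exact: ext_degree_idem.
- exact: ext_degree_orth.
- exact: ext_degree_sum.
- exact: std_diff_deg.
- exact: (km_square0 std_koszul_model rep).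
Qed.

End StandardModel.

(** * The differential on wedges of vectors *)

Section OrdinalEnumeration.
Variable n : nat.
Implicit Types (A : {set 'I_n}) (i j : 'I_n) (s : seq 'I_n).

Lemma sorted_enum_set A : sorted (fun i j : 'I_n => (i < j)%N) (enum A).
Proof.
rewrite /enum_mem; apply: sorted_filter; first by move=> i j k; exact: ltn_trans.
rewrite -enumT; have := iota_ltn_sorted 0 n; rewrite -val_enum_ord sorted_map.
by [].
Qed.

Lemma count_lt_index i s : sorted (fun i j : 'I_n => (i < j)%N) s -> i \in s ->
  count (fun j : 'I_n => (j < i)%N) s = index i s.
Proof.
elim: s => // h s IH hs; rewrite inE /=.
have hlt j : j \in s -> (h < j)%N.
  by move: hs; rewrite /= path_sortedE => [/andP[/allP + _]|? ? ?]; [apply|exact: ltn_trans].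
have [-> _|ih /= si] := eqVneq i h.
  rewrite ltnn add0n; apply/eqP; rewrite -leqn0 leqNgt -has_count.
  by apply/hasPn => j js; rewrite -leqNgt ltnW // hlt.
by rewrite hlt // IH ?(path_sorted hs) // add1n.
Qed.

Lemma enum_setD1_val A (j : 'I_#|A|) :
  enum (A :\ enum_val j) = take j (enum A) ++ drop j.+1 (enum A).
Proof.
have jA : (j < size (enum A))%N by rewrite -cardE.
have jE : index (enum_val j) (enum A) = j.
  by rewrite (enum_val_nth (enum_val j)) index_uniq // enum_uniq.
rewrite -{1 2}jE -remE rem_filter ?enum_uniq // /enum_mem -filter_predI.
by apply: eq_filter => x; rewrite /= !inE.
Qed.

Lemma card_lt_enum_val A (j : 'I_#|A|) :
  #|[set i in A | (i < enum_val j)%N]| = j.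
Proof.
have jA : (j < size (enum A))%N by rewrite -cardE.
rewrite -[RHS](index_uniq (enum_val j) jA (enum_uniq _)) -enum_val_nth.
rewrite -count_lt_index ?sorted_enum_set ?mem_enum ?enum_valP //.
rewrite -size_filter cardE /enum_mem -filter_predI; congr size; apply: eq_filter => x.
by rewrite /= !inE andbC.
Qed.

End OrdinalEnumeration.

Lemma nth_take_drop (T : Type) (x0 : T) (s : seq T) j k : (j < size s)%N ->
  nth x0 (take j s ++ drop j.+1 s) k = nth x0 s (bump j k).
Proof.
move=> js; rewrite nth_cat size_take js /bump; case: ltnP => kj.
  by rewrite nth_take // add0n.
by rewrite nth_drop; congr nth; rewrite addSn subnKC.
Qed.

Section WedgeFormula.
Variables (R : realType).
Local Notation C := R[i].
Variables (L : lieAlgType C) (X : completeNormedModType C).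
Local Notation n := (\dim {:L}).
Local Notation e := (vbasis {:L}).
Local Notation G := {ffun {set 'I_n} -> X}.

Let cmat (s : seq L) (r : seq 'I_n) m : 'M[C]_m :=
  \matrix_(i < m, j < m) nth 0 [seq coord e a s`_i | a <- r] j.

Let wedge_coordE s (A : {set 'I_n}) :
  wedge_coord s A = if size s == #|A| then \det (cmat s (enum A) #|A|) else 0.
Proof.
rewrite /wedge_coord; case: ifP => // _; apply: (congr1 determinant); apply/matrixP => i j.
have jA : (j < size (enum A))%N by rewrite -cardE.
by rewrite !mxE (nth_map (enum_val j)) // -enum_val_nth.
Qed.

Let cmat_cons l s r m : size r = m.+1 -> \det (cmat (l :: s) r m.+1) =
  \sum_(j < m.+1) nth 0 [seq coord e a l | a <- r] j *
    ((-1) ^+ j * \det (cmat s (take j r ++ drop j.+1 r) m)).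
Proof.
move=> rm; rewrite (expand_det_row _ ord0); apply: eq_bigr => j _.
rewrite mxE /cofactor add0n; congr (_ * (_ * \det _)); apply/matrixP => i k.
rewrite !mxE /= map_cat map_take map_drop nth_take_drop ?size_map ?rm //.
Qed.

(** Laplace expansion along the row of [l]. The sign of the [j]-th column is [ext_sign] of the
    [j]-th element of [A], since exactly [j] elements precede it. *)
Lemma wedge_coord_cons l s (A : {set 'I_n}) : wedge_coord (l :: s) A =
  \sum_(i in A) coord e i l * (ext_sign R i A * wedge_coord s (A :\ i)).
Proof.
rewrite wedge_coordE /=; case: eqP => [sA|sA]; last first.
  rewrite big1 // => i iA; rewrite wedge_coordE; case: eqP => [sA'|]; rewrite ?mulr0 //.
  by case: sA; rewrite sA' (cardsD1 i A) iA.
rewrite big_enum_val /=; have sE : size (enum A) = (size s).+1 by rewrite -cardE.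
transitivity (\det (cmat (l :: s) (enum A) (size s).+1)).
  by rewrite sA.
rewrite cmat_cons //.
(* Transports the sum between the ordinals below [(size s).+1] and below [#|A|], equal only
   propositionally. *)
have E : forall (m : nat) (mA : m = #|A|) (F : nat -> C) (H : 'I_#|A| -> C),
    (forall j : 'I_#|A|, F j = H j) -> \sum_(j < m) F j = \sum_(j < #|A|) H j.
  by move=> m -> F H FH; apply: eq_bigr => j _.
apply: (E _ sA (fun j => nth 0 [seq coord e a l | a <- enum A] j *
    ((-1) ^+ j * \det (cmat s (take j (enum A) ++ drop j.+1 (enum A)) (size s))))) => j.
have jA : (j < size (enum A))%N by rewrite -cardE.
rewrite (nth_map (enum_val j)) // -enum_val_nth /ext_sign card_lt_enum_val.
rewrite wedge_coordE -enum_setD1_val.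
have sD : size s = #|A :\ enum_val j|.
  by move: sA; rewrite (cardsD1 (enum_val j) A) enum_valP => -[].
by rewrite -sD eqxx.
Qed.

Definition wedge (s : seq L) (x : X) : G := foldr (fun l u => std_eps X l u) (std_eta L X x) s.

Lemma wedge_cons l s x : wedge (l :: s) x = std_eps X l (wedge s x).
Proof. by []. Qed.

Lemma wedge_swap l m s x : wedge [:: l, m & s] x = - std_eps X m (wedge (l :: s) x).
Proof. by rewrite !wedge_cons -!mul_blinE std_anticomm opp_blinE. Qed.

(** Reconciles iterated exterior multiplication with the minors that define [wedge_coord]. *)
Lemma wedgeE s x : wedge s x = [ffun A => wedge_coord s A *: x].
Proof.
elim: s => [|l s IH]; apply/ffunP => A; rewrite [RHS]ffunE.
  rewrite ffunE wedge_coordE /= [0%N == _]eq_sym cards_eq0; case: eqP => [->|]; rewrite ?scale0r //.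
  by rewrite cards0 det_mx00 scale1r.
rewrite wedge_cons IH /std_eps sum_blinE sum_ffunE wedge_coord_cons scaler_suml [RHS]big_mkcond.
apply: eq_bigr => i _; rewrite scale_blinE ffunE creationE; case: ifP => _.
  by rewrite ffunE !scalerA mulrA.
by rewrite scaler0.
Qed.

Lemma wedge_basis (A : {set 'I_n}) x : wedge [seq e`_i | i : 'I_n <- enum A] x = delta A x.
Proof.
have -> : wedge [seq e`_i | i : 'I_n <- enum A] x =
    ordered_prod (fun i => creation X i) A (std_eta L X x).
  rewrite /ordered_prod.
  have -> : \prod_(i in A) creation X i = \prod_(i <- enum A) creation X i.
    by rewrite -big_filter [index_enum _]unlock.
  elim: (enum A) => [|i s IH]; first by rewrite big_nil.
  by rewrite /= big_cons mul_blinE -IH std_eps_basis.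
have [k] := ubnP #|A|; elim: k => // k IH in A *.
have [->|[i iA]] := finset.set_0Vmem A; first by rewrite ordered_prod0.
have anti (a b : 'I_n) : creation X a * creation X b = - (creation X b * creation X a).
  by apply/eqP; rewrite -addr_eq0 creation_anticomm.
move=> Ak; have := mul_ordered_prod (g := fun a => creation X a) anti (fun a => creation_sqr X a) i (A :\ i).
have nA : (i \in A :\ i) = false by rewrite !inE eqxx.
rewrite nA finset.setD1K // => /(congr1 (fun T : 'L(G) => T (std_eta L X x))).
rewrite mul_blinE scale_blinE IH; last by rewrite (cardsD1 i A) iA in Ak.
rewrite creation_delta nA finset.setD1K //.
move=> /(congr1 (fun u => ext_sign R i (A :\ i) *: u)).
by rewrite !scalerA ext_sign_sqr !scale1r => <-.
Qed.

Lemma delete0 (l : L) s : delete 0 (l :: s) = s.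
Proof. by rewrite /delete take0 drop1. Qed.

Lemma deleteS (l : L) s k : delete k.+1 (l :: s) = l :: delete k s.
Proof. by []. Qed.

Variable rho : L -> 'L(X).
Hypothesis rep : is_representation rho.

Let km := std_koszul_model rep.

(** A derivation acts on one factor at a time; bringing the [j]-th factor to the front costs
    [(-1) ^+ j]. *)
Lemma ad_wedge l s x : std_ad X l (wedge s x) =
  \sum_(j < size s) (-1) ^+ j *: wedge (lie l s`_j :: delete j s) x.
Proof.
elim: s => [|m s IH]; first by rewrite big_ord0 std_ad_eta.
rewrite -[wedge (m :: s) x]/(std_eps X m (wedge s x)) -mul_blinE std_ad_eps add_blinE.
rewrite mul_blinE IH -[size (m :: s)]/((size s).+1) big_ord_recl expr0 scale1r addrC.
rewrite delete0; congr (_ + _).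
rewrite blin_sum; apply: eq_bigr => j _; rewrite blinZ lift0 deleteS exprS mulN1r scaleNr.
by rewrite -scalerN wedge_swap opprK.
Qed.

(** Induction on [s] with Cartan's formula: [theta l] yields the terms in which the first vector [l]
    is consumed, and [- eps l] applied to the other terms accounts for their indices shifting by
    one. *)
Lemma diff_wedge s x : std_diff rho (wedge s x) =
  \sum_(k < size s) (-1) ^+ k *: wedge (delete k s) (rho s`_k x) +
  \sum_(j < size s) \sum_(i < j) (-1) ^+ (i + j).+1 *:
    wedge (lie s`_i s`_j :: delete i (delete j s)) x.
Proof.
elim: s => [|l s IH]; first by rewrite !big_ord0 addr0 (km_diff0 km).
rewrite -[wedge (l :: s) x]/(std_eps X l (wedge s x)) (km_cartanE km) IH.
rewrite add_blinE ad_wedge.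
rewrite -[size (l :: s)]/((size s).+1) [X in _ = X + _]big_ord_recl.
rewrite [X in _ = _ + X]big_ord_recl big_ord0 add0r expr0 scale1r delete0.
have -> : pointwise {set 'I_n} (rho l) (wedge s x) = wedge s (rho l x).
  elim: s {IH} => [|m s IH]; first exact: pointwise_delta.
  by rewrite !wedge_cons -mul_blinE std_pointwise_eps mul_blinE IH.
rewrite -!addrA; congr (_ + _); rewrite blinD opprD addrCA; congr (_ + _).
  rewrite blin_sum -sumrN; apply: eq_bigr => k _.
  by rewrite blinZ lift0 deleteS exprS mulN1r scaleNr.
rewrite blin_sum -sumrN -big_split; apply: eq_bigr => j _.
rewrite lift0 big_ord_recl add0n deleteS delete0 !exprS !mulN1r opprK.
congr (_ + _); rewrite blin_sum -sumrN; apply: eq_bigr => i _.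
rewrite blinZ lift0 deleteS addSn addnS wedge_swap !exprS !mulN1r.
by rewrite !scaleNr scalerN !opprK.
Qed.

End WedgeFormula.

(** * Comparison with the degreewise Koszul complex *)

Lemma sum_sub (V : nmodType) (I : finType) (Q : pred I) (F : I -> V) :
  \sum_(i | Q i) F i = \sum_(x : {i | Q i}) F (val x).
Proof.
rewrite (reindex_omap (val : {i | Q i} -> I) insub); last first.
  by move=> i Qi; rewrite insubT.
by apply: eq_bigl => -[i Qi] /=; rewrite insubT Qi /= eqxx.
Qed.

Section DegreewiseComplex.
Variables (R : realType).
Local Notation C := R[i].
Variables (L : lieAlgType C) (X : completeNormedModType C) (rho : L -> 'L(X)).
Hypothesis rep : is_representation rho.
Local Notation n := (\dim {:L}).
Local Notation e := (vbasis {:L}).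
Local Notation G := {ffun {set 'I_n} -> X}.
Local Notation D := (std_diff rho).
Local Notation P := (std_deg L X).

Let gc := std_graded_complex rep.

Definition restrict_fun (p : int) (f : G) : koszul_space L X p := [ffun A => f (val A)].

Lemma restrict_linear p : linear (restrict_fun p).
Proof. by move=> a f g; apply/ffunP => A; rewrite !ffunE. Qed.

Lemma restrict_bounded p f : rnorm (restrict_fun p f) <= 1 * rnorm f.
Proof.
rewrite mul1r !rnorm_ffun; under eq_bigr do rewrite ffunE.
rewrite [leRHS](bigID (fun A : {set 'I_n} => #|A|%:Z == p)) /=.
rewrite (sum_sub (fun A : {set 'I_n} => #|A|%:Z == p) (fun A => rnorm (f A))) /=.
by rewrite lerDl sumr_ge0 // => A _; exact: rnorm_ge0.
Qed.

Definition restrict p : blin G (koszul_space L X p) :=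
  mk_blin_bounded (restrict_linear p) (restrict_bounded p).

Definition extend_fun p (u : koszul_space L X p) : G :=
  [ffun A => if insub A is Some a then u a else 0].

Lemma extend_linear p : linear (@extend_fun p).
Proof.
move=> a u v; apply/ffunP => A; rewrite !ffunE; case: insubP => [b _ _|_].
  by rewrite !ffunE.
by rewrite scaler0 addr0.
Qed.

Lemma extend_bounded p (u : koszul_space L X p) : rnorm (extend_fun u) <= 1 * rnorm u.
Proof.
rewrite mul1r !rnorm_ffun (bigID (fun A : {set 'I_n} => #|A|%:Z == p)) /=.
rewrite [X in _ + X]big1 => [|A Ap]; last by rewrite ffunE insubN // rnorm0.
rewrite addr0 (sum_sub (fun A : {set 'I_n} => #|A|%:Z == p) (fun A => rnorm (extend_fun u A))) /=.
by apply: ler_sum => A _; rewrite ffunE valK.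
Qed.

Definition extend p : blin (koszul_space L X p) G :=
  mk_blin_bounded (@extend_linear p) (@extend_bounded p).

Lemma restrictE p f A : restrict p f A = f (val A).
Proof. by rewrite [LHS]ffunE. Qed.

Lemma extendE p u A : extend p u A = if insub A is Some a then u a else 0.
Proof. by rewrite [LHS]ffunE. Qed.

Lemma extendK p u : restrict p (extend p u) = u.
Proof. by apply/ffunP => A; rewrite restrictE extendE valK. Qed.

Lemma restrictK p f : extend p (restrict p f) = P p f.
Proof.
apply/ffunP => A; rewrite extendE ext_degreeE; case: insubP => [a -> aA|/negbTE-> //].
by rewrite restrictE aA.
Qed.

Lemma extend_deg p u : P p (extend p u) = extend p u.
Proof. by rewrite -restrictK extendK. Qed.

Lemma restrict_deg p f : restrict p (P p f) = restrict p f.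
Proof. by rewrite -restrictK extendK. Qed.

Lemma restrict_out p q f : p != q -> P p f = f -> restrict q f = 0.
Proof.
move=> pq <-; apply/ffunP => A; rewrite restrictE ext_degreeE [RHS]ffunE.
by case: eqP => // Ap; case/eqP: pq; rewrite -Ap; apply/eqP; exact: valP A.
Qed.

Lemma koszul_formulaE q x s : koszul_formula rho q x s = restrict q (D (wedge s x)).
Proof.
have wE y r : wedge_tensor q y r = restrict q (wedge r y).
  by apply/ffunP => A; rewrite restrictE wedgeE !ffunE.
rewrite (diff_wedge rep) blinD !blin_sum /koszul_formula; congr (_ + _).
  by apply: eq_bigr => k _; rewrite blinZ wE.
apply: eq_bigr => j _; rewrite blin_sum; apply: eq_bigr => i _.
by rewrite blinZ wE.
Qed.

(** Both sides are sums over the vectors [x (x) e_A], where [diff_wedge] applies. *)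
Lemma koszul_dE p q u : koszul_d rho q u = restrict q (D (extend p u)).
Proof.
rewrite (ffun_deltaE (extend p u)) !blin_sum.
transitivity (\sum_(A : {set 'I_n} | #|A|%:Z == p) restrict q (D (delta A (extend p u A)))).
  rewrite sum_sub; apply: eq_bigr => A _.
  by rewrite koszul_formulaE wedge_basis extendE valK.
rewrite big_mkcond; apply: eq_bigr => A _; case: ifP => // /negbT Ap.
by rewrite extendE insubN // delta0 !blin0.
Qed.

Lemma extend_koszul_d p u : extend (p - 1) (koszul_d rho (p - 1) u) = D (extend p u).
Proof. by rewrite koszul_dE restrictK -(gr_diffE gc) extend_deg. Qed.

Lemma extend_koszul_dS p (u : koszul_space L X (p + 1)) :
  extend p (koszul_d rho p u) = D (extend (p + 1) u).
Proof. by rewrite koszul_dE restrictK -(gr_diffS gc) extend_deg. Qed.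

Lemma homology_gexact p : homology_neq0 (koszul_d rho) p <-> ~ gexact D P p.
Proof.
split=> [hp ex|nex hp].
  apply: hp; apply/seteqP; split=> [u /= du|u [v _ <-] /=].
    have [|v vu] := ex (extend p u) (extend_deg u).
      by rewrite -extend_koszul_d du blin0.
    exists (restrict (p + 1) v) => //.
    by rewrite koszul_dE restrictK (gr_diffS gc) vu extend_deg extendK.
  by rewrite koszul_dE extend_koszul_dS (gr_square0E gc) blin0.
apply: nex => f Pf Df; have fE : extend p (restrict p f) = f by rewrite restrictK.
have : [set u | koszul_d rho (p - 1) u = 0] (restrict p f).
  by rewrite /= koszul_dE fE Df blin0.
rewrite hp => -[v _ vf]; exists (extend (p + 1) v).
by rewrite -extend_koszul_dS vf fE.
Qed.

Lemma closed_preimage_blin (E F : completeNormedModType C) (T : blin E F) (V : set F) :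
  closed V -> closed [set x | V (T x)].
Proof. by move=> cV; apply: closed_comp => // x _; exact: blin_continuous. Qed.

(** Each range is a preimage of the other under [restrict] or [extend], up to intersecting with the
    homogeneous vectors. *)
Lemma closed_gclosed p :
  closed (range (@koszul_d _ _ _ rho p (p - 1))) <-> gclosed D P p.
Proof.
split=> [cd|cD]; rewrite /gclosed.
  have -> : range (D * P p) = [set f | (P (p - 1) - 1) f = 0] `&`
      [set f | range (@koszul_d _ _ _ rho p (p - 1)) (restrict (p - 1) f)].
    apply/seteqP; split=> [_ [f _ <-]|f [Pf [u _ uf]]].
      split.
        change ((P (p - 1) - 1) (D (P p f)) = 0).
        by rewrite sub_blinE one_blinE (gr_diffE gc) (gr_idemE gc) subrr.
      exists (restrict p f); first by [].
      by rewrite koszul_dE restrictK mul_blinE.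
    exists (extend p u); first by [].
    rewrite mul_blinE extend_deg -extend_koszul_d uf restrictK.
    by apply/eqP; rewrite -subr_eq0; apply/eqP; exact: Pf.
  apply: closedI; first exact: gr_closed_ker.
  exact: closed_preimage_blin.
have -> : range (@koszul_d _ _ _ rho p (p - 1)) =
    [set u | range (D * P p) (extend (p - 1) u)].
  apply/seteqP; split=> [_ [u _ <-]|u [f _ fu]].
    exists (extend p u); first by [].
    by rewrite mul_blinE extend_deg extend_koszul_d.
  exists (restrict p f); first by [].
  by rewrite koszul_dE restrictK -mul_blinE fu extendK.
exact: closed_preimage_blin.
Qed.

Lemma split_gsplit p : split_at (koszul_d rho) p <-> gsplit D P p.
Proof.
have pp : p + 1 != p by rewrite -subr_eq0 addrAC subrr add0r.
split=> [[h [h' hP]]|[H HP]].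
  (* The two homotopies start from different degrees, so their sum restricts to each of them. *)
  pose H : 'L(G) := bcomp (extend (p + 1)) (bcomp h (restrict p)) +
    bcomp (extend p) (bcomp h' (restrict (p - 1))).
  have HE f : H f = extend (p + 1) (h (restrict p f)) + extend p (h' (restrict (p - 1) f)) by [].
  exists H => f Pf; pose v := restrict p f.
  have Df : P (p - 1) (D f) = D f by rewrite -(gr_diffE gc) Pf.
  have p1 : p - 1 != p by rewrite -subr_eq0 addrAC subrr add0r oppr_eq0.
  have -> : H f = extend (p + 1) (h v).
    by rewrite HE (restrict_out (q := p - 1) _ Pf) 1?eq_sym // !blin0 addr0.
  have -> : H (D f) = extend p (h' (restrict (p - 1) (D f))).
    by rewrite HE (restrict_out p1 Df) !blin0 add0r.
  have -> : restrict (p - 1) (D f) = koszul_d rho (p - 1) v by rewrite koszul_dE restrictK Pf.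
  by rewrite -extend_koszul_dS -blinD hP restrictK Pf.
exists (bcomp (restrict (p + 1)) (bcomp H (extend p))), (bcomp (restrict p) (bcomp H (extend (p - 1)))).
move=> u; rewrite -[RHS](extendK u) -[in RHS](HP _ (extend_deg u)) blinD; congr (_ + _).
  rewrite koszul_dE -[bcomp _ _ u]/(restrict (p + 1) (H (extend p u))) restrictK.
  by rewrite (gr_diffS gc) restrict_deg.
by rewrite -[LHS]/(restrict p (H (extend (p - 1) (koszul_d rho (p - 1) u)))) extend_koszul_d.
Qed.

End DegreewiseComplex.

(** * The Koszul complex of a tensor product *)

Section Lifts.
Variables (R : realType).
Local Notation C := R[i].

Lemma tensor_structure_iso (G1 G2 G G' : completeNormedModType C) (t : G1 -> G2 -> G)
    (tt : 'L(G1) -> 'L(G2) -> 'L(G)) (Phi : blin G' G) (Psi : blin G G') :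
  (forall u, Phi (Psi u) = u) -> (forall u, Psi (Phi u) = u) -> tensor_structure t tt ->
  tensor_structure (fun x y => Psi (t x y)) (fun T S => bcomp Psi (bcomp (tt T S) Phi)).
Proof.
move=> PhiK PsiK ts; split.
- by move=> y a x x'; rewrite (ts_linl ts) blinD blinZ.
- by move=> x a y y'; rewrite (ts_linr ts) blinD blinZ.
- by move=> S a T T'; apply: blinP => u /=; rewrite (ts_opl ts) add_blinE scale_blinE blinD blinZ.
- by move=> T a S S'; apply: blinP => u /=; rewrite (ts_opr ts) add_blinE scale_blinE blinD blinZ.
- by move=> T S x y /=; rewrite PhiK (ts_op ts).
- by move=> T1 S1 T2 S2; apply: blinP => u; rewrite mul_blinE /= PhiK -(ts_mul ts).
- by apply: blinP => u /=; rewrite (ts_one ts) one_blinE PsiK.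
(* Adding 1 keeps the denominator positive even if [Phi] is zero. *)
- have [c c0 cP] := ts_lower ts; have p0 : 0 < rnorm Phi + 1 by rewrite ltr_wpDl ?rnorm_ge0.
  exists (c / (rnorm Phi + 1)) => [|x y]; first by rewrite divr_gt0.
  rewrite mulrAC ler_pdivrMr //; apply: le_trans (cP x y) _.
  rewrite -{1}(PhiK (t x y)); apply: le_trans (opnormP _ _) _.
  by rewrite mulrC ler_wpM2l ?rnorm_ge0 // lerDl.
- have [c c0 cP] := ts_upper ts; exists (rnorm Psi * c) => [|x y].
    by rewrite mulr_ge0 ?rnorm_ge0.
  by apply: le_trans (opnormP _ _) _; rewrite -mulrA ler_wpM2l ?rnorm_ge0.
- have [c c0 cP] := ts_op_upper ts; exists (rnorm Psi * c * rnorm Phi) => [|T S].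
    by rewrite !mulr_ge0 ?rnorm_ge0.
  have TS0 : 0 <= rnorm T * rnorm S by rewrite mulr_ge0 ?rnorm_ge0.
  apply: rnorm_opnorm_le => [|u]; first by rewrite !mulr_ge0 ?rnorm_ge0.
  apply: le_trans (opnormP Psi (tt T S (Phi u))) _; rewrite -!mulrA ler_wpM2l ?rnorm_ge0 //.
  apply: le_trans (opnormP (tt T S) (Phi u)) _; have h1 := cP T S; have h2 := opnormP Phi u.
  apply: le_trans (ler_pM (rnorm_ge0 _) (rnorm_ge0 _) h1 h2) _.
  rewrite [leRHS](_ : _ = c * (rnorm T * rnorm S) * (rnorm Phi * rnorm u)) //; ring.
Qed.

Lemma anticomm_prod (Y : normedModType C) (I : Type) (g : I -> 'L(Y)) (h : 'L(Y))
    (r : seq I) (Q : pred I) : (forall i, h * g i = - (g i * h)) ->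
  h * \prod_(i <- r | Q i) g i = (-1) ^+ count Q r *: (\prod_(i <- r | Q i) g i * h).
Proof.
move=> hg; elim: r => [|i r IH]; first by rewrite !big_nil mulr1 mul1r scale1r.
rewrite !big_cons /=; case: ifP => _; last by rewrite IH.
rewrite mulrA hg mulNr -(mulrA (g i) h) IH -scaler_blinAr (mulrA (g i)).
rewrite add1n exprS mulN1r scaleNr.
by [].
Qed.

Variables (L : lieAlgType C) (X : completeNormedModType C) (rho : L -> 'L(X)).
Variables (G' : completeNormedModType C) (eta' : blin X G')
  (eps' theta' : L -> 'L(G')) (D' : 'L(G')) (P' : int -> 'L(G')).
Hypothesis km' : koszul_model rho eta' eps' theta' D' P'.

Section StandardLift.
Local Notation n := (\dim {:L}).
Local Notation e := (vbasis {:L}).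
Local Notation G := {ffun {set 'I_n} -> X}.

(** The universal property of the standard model: [x (x) e_A] has to go to the ordered product of
    the [eps' e_i] applied to [eta' x]. *)
Definition std_lift : blin G G' :=
  \sum_(A : {set 'I_n})
    bcomp (ordered_prod (fun i : 'I_n => eps' e`_i) A) (bcomp eta' (bcoord X A)).

Lemma std_lift_delta A x :
  std_lift (delta A x) = ordered_prod (fun i : 'I_n => eps' e`_i) A (eta' x).
Proof.
rewrite /std_lift sum_blinE (sum_single (i0 := A)) => [|B BA].
  by rewrite /= ffunE eqxx.
by rewrite /= ffunE (negbTE BA) !blin0.
Qed.

Lemma std_lift_eta x : std_lift (std_eta L X x) = eta' x.
Proof. by rewrite [LHS]std_lift_delta ordered_prod0. Qed.

Lemma std_lift_eps l u : std_lift (std_eps X l u) = eps' l (std_lift u).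
Proof.
suff h : forall i : 'I_n, bcomp std_lift (creation X i) = bcomp (eps' e`_i) std_lift.
  have -> : eps' l = \sum_i coord e i l *: eps' e`_i.
    rewrite {1}(std_expand l) (km_sum km'); apply: eq_bigr => i _.
    exact: (kmZ km').
  rewrite [RHS]sum_blinE.
  have -> : std_eps X l u = \sum_i coord e i l *: creation X i u by rewrite /std_eps sum_blinE.
  rewrite blin_sum; apply: eq_bigr => i _.
  rewrite scale_blinE blinZ; congr (_ *: _).
  exact: (congr1 (fun T : blin G G' => T u) (h i)).
move=> i; apply: ffun_blinP => A x; rewrite !comp_blinE creation_delta std_lift_delta.
rewrite -mul_blinE mul_ordered_prod //; last first.
- by move=> j; exact: (km_sqr km').
- by move=> j k; exact: (km_anticomm km').
case: ifP => _; first by rewrite blin0.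
by rewrite blinZ std_lift_delta.
Qed.

End StandardLift.
End Lifts.

Lemma commD (A : pzRingType) (a b x y c d : A) :
  a * x - x * a = c -> b * x = x * b -> a * y = y * a ->
  b * y - y * b = d -> (a + b) * (x + y) - (x + y) * (a + b) = c + d.
Proof.
move=> <- bx ay <-; rewrite !mulrDl !mulrDr bx ay (addrACA (x * a)) opprD addrACA.
by rewrite [x * a + _]addrC addrKA [x * b + b * y]addrC addrKA.
Qed.

Section TensorAlgebra.
Variables (R : realType).
Local Notation C := R[i].
Variables (G1 G2 G : completeNormedModType C) (t : G1 -> G2 -> G)
  (tt : 'L(G1) -> 'L(G2) -> 'L(G)).
Hypothesis ts : tensor_structure t tt.
Variables (L1 L2 : lieAlgType C) (X1 X2 : completeNormedModType C).
Variables (rho1 : L1 -> 'L(X1)) (eta1 : blin X1 G1) (eps1 theta1 : L1 -> 'L(G1))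
  (D1 : 'L(G1)) (P1 : int -> 'L(G1)).
Variables (rho2 : L2 -> 'L(X2)) (eta2 : blin X2 G2) (eps2 theta2 : L2 -> 'L(G2))
  (D2 : 'L(G2)) (P2 : int -> 'L(G2)).
Hypotheses (km1 : koszul_model rho1 eta1 eps1 theta1 D1 P1)
  (km2 : koszul_model rho2 eta2 eps2 theta2 D2 P2).
Variable s : 'L(G1).
Hypotheses (ss : s * s = 1) (sD : s * D1 = - (D1 * s))
  (seps : forall l, s * eps1 l = - (eps1 l * s)).

(** The sign [s] in front of [eps2] makes multiplications by vectors of [L1] and of [L2]
    anticommute. [tensor_theta] carries no sign, the Lie derivative being of degree 0. *)
Definition tensor_eps (l : L1 * L2) : 'L(G) := tt (eps1 l.1) 1 + tt s (eps2 l.2).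
Definition tensor_theta (l : L1 * L2) : 'L(G) := tt (theta1 l.1) 1 + tt 1 (theta2 l.2).
Definition tensor_diff : 'L(G) := tt D1 1 + tt s D2.

Lemma sign_theta l : s * theta1 l = theta1 l * s.
Proof.
rewrite -(km_cartan km1) mulrDr mulrDl !mulrA sD seps !mulNr -!mulrA.
by rewrite sD seps !mulrN !opprK.
Qed.

Lemma tensor_eps_linear : linear tensor_eps.
Proof.
move=> a l m; rewrite /tensor_eps (km_eps km1) (km_eps km2) (ts_opl ts) (ts_opr ts).
by rewrite scalerDr addrACA.
Qed.

Lemma tensor_eps_sqr l : tensor_eps l * tensor_eps l = 0.
Proof.
rewrite mulrDl !mulrDr !(ts_mul ts) !mulr1 !mul1r seps (tsNl ts) ss.
by rewrite (km_sqr km1) (km_sqr km2) (ts0l ts) (ts0r ts) add0r addr0 addrN.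
Qed.

Lemma tensor_cartan l :
  tensor_diff * tensor_eps l + tensor_eps l * tensor_diff = tensor_theta l.
Proof.
apply: anticommD; rewrite !(ts_mul ts) ?mulr1 ?mul1r.
- by rewrite -(tsDl ts) (km_cartan km1).
- by rewrite seps (tsNl ts).
- by rewrite sD (tsNl ts) opprK.
- by rewrite ss -(tsDr ts) (km_cartan km2).
Qed.

Lemma tensor_theta_eps l m :
  tensor_theta l * tensor_eps m - tensor_eps m * tensor_theta l = tensor_eps (lie l m).
Proof.
apply: commD; rewrite !(ts_mul ts) ?mulr1 ?mul1r.
- by rewrite -(tsBl ts) (km_theta_eps km1).
- by [].
- by rewrite sign_theta.
- by rewrite -(tsBr ts) (km_theta_eps km2).
Qed.

End TensorAlgebra.

(** * The total complex as a model over the product Lie algebra *)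

Section TotalComplex.
Variables (R : realType).
Local Notation C := R[i].
Variables (L1 L2 : lieAlgType C) (X1 X2 X : completeNormedModType C)
  (t : X1 -> X2 -> X) (tt : 'L(X1) -> 'L(X2) -> 'L(X)).
Hypothesis ts : tensor_structure t tt.
Variables (rho1 : L1 -> 'L(X1)) (rho2 : L2 -> 'L(X2)).
Hypotheses (rep1 : is_representation rho1) (rep2 : is_representation rho2).
Local Notation n1 := (\dim {:L1}).
Local Notation n2 := (\dim {:L2}).
Local Notation e1 := (vbasis {:L1}).
Local Notation e2 := (vbasis {:L2}).
Local Notation I1 := {set 'I_n1}.
Local Notation I2 := {set 'I_n2}.
Local Notation G1 := {ffun I1 -> X1}.
Local Notation G2 := {ffun I2 -> X2}.
Local Notation G := {ffun I1 * I2 -> X}.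
Local Notation L := (L1 * L2)%type.
Local Notation "T (x) S" := (@ffun_op R X1 X2 X tt I1 I2 T S) (at level 35).

Let tsG : tensor_structure (ffun_tensor t (I := I1) (J := I2)) (@ffun_op R X1 X2 X tt I1 I2) :=
  ffun_tensor_structure ts I1 I2.
Let km1 := std_koszul_model rep1.
Let km2 := std_koszul_model rep2.
Let gc1 := std_graded_complex rep1.
Let gc2 := std_graded_complex rep2.

Definition parity : 'L(G1) := ext_parity n1 X1.

Lemma parity_sqr : parity * parity = 1.
Proof. exact: (sign_square gc1 (@ext_parity_degree _ _ _)). Qed.

Lemma parity_eps l : parity * std_eps X1 l = - (std_eps X1 l * parity).
Proof.
apply: (sign_odd gc1 (@ext_parity_degree _ _ _)) => p.
by have := std_deg_eps X1 (p + 1) l; rewrite addrK => ->.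
Qed.

Lemma parity_diff : parity * std_diff rho1 = - (std_diff rho1 * parity).
Proof. exact: (sign_diff gc1 (@ext_parity_degree _ _ _)). Qed.

Definition tot_eta : blin X G := bdelta X (finset.set0, finset.set0).

Definition tot_eps : L -> 'L(G) :=
  tensor_eps (@ffun_op R X1 X2 X tt I1 I2) (std_eps X1) (std_eps X2) parity.

Definition tot_theta : L -> 'L(G) :=
  tensor_theta (@ffun_op R X1 X2 X tt I1 I2) (std_theta rho1) (std_theta rho2).

Definition tot_diff : 'L(G) :=
  tensor_diff (@ffun_op R X1 X2 X tt I1 I2) (std_diff rho1) (std_diff rho2) parity.

Definition tot_deg (p : int) : 'L(G) :=
  wcomp X (fun AB : I1 * I2 => (#|AB.1|%:Z + #|AB.2|%:Z == p)%:R) id.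

Lemma tot_degE p f AB :
  tot_deg p f AB = if #|AB.1|%:Z + #|AB.2|%:Z == p then f AB else 0.
Proof. by rewrite wcompE; case: ifP; rewrite ?scale0r ?scale1r. Qed.

Lemma tot_creation1E (i : 'I_n1) f AB : (creation X1 i (x) 1) f AB =
  if i \in AB.1 then ext_sign R i AB.1 *: f (AB.1 :\ i, AB.2) else 0.
Proof.
rewrite -(wcomp1 I2 X2) (ffun_op_wcomp ts) wcompE mulr1.
by case: ifP; rewrite ?scale0r.
Qed.

Lemma tot_creation2E (i : 'I_n2) f AB : (parity (x) creation X2 i) f AB =
  if i \in AB.2 then ((-1) ^+ #|AB.1| * ext_sign R i AB.2) *: f (AB.1, AB.2 :\ i) else 0.
Proof.
rewrite (ffun_op_wcomp ts) wcompE.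
by case: ifP; rewrite ?mulr0 ?scale0r.
Qed.

Lemma tot_creation1_delta (i : 'I_n1) A B x : (creation X1 i (x) 1) (delta (A, B) x) =
  if i \in A then 0 else ext_sign R i A *: delta (i |: A, B) x.
Proof.
apply/ffunP => -[A' B']; rewrite tot_creation1E /= [delta _ _ _]ffunE -pair_eqE /=.
transitivity (if B' == B then creation X i (delta A x) A' else 0).
  by rewrite creationE ffunE; case: (B' == B); rewrite ?andbT // andbF scaler0; case: ifP.
rewrite creation_delta; case: (i \in A); first by rewrite !ffunE; case: ifP.
rewrite ffunE [RHS]ffunE !ffunE -pair_eqE /=.
by case: (B' == B); rewrite ?andbT // andbF scaler0.
Qed.

Lemma tot_creation2_delta (i : 'I_n2) A B x : (parity (x) creation X2 i) (delta (A, B) x) =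
  if i \in B then 0 else ((-1) ^+ #|A| * ext_sign R i B) *: delta (A, i |: B) x.
Proof.
apply/ffunP => -[A' B']; rewrite tot_creation2E /= [delta _ _ _]ffunE -pair_eqE /=.
transitivity (if A' == A then (-1) ^+ #|A| *: creation X i (delta B x) B' else 0).
  rewrite creationE ffunE; case: eqP => [->|_] /=; last by rewrite scaler0; case: ifP.
  by case: ifP; rewrite ?scaler0 ?scalerA.
rewrite creation_delta; case: (i \in B); first by rewrite !ffunE scaler0; case: ifP.
rewrite ffunE [RHS]ffunE !ffunE -pair_eqE /= scalerA.
by case: (A' == A); rewrite //= scaler0.
Qed.

Lemma tot_epsE l : tot_eps l = \sum_i coord e1 i l.1 *: (creation X1 i (x) 1) +
  \sum_i coord e2 i l.2 *: (parity (x) creation X2 i).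
Proof.
rewrite /tot_eps /tensor_eps /std_eps (ts_suml tsG) (ts_sumr tsG); congr (_ + _); apply: eq_bigr => i _.
  exact: (tsZl tsG).
exact: (tsZr tsG).
Qed.

Lemma tot_eps_inl (i : 'I_n1) : tot_eps (lie_inl L2 e1`_i) = (creation X1 i (x) 1).
Proof. by rewrite /tot_eps /tensor_eps /= std_eps_basis std_eps0 (ts0r tsG) addr0. Qed.

Lemma tot_eps_inr (i : 'I_n2) : tot_eps (lie_inr L1 e2`_i) = (parity (x) creation X2 i).
Proof. by rewrite /tot_eps /tensor_eps /= std_eps_basis std_eps0 (ts0l tsG) add0r. Qed.

Lemma tot_ind (W : G -> Prop) : (forall x, W (tot_eta x)) ->
  (forall u v, W u -> W v -> W (u + v)) -> (forall l u, W u -> W (tot_eps l u)) ->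
  forall u, W u.
Proof.
move=> W0 WD We u; rewrite (ffun_deltaE u).
have W00 : W 0 by rewrite -(blin0 tot_eta).
elim/big_ind: _ => // -[A B] _.
move: (u (A, B)) => x; have [k] := ubnP (#|A| + #|B|)%N; elim: k => // k IH in A B x *.
have [->|[i iA]] := finset.set_0Vmem A; last first.
  move=> ABk.
  have -> : delta (A, B) x = tot_eps (lie_inl L2 e1`_i) (delta (A :\ i, B) (ext_sign R i A *: x)).
    rewrite tot_eps_inl tot_creation1_delta !inE eqxx /= finset.setD1K // ext_signD1x.
    by rewrite deltaZ scalerA ext_sign_sqr scale1r.
  by apply: We; apply: IH; rewrite (cardsD1 i A) iA in ABk.
have [->|[i iB]] := finset.set_0Vmem B; first by move=> _; exact: W0.
move=> Bk.
have -> : delta (finset.set0, B) x =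
    tot_eps (lie_inr L1 e2`_i) (delta (finset.set0, B :\ i) (ext_sign R i B *: x)).
  rewrite tot_eps_inr tot_creation2_delta !inE eqxx /= finset.setD1K // ext_signD1x.
  by rewrite cards0 mul1r deltaZ scalerA ext_sign_sqr scale1r.
by apply: We; apply: IH; rewrite (cardsD1 i B) iB addnS in Bk.
Qed.

Let entry_std_theta1 l A : entry (std_theta rho1 l) A finset.set0 =
  if A == finset.set0 then rho1 l else 0.
Proof.
apply: blinP => x; rewrite entryE; have := km_theta0 km1 l x; rewrite /std_eta /= => ->.
by rewrite ffunE; case: ifP.
Qed.

Let entry_std_theta2 l B : entry (std_theta rho2 l) B finset.set0 =
  if B == finset.set0 then rho2 l else 0.
Proof.
apply: blinP => x; rewrite entryE; have := km_theta0 km2 l x; rewrite /std_eta /= => ->.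
by rewrite ffunE; case: ifP.
Qed.

Let entry_diff1 A : entry (std_diff rho1) A finset.set0 = 0.
Proof.
apply: blinP => x; rewrite entryE; have := km_diff0 km1 x; rewrite /std_eta /= => ->.
by rewrite ffunE.
Qed.

Let entry_diff2 A : entry (std_diff rho2) A finset.set0 = 0.
Proof.
apply: blinP => x; rewrite entryE; have := km_diff0 km2 x; rewrite /std_eta /= => ->.
by rewrite ffunE.
Qed.

Lemma tot_koszul_model :
  koszul_model (tensor_rep tt rho1 rho2 : L -> 'L(X)) tot_eta tot_eps tot_theta tot_diff tot_deg.
Proof.
split.
- exact: (tensor_eps_linear tsG km1 km2 _).
- exact: tot_ind.
- exact: (tensor_eps_sqr tsG km1 km2 parity_sqr parity_eps).
- exact: (tensor_cartan tsG km1 km2 parity_sqr parity_diff parity_eps).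
- move=> x; apply/ffunP => AB; rewrite add_blinE ffunE [RHS]ffunE !ffun_op_delta.
  by rewrite entry_diff1 entry_diff2 (ts0l ts) (ts0r ts) addr0.
- exact: (tensor_theta_eps tsG km1 km2 parity_diff parity_eps).
- move=> l x; apply/ffunP => -[A B]; rewrite add_blinE ffunE !ffun_op_delta /=.
  rewrite entry_std_theta1 entry_std_theta2 !entry1 ffunE -pair_eqE /=.
  case: eqP => _; case: eqP => _ //=; rewrite ?(ts0l ts) ?(ts0r ts) ?zero_blinE ?addr0 //.
- move=> p l; rewrite tot_epsE mulrDr mulrDl !mulr_sumr !mulr_suml.
  congr (_ + _); apply: eq_bigr => i _; rewrite -scaler_blinAr -scaler_blinAl; congr (_ *: _).
    apply: blinP => f; apply/ffunP => -[A B]; rewrite !mul_blinE tot_degE !tot_creation1E tot_degE /=.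
    case: (boolP (i \in A)) => iA; last by case: ifP.
    rewrite (cardsD1 i A) iA.
    have -> : ((true + #|A :\ i|)%N%:Z + #|B|%:Z == p) = (#|A :\ i|%:Z + #|B|%:Z == p - 1).
      by apply/eqP/eqP; lia.
    by case: ifP; rewrite ?scaler0.
  apply: blinP => f; apply/ffunP => -[A B]; rewrite !mul_blinE tot_degE !tot_creation2E tot_degE /=.
  case: (boolP (i \in B)) => iB; last by case: ifP.
  rewrite (cardsD1 i B) iB.
  have -> : (#|A|%:Z + (true + #|B :\ i|)%N%:Z == p) = (#|A|%:Z + #|B :\ i|%:Z == p - 1).
    by apply/eqP/eqP; lia.
  by case: ifP; rewrite ?scaler0.
- move=> p x; apply/ffunP => -[A B]; rewrite tot_degE ffunE -pair_eqE /=.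
  have [->|A0] := eqVneq A finset.set0; have [->|B0] := eqVneq B finset.set0 => /=.
  + by rewrite !cards0 eq_sym; case: ifP => _; rewrite ffunE ?eqxx.
  + by case: ifP => _ //; case: ifP => _; rewrite ffunE // -pair_eqE /= (negbTE B0) andbF.
  + by case: ifP => _ //; case: ifP => _; rewrite ffunE // -pair_eqE /= (negbTE A0).
  + by case: ifP => _ //; case: ifP => _; rewrite ffunE // -pair_eqE /= (negbTE A0).
Qed.

Section TotalLift.
Variables (G' : completeNormedModType C) (eta' : blin X G')
  (eps' theta' : L -> 'L(G')) (D' : 'L(G')) (P' : int -> 'L(G')).
Hypothesis km' : koszul_model (tensor_rep tt rho1 rho2 : L -> 'L(X)) eta' eps' theta' D' P'.

Let g1 (i : 'I_n1) := eps' (lie_inl L2 e1`_i).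
Let g2 (i : 'I_n2) := eps' (lie_inr L1 e2`_i).

(** Sends [x (x) (e_A (x) e_B)] to [e_A /\ e_B] acting on [eta' x], with the factors from [L1] on
    the left. *)
Definition tot_lift : blin G G' :=
  \sum_(AB : I1 * I2)
    bcomp (ordered_prod g1 AB.1 * ordered_prod g2 AB.2) (bcomp eta' (bcoord X AB)).

Lemma tot_lift_delta A B x :
  tot_lift (delta (A, B) x) = ordered_prod g1 A (ordered_prod g2 B (eta' x)).
Proof.
rewrite /tot_lift sum_blinE (sum_single (i0 := (A, B))) => [|AB nAB].
  by rewrite /= ffunE eqxx.
by rewrite /= ffunE (negbTE nAB) !blin0.
Qed.

Lemma tot_lift_eta x : tot_lift (tot_eta x) = eta' x.
Proof. by rewrite [LHS]tot_lift_delta !ordered_prod0. Qed.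

Lemma tot_lift_eps l u : tot_lift (tot_eps l u) = eps' l (tot_lift u).
Proof.
have h1 (i : 'I_n1) : bcomp tot_lift (creation X1 i (x) 1) = bcomp (g1 i) tot_lift.
  apply: ffun_blinP => -[A B] x; rewrite !comp_blinE tot_creation1_delta tot_lift_delta.
  rewrite -[g1 i _]mul_blinE mul_ordered_prod.
  - by case: ifP => _; rewrite ?blin0 // blinZ tot_lift_delta.
  - by move=> j k; exact: (km_anticomm km').
  - by move=> j; exact: (km_sqr km').
(* Moving [g2 i] past the [#|A|] factors from [L1] produces the sign that [parity] carries. *)
have h2 (i : 'I_n2) : bcomp tot_lift (parity (x) creation X2 i) = bcomp (g2 i) tot_lift.
  apply: ffun_blinP => -[A B] x; rewrite !comp_blinE tot_creation2_delta tot_lift_delta.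
  rewrite -[g2 i _]mul_blinE /ordered_prod anticomm_prod; last first.
    by move=> j; exact: (km_anticomm km').
  rewrite -/(ordered_prod g1 A) scale_blinE mul_blinE -/(ordered_prod g2 B).
  rewrite -[g2 i _]mul_blinE mul_ordered_prod; last first.
  - by move=> j; exact: (km_sqr km').
  - by move=> j k; exact: (km_anticomm km').
  have -> : count (fun j => j \in A) (index_enum 'I_n1) = #|A|.
    by rewrite -sum1_count -sum1_card.
  case: ifP => _; first by rewrite !blin0 scaler0.
  by rewrite blinZ tot_lift_delta scale_blinE blinZ scalerA.
have lE : l = \sum_i coord e1 i l.1 *: lie_inl L2 e1`_i + \sum_i coord e2 i l.2 *: lie_inr L1 e2`_i.
  transitivity (lie_inl L2 l.1 + lie_inr L1 l.2).
    by case: l => a b; congr (_, _); rewrite /= ?addr0 ?add0r.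
  congr (_ + _); [rewrite {1}(std_expand l.1)|rewrite {1}(std_expand l.2)];
    rewrite linear_sum; apply: eq_bigr => i _; exact: linearZ.
have E1 : tot_eps l u = \sum_i coord e1 i l.1 *: (creation X1 i (x) 1) u +
    \sum_i coord e2 i l.2 *: (parity (x) creation X2 i) u.
  by rewrite tot_epsE add_blinE !sum_blinE.
have E2 v : eps' l v = \sum_i coord e1 i l.1 *: g1 i v + \sum_i coord e2 i l.2 *: g2 i v.
  rewrite {1}lE (kmD km') !(km_sum km') add_blinE !sum_blinE.
  by congr (_ + _); apply: eq_bigr => i _; rewrite (kmZ km').
rewrite E1 E2 blinD !blin_sum; congr (_ + _); apply: eq_bigr => i _; rewrite blinZ; congr (_ *: _).
  exact: (congr1 (fun T : blin G G' => T u) (h1 i)).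
exact: (congr1 (fun T : blin G G' => T u) (h2 i)).
Qed.

End TotalLift.
End TotalComplex.

(** * Uniqueness of models and transport of tensor structures *)

Section ModelTransport.
Variables (R : realType).
Local Notation C := R[i].
Variables (L : lieAlgType C) (X : completeNormedModType C) (rho : L -> 'L(X)).
Variables (G : completeNormedModType C) (eta : blin X G) (eps theta : L -> 'L(G))
  (D : 'L(G)) (P : int -> 'L(G)).
Variables (G' : completeNormedModType C) (eta' : blin X G') (eps' theta' : L -> 'L(G'))
  (D' : 'L(G')) (P' : int -> 'L(G')).
Hypotheses (km : koszul_model rho eta eps theta D P)
  (km' : koszul_model rho eta' eps' theta' D' P').
Variables (Psi : blin G' G) (Phi : blin G G').
Hypotheses (Psi_eta : forall x, Psi (eta' x) = eta x)
  (Psi_eps : forall l u, Psi (eps' l u) = eps l (Psi u))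
  (Phi_eta : forall x, Phi (eta x) = eta' x)
  (Phi_eps : forall l u, Phi (eps l u) = eps' l (Phi u)).

(** The composite fixes the generators and commutes with [eps], and only the identity does. *)
Lemma model_liftK : cancel Phi Psi.
Proof.
move=> u; have h : bcomp Psi Phi = 1.
  apply: (km_endo_id km) => [x|l v]; first by rewrite comp_blinE Phi_eta Psi_eta.
  by rewrite !comp_blinE Phi_eps Psi_eps.
exact: (congr1 (fun T : 'L(G) => T u) h).
Qed.

Lemma model_liftVK : cancel Psi Phi.
Proof.
move=> u; have h : bcomp Phi Psi = 1.
  apply: (km_endo_id km') => [x|l v]; first by rewrite comp_blinE Psi_eta Phi_eta.
  by rewrite !comp_blinE Psi_eps Phi_eps.
exact: (congr1 (fun T : 'L(G') => T u) h).
Qed.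

Lemma model_tensor_structure (G1 G2 : completeNormedModType C) (t : G1 -> G2 -> G')
    (tt : 'L(G1) -> 'L(G2) -> 'L(G')) D1 (P1 : int -> 'L(G1)) D2 (P2 : int -> 'L(G2)) s :
  tensor_structure t tt -> D' = tt D1 1 + tt s D2 ->
  (forall i j, P' (i + j) * tt (P1 i) (P2 j) = tt (P1 i) (P2 j)) ->
  exists t' tt', [/\ @tensor_structure R G1 G2 G t' tt', D = tt' D1 1 + tt' s D2 &
    forall i j, P (i + j) * tt' (P1 i) (P2 j) = tt' (P1 i) (P2 j)].
Proof.
move=> ts DE PE.
exists (fun x y => Psi (t x y)), (fun T S => bcomp Psi (bcomp (tt T S) Phi)); split.
- exact: (tensor_structure_iso model_liftVK model_liftK ts).
- apply: blinP => u; rewrite add_blinE !comp_blinE -blinD -add_blinE -DE.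
  by rewrite (km_morph_diff km' km Psi_eta Psi_eps) model_liftK.
- move=> i j; apply: blinP => u; rewrite mul_blinE !comp_blinE.
  by rewrite -(km_morph_deg km' km Psi_eta Psi_eps) -mul_blinE PE.
Qed.

End ModelTransport.

Section KoszulTensor.
Variables (R : realType).
Local Notation C := R[i].
Variables (L1 L2 : lieAlgType C) (X1 X2 X : completeNormedModType C)
  (t : X1 -> X2 -> X) (tt : 'L(X1) -> 'L(X2) -> 'L(X)).
Hypothesis ts : tensor_structure t tt.
Variables (rho1 : L1 -> 'L(X1)) (rho2 : L2 -> 'L(X2)).
Hypotheses (rep1 : is_representation rho1) (rep2 : is_representation rho2).
Local Notation L := (Datatypes_prod__canonical__Defs_LieAlgebra L1 L2).
Local Notation rho := (tensor_rep tt rho1 rho2).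

Lemma tensor_representation : @is_representation R L X rho.
Proof.
have [l1 b1] := rep1; have [l2 b2] := rep2; split=> [a l m|l m].
  rewrite /tensor_rep l1 l2 (ts_opl ts) (ts_opr ts) scalerDr.
  by rewrite addrACA.
pose A (k : L) := tt (rho1 k.1) 1; pose B (k : L) := tt 1 (rho2 k.2).
have -> : rho (lie l m) = tt (rho1 l.1 * rho1 m.1 - rho1 m.1 * rho1 l.1) 1 +
    tt 1 (rho2 l.2 * rho2 m.2 - rho2 m.2 * rho2 l.2).
  by rewrite /tensor_rep b1 b2.
symmetry; transitivity ((A l + B l) * (A m + B m) - (A m + B m) * (A l + B l)); first by [].
apply: commD; rewrite !(ts_mul ts) ?mulr1 ?mul1r //.
  by rewrite -(tsBl ts).
by rewrite -(tsBr ts).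
Qed.

Local Notation I1 := {set 'I_(\dim {:L1})}.
Local Notation I2 := {set 'I_(\dim {:L2})}.
Local Notation G1 := {ffun I1 -> X1}.
Local Notation G2 := {ffun I2 -> X2}.
Local Notation G := {ffun {set 'I_(\dim {:L})} -> X}.
Local Notation Gt := {ffun I1 * I2 -> X}.
Local Notation ff := (@ffun_op R X1 X2 X tt I1 I2).

Let rep := tensor_representation.
Let km := std_koszul_model rep.
Let kmt := tot_koszul_model ts rep1 rep2.

Let Psi : blin Gt G := tot_lift (std_eta L X) (std_eps X).
Let Phi : blin G Gt := std_lift (tot_eta L1 L2 X) (tot_eps tt).

Let Psi_eta x : Psi (tot_eta L1 L2 X x) = std_eta L X x.
Proof. exact: tot_lift_eta. Qed.

Let Psi_eps l u : Psi (tot_eps tt l u) = std_eps X l (Psi u).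
Proof. exact: (tot_lift_eps ts km). Qed.

Let Phi_eta x : Phi (std_eta L X x) = tot_eta L1 L2 X x.
Proof. exact: std_lift_eta. Qed.

Let Phi_eps l u : Phi (std_eps X l u) = tot_eps tt l (Phi u).
Proof. exact: (std_lift_eps kmt). Qed.

Lemma koszul_tensor_structure : exists t' tt', [/\ @tensor_structure R G1 G2 G t' tt',
  @std_diff R L X rho = tt' (std_diff rho1) 1 + tt' (parity L1 X1) (std_diff rho2) &
  forall i j, std_deg L X (i + j) * tt' (std_deg L1 X1 i) (std_deg L2 X2 j) =
    tt' (std_deg L1 X1 i) (std_deg L2 X2 j)].
Proof.
apply: (model_tensor_structure km kmt Psi_eta Psi_eps Phi_eta Phi_eps
  (ffun_tensor_structure ts I1 I2)) => [//|i j].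
rewrite /tot_deg /std_deg /ext_degree (ffun_op_wcomp ts) wcompM.
apply: blinP => f; apply/ffunP => -[A B]; rewrite !wcompE /=; congr (_ *: _).
have [->|_] := eqVneq #|A|%:Z i; last by rewrite mul0r mulr0.
have [->|_] := eqVneq #|B|%:Z j; last by rewrite !mulr0.
by rewrite eqxx mul1r.
Qed.

Lemma koszul_tensor_not_split (m : int) : ~ gsplit (@std_diff R L X rho) (std_deg L X) m ->
  exists i j : int, [/\ 0 <= i < (\dim {:L1}).+1%:Z, 0 <= j < (\dim {:L2}).+1%:Z, i + j = m,
    ~ gsplit (std_diff rho1) (std_deg L1 X1) i & ~ gsplit (std_diff rho2) (std_deg L2 X2) j].
Proof.
have [t' [tt' [ts' DE PE]]] := koszul_tensor_structure.
exact: (tensor_not_split ts' (std_graded_complex rep1) (std_graded_complex rep2)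
  (std_graded_complex rep) (@ext_parity_degree _ _ _) DE PE).
Qed.

Lemma koszul_tensor_approx_cycles (b1 b2 : bool) (p q : int) :
  approx_cycles (std_diff rho1) (std_deg L1 X1) b1 p ->
  approx_cycles (std_diff rho2) (std_deg L2 X2) b2 q ->
  gclosed (@std_diff R L X rho) (std_deg L X) (p + q) \/ b1 && b2 ->
  ~ gexact (@std_diff R L X rho) (std_deg L X) (p + q).
Proof.
have [t' [tt' [ts' DE PE]]] := koszul_tensor_structure.
exact: (tensor_approx_cycles ts' (std_graded_complex rep) DE PE).
Qed.

(** Failure of exactness gives strict approximate cycles, whose tensor product is a genuine
    cycle. *)
Lemma koszul_tensor_inexact (p q : int) :
  ~ gexact (std_diff rho1) (std_deg L1 X1) p -> ~ gexact (std_diff rho2) (std_deg L2 X2) q ->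
  ~ gexact (@std_diff R L X rho) (std_deg L X) (p + q).
Proof.
move=> n1 n2; apply: (@koszul_tensor_approx_cycles true true); last by right.
  by apply: contrapT => /(not_approx_cycles_exact (std_graded_complex rep1)).
by apply: contrapT => /(not_approx_cycles_exact (std_graded_complex rep2)).
Qed.

(** A range that is not closed only gives approximate cycles; the assumed closed range of the total
    differential then corrects their tensor product. *)
Lemma koszul_tensor_singular (p q : int) :
  ~ (gexact (std_diff rho1) (std_deg L1 X1) p /\ gclosed (std_diff rho1) (std_deg L1 X1) p) ->
  ~ (gexact (std_diff rho2) (std_deg L2 X2) q /\ gclosed (std_diff rho2) (std_deg L2 X2) q) ->
  ~ (gexact (@std_diff R L X rho) (std_deg L X) (p + q) /\ gclosed (@std_diff R L X rho) (std_deg L X) (p + q)).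
Proof.
move=> n1 n2 [ex cl]; move: ex.
apply: (@koszul_tensor_approx_cycles false false); last by left.
  apply: contrapT => h; apply: n1; have gc := std_graded_complex rep1.
  by split; [exact: (not_approx_cycles_exact gc h)|exact: (not_approx_cycles_closed gc h)].
apply: contrapT => h; apply: n2; have gc := std_graded_complex rep2.
by split; [exact: (not_approx_cycles_exact gc h)|exact: (not_approx_cycles_closed gc h)].
Qed.

End KoszulTensor.

(** * From the tensor product axioms to [tensor_structure] *)

Section FromTensorProduct.
Variables (R : realType) (X1 X2 X : completeNormedModType R[i]).
Local Notation C := R[i].

Lemma bilinear_bounded (E F G : normedModType C) (f : E -> F -> G) :
  (forall y, linear (f^~ y)) -> (forall x, linear (f x)) ->
  continuous (fun z : E * F => f z.1 z.2) ->
  exists2 c : R, 0 <= c & forall x y, rnorm (f x y) <= c * (rnorm x * rnorm y).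
Proof.
move=> fl fr cf.
have f0 y : f 0 y = 0.
  by have := fl y 1 0 0; rewrite !scale1r addr0 => /eqP; rewrite eq_sym -subr_eq0 addrK => /eqP.
have f0r x : f x 0 = 0.
  by have := fr x 1 0 0; rewrite !scale1r addr0 => /eqP; rewrite eq_sym -subr_eq0 addrK => /eqP.
have fZ (a b : C) x y : f (a *: x) (b *: y) = (a * b) *: f x y.
  have := fl (b *: y) a x 0; rewrite addr0 f0 addr0 => ->.
  by have := fr x b y 0; rewrite addr0 f0r addr0 => ->; rewrite scalerA.
have := cf (0, 0); rewrite /continuous_at /= f0 => /cvgrPdist_lt/(_ 1 ltr01).
rewrite near_simpl => /nbhs_ballP[e /= e0 eB].
(* Half the radius, so that the closed ball of radius [r] lies in the open ball given by
   continuity. *)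
pose r : R := complex.Re e / 2.
have re0 : 0 < complex.Re e by move: e0; rewrite ltcE => /andP[].
have r0 : 0 < r by rewrite divr_gt0.
have re : r < complex.Re e by rewrite /r; lra.
have small x y : rnorm x <= r -> rnorm y <= r -> rnorm (f x y) <= 1.
  move=> xr yr; have := eB (x, y); rewrite /= sub0r normrN normE -(rmorph1 (real_complex R)) ltcR.
  move=> h; apply/ltW/h; split; rewrite -ball_normE /= sub0r normrN normE.
    by rewrite -(ge0_Re (ltW e0)) ltcR; exact: le_lt_trans re.
  by rewrite -(ge0_Re (ltW e0)) ltcR; exact: le_lt_trans re.
exists (r ^- 2) => [|x y]; first by rewrite invr_ge0 exprn_ge0 // ltW.
have [->|x0] := eqVneq x 0; first by rewrite f0 !rnorm0 mul0r mulr0.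
have [->|y0] := eqVneq y 0; first by rewrite f0r !rnorm0 !mulr0.
have xp := rnorm_eq0E x0; have yp := rnorm_eq0E y0.
have nZ (z : R) (V : normedModType C) (v : V) : 0 < z -> rnorm v = z ->
    rnorm ((r / z)%:C%C *: v) = r.
  move=> z0 vz; rewrite rnormZr ger0_norm ?vz ?divfK ?gt_eqF //.
  by rewrite divr_ge0 ?ltW.
have rle z : z = r -> z <= r by move=> ->.
have := small _ _ (rle _ (nZ _ _ x xp erefl)) (rle _ (nZ _ _ y yp erefl)).
rewrite fZ -rmorphM rnormZr ger0_norm; last first.
  by apply: mulr_ge0; apply: divr_ge0; rewrite ?rnorm_ge0 // ltW.
move=> h; rewrite -(ler_pM2l (_ : 0 < r / rnorm x * (r / rnorm y))); last first.
  by rewrite mulr_gt0 ?divr_gt0.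
apply: le_trans h _; rewrite le_eqVlt; apply/orP; left; apply/eqP.
by field; rewrite !gt_eqF.
Qed.

Lemma tensor_product_structure (t : {bilinear X1 -> X2 -> X})
    (tt : {bilinear 'L(X1) -> 'L(X2) -> 'L(X)}) :
  is_tensor_product t tt -> tensor_structure t tt.
Proof.
move=> tp.
have tl y : linear (t^~ y) by move=> a x x'; exact: linearPl.
have tr x : linear (t x) by move=> a y y'; exact: linearPr.
have ttl S : linear (tt^~ S) by move=> a T T'; exact: linearPl.
have ttr T : linear (tt T) by move=> a S S'; exact: linearPr.
have tn x y : rnorm (t x y) = rnorm x * rnorm y.
  by apply: complexI; rewrite rmorphM /= -!normE (tensor_norm tp).
split => //.
- exact: (tensor_op_tensor tp).
- exact: (tensor_op_comp tp).
- exact: (tensor_op_id tp).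
- by exists 1 => // x y; rewrite mul1r tn.
- by exists 1 => // x y; rewrite mul1r tn.
- exact: (bilinear_bounded ttl ttr (tensor_op_continuous tp)).
Qed.

End FromTensorProduct.

Section Representations.
Variables (R : realType).
Local Notation C := R[i].

(** Subtracting scalars does not change commutators, and a character vanishes on brackets. *)
Lemma rep_shift_representation (L : lieAlgType C) (X : completeNormedModType C)
    (rho : L -> 'L(X)) f : is_representation rho -> is_character f ->
  is_representation (rep_shift rho f).
Proof.
move=> [rl rb] cf; split=> [a l m|l m]; rewrite /rep_shift.
  rewrite rl linearP scalerDl scalerBr opprD addrACA; congr (_ + _).
  by rewrite scalerA.
rewrite rb cf scale0r subr0.
rewrite -[bcomp (rho l) (rho m)]/(rho l * rho m) -[bcomp (rho m) (rho l)]/(rho m * rho l).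
rewrite -[bid X]/(1 : 'L(X)).
rewrite -[bcomp (rho l - _) _]/((rho l - f l *: (1 : 'L(X))) * (rho m - f m *: (1 : 'L(X)))).
rewrite -[bcomp (rho m - _) _]/((rho m - f m *: (1 : 'L(X))) * (rho l - f l *: (1 : 'L(X)))).
rewrite !mulrBl !mulrBr -!scaler_blinAl -!scaler_blinAr !mul1r !mulr1 !scalerA.
rewrite [f m * f l]mulrC; set a := f l *: rho m; set b := f m *: rho l; set c := _ *: (1 : 'L(X)).
rewrite -[_ - b - _]addrA -opprD -[_ - a - _]addrA -opprD.
by rewrite (addrCA b a) opprB subrKA.
Qed.

End Representations.

(** * Hilbert spaces *)

Section InnerProducts.
Variable R : realType.
Local Notation C := R[i].

(* An inner product whose norm is equivalent to that of the space: the sum norm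
   of a product of Hilbert spaces is only equivalent to a Hilbert norm. *)
Record inner_product (E : completeNormedModType C) (ip : E -> E -> C) (N : R) : Prop := {
  ip_add : forall x y z, ip (x + y) z = ip x z + ip y z;
  ip_scale : forall a x z, ip (a *: x) z = a * ip x z;
  ip_conj : forall x y, ip x y = Num.conj (ip y x);
  ip_lower : forall x, rnorm x ^+ 2 <= N * complex.Re (ip x x);
  ip_upper : forall x, complex.Re (ip x x) <= rnorm x ^+ 2 }.

Section Projection.
Variables (E : completeNormedModType C) (ip : E -> E -> C) (N : R).
Hypotheses (N0 : 0 < N) (ipP : inner_product ip N).

Let re x y : R := complex.Re (ip x y).
Let q x := re x x.

Let reC x y : re x y = re y x.
Proof. by rewrite /re (ip_conj ipP); case: (ip y x). Qed.

Let reDl x y z : re (x + y) z = re x z + re y z.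
Proof. by rewrite /re (ip_add ipP); case: (ip x z) => ? ?; case: (ip y z). Qed.

Let reZl (a : R) x z : re (a%:C%C *: x) z = a * re x z.
Proof. by rewrite /re (ip_scale ipP); case: (ip x z) => u v /=; rewrite mul0r subr0. Qed.

Let reDr x y z : re z (x + y) = re z x + re z y.
Proof. by rewrite !(reC z) reDl. Qed.

Let reZr (a : R) x z : re z (a%:C%C *: x) = a * re z x.
Proof. by rewrite !(reC z) reZl. Qed.

Let qD (s : R) x y : q (x + s%:C%C *: y) = q x + 2 * s * re x y + s ^+ 2 * q y.
Proof. by rewrite /q !reDl !reDr !reZl !reZr (reC y x); ring. Qed.

Let qZ (s : R) x : q (s%:C%C *: x) = s ^+ 2 * q x.
Proof. by rewrite /q reZl reZr mulrA. Qed.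

Let qS x y : q (x + y) = q x + 2 * re x y + q y.
Proof. by rewrite -[y in LHS]scale1r -(rmorph1 (real_complex R)) qD mulr1 expr1n mul1r. Qed.

Let q_ge0 x : 0 <= q x.
Proof.
rewrite -(pmulr_rge0 _ N0); apply: le_trans (ip_lower ipP x).
by rewrite exprn_ge0 ?rnorm_ge0.
Qed.

Let q_eq0 x : q x = 0 -> x = 0.
Proof.
move=> q0; have := ip_lower ipP x; rewrite -[complex.Re _]/(q x) q0 mulr0 => x0.
apply: rnorm_le0; rewrite leNgt; apply/negP => xp.
by have := exprn_gt0 2 xp; rewrite ltNge x0.
Qed.

(** Testing against the multiple [ip x v *: v] turns the real part into the squared modulus of
    [ip x v]. *)
Let ip_ortho x (V : set E) : (forall v, V v -> re x v = 0) ->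
  (forall (a : C) v, V v -> V (a *: v)) -> forall v, V v -> ip x v = 0.
Proof.
move=> xV VZ v Vv; have := xV _ (VZ (ip x v) v Vv); rewrite reC /re (ip_scale ipP).
rewrite (ip_conj ipP v x); case: (ip x v) => a b /= h.
have : a ^+ 2 + b ^+ 2 = 0 by rewrite -h; ring.
by move/eqP; rewrite paddr_eq0 ?sqr_ge0 // !sqrf_eq0 => /andP[/eqP-> /eqP->].
Qed.

(** A minimizing sequence is Cauchy by the parallelogram law, its limit realizes the distance, and
    minimality along each direction of [V] gives orthogonality. *)
Lemma nearest_point (V : set E) (x : E) : closed V -> V 0 ->
  (forall (a : C) u v, V u -> V v -> V (a *: u + v)) ->
  exists2 l, V l & forall v, V v -> ip (x - l) v = 0.
Proof.
move=> cV V0 VP.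
have VD u v : V u -> V v -> V (u + v) by move=> Vu Vv; rewrite -[u]scale1r; exact: VP.
have VZ (a : C) v : V v -> V (a *: v) by move=> Vv; rewrite -[_ *: _]addr0; exact: VP.
pose Q := [set q (x - v) | v in V].
have Qlb : has_lbound Q by exists 0 => _ [v _ <-]; exact: q_ge0.
have Q0 : Q !=set0 by exists (q (x - 0)), 0.
pose d := inf Q.
have dle v : V v -> d <= q (x - v) by move=> Vv; apply: ge_inf => //; exists v.
(* Chosen so that [N * (4 * eps n)], the bound on the squared distance between consecutive terms, is
   the square of [(1 / 2) ^+ n]. *)
pose eps n : R := (4 * N)^-1 / 4 ^+ n.
have eps0 n : 0 < eps n by rewrite divr_gt0 ?exprn_gt0 // invr_gt0 mulr_gt0.
have /choice[v vP] : forall n, exists v, V v /\ q (x - v) < d + eps n.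
  move=> n; have [|_ [v Vv <-] h] := @inf_adherent _ Q (eps n) (eps0 n).
    by split.
  by exists v.
have epsS n : eps n.+1 <= eps n.
  rewrite /eps ler_wpM2l ?invr_ge0 ?mulr_ge0 ?(ltW N0) // lef_pV2 ?posrE ?exprn_gt0 //.
  by rewrite ler_eXn2l // ltr1n.
have vstep n : rnorm (v n.+1 - v n) <= (1 / 2) ^+ n.
  have [Vn qn] := vP n; have [Vn1 qn1] := vP n.+1.
  have mid : d <= q (x - (2^-1)%:C%C *: (v n + v n.+1)) by apply: dle; apply: VZ; exact: VD.
  have par : q (v n.+1 - v n) = 2 * q (x - v n) + 2 * q (x - v n.+1)
      - 4 * q (x - (2^-1)%:C%C *: (v n + v n.+1)).
    set a := x - v n; set b := x - v n.+1.
    have -> : v n.+1 - v n = a + (-1)%:C%C *: b.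
      by rewrite rmorphN rmorph1 scaleN1r /a /b opprB [RHS]addrC subrKA.
    have -> : x - (2^-1)%:C%C *: (v n + v n.+1) = (2^-1)%:C%C *: (a + b).
      rewrite /a /b addrACA -opprD scalerBr; congr (_ - _).
      by rewrite scalerDr -scalerDl -rmorphD -[2^-1]mul1r -splitr rmorph1 scale1r.
    by rewrite qD qZ qS; field.
  have h4 : rnorm (v n.+1 - v n) ^+ 2 <= N * (4 * eps n).
    apply: le_trans (ip_lower ipP _) _; rewrite ler_pM2l // -[complex.Re _]/(q _) par.
    have := epsS n; lra.
  have h5 : N * (4 * eps n) = ((1 / 2) ^+ n) ^+ 2.
    rewrite /eps -exprM mulnC exprM expr2; have -> : (1 / 2 : R) * (1 / 2) = 4^-1 by field.
    rewrite -exprVn; set w := _ ^+ n; field; rewrite gt_eqF //.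
  by rewrite h5 in h4; rewrite -(ler_pXn2r (n := 2)) ?nnegrE ?rnorm_ge0.
have [||l lP] := @rnorm_cauchy_cvg _ _ v (fun n => (1 / 2) ^+ n) => //.
  by move=> n; rewrite exprS; lra.
have Vl : V l.
  have /closed_rnormP := cV; apply => e e0; apply: contrapT => h.
  suff : e <= 0 by rewrite leNgt e0.
  apply: (@le_geom_le0 _ _ 2) => n; rewrite leNgt; apply/negP => ne; apply: h.
  exists (v n); first by case: (vP n).
  by apply: le_lt_trans (lP n) _; apply: le_lt_trans ne; rewrite expr_div_n expr1n mul1r.
(* Young's inequality with weight [s = 2 ^- n]: as [q (v n - l)] is of order [s ^+ 2], dividing it
   by [s] still leaves an error of order [s]. *)
have ql : q (x - l) <= d.
  rewrite -subr_le0; apply: (@le_geom_le0 _ _ (d + 2 * (4 * N)^-1 + 8)) => n.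
  pose s : R := 2 ^- n; have s0 : 0 < s by rewrite invr_gt0 exprn_gt0.
  have s1 : s <= 1 by rewrite invf_le1 ?exprn_gt0 // exprn_ege1 // ler1n.
  have young u w : q (u + w) <= (1 + s) * q u + (1 + s^-1) * q w.
    have := q_ge0 (u + (- s^-1)%:C%C *: w); rewrite qD qS => h; have := mulr_ge0 (ltW s0) h.
    have -> : s * (q u + 2 * - s^-1 * re u w + (- s^-1) ^+ 2 * q w) =
      s * q u - 2 * re u w + s^-1 * q w by field; rewrite gt_eqF.
    lra.
  have [Vn qn] := vP n.
  have -> : x - l = (x - v n) + (v n - l) by rewrite addrA subrK.
  have qw : q (v n - l) <= 4 * s ^+ 2.
    apply: le_trans (ip_upper ipP _) _; rewrite rdistC.
    have -> : 4 * s ^+ 2 = (2 * (1 / 2) ^+ n) ^+ 2 by rewrite exprMn /s expr_div_n expr1n mul1r; ring.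
    by rewrite ler_pXn2r ?nnegrE ?rnorm_ge0 // mulr_ge0 // exprn_ge0 // divr_ge0.
  have es : eps n <= (4 * N)^-1 * s.
    rewrite /eps ler_wpM2l ?invr_ge0 ?mulr_ge0 ?(ltW N0) // lef_pV2 ?posrE ?exprn_gt0 //.
    by rewrite lerXn2r ?nnegrE // ler_nat.
  have h1 := young (x - v n) (v n - l).
  have h2 : (1 + s) * q (x - v n) <= (1 + s) * (d + eps n).
    by rewrite ler_wpM2l ?addr_ge0 ?(ltW s0) // ltW.
  have h3 : (1 + s^-1) * q (v n - l) <= (1 + s^-1) * (4 * s ^+ 2).
    by rewrite ler_wpM2l ?addr_ge0 ?invr_ge0 ?(ltW s0).
  have h4 : (1 + s^-1) * (4 * s ^+ 2) = 4 * s ^+ 2 + 4 * s by field; rewrite gt_eqF.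
  have h5 : s ^+ 2 <= s by rewrite expr2 -[leRHS]mulr1 ler_wpM2l ?(ltW s0).
  have e0 := ltW (eps0 n).
  have h6 : s * eps n <= eps n by rewrite -[leRHS]mul1r ler_wpM2r.
  rewrite -/s; rewrite mulrDl mul1r in h2; lra.
(* A step along [w] would decrease [q] unless the real part vanishes; [q w + 1] avoids dividing by
   zero. *)
have lre w : V w -> re (x - l) w = 0.
  move=> Vw; pose s := re (x - l) w / (q w + 1); have qw1 : 0 < q w + 1 by rewrite ltr_wpDl.
  have : d <= q ((x - l) + (- s)%:C%C *: w).
    rewrite rmorphN scaleNr -addrA -opprD; apply: dle; apply: VD => //; exact: VZ.
  rewrite qD => h; have {h ql} : 0 <= - (2 * s * re (x - l) w) + s ^+ 2 * q w by move: h; lra.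
  set r := re _ w; rewrite -/r in s *.
  have -> : - (2 * s * r) + s ^+ 2 * q w = - (s ^+ 2 * (q w + 2)).
    by rewrite /s -/r; field; rewrite gt_eqF.
  rewrite oppr_ge0 => h; have q2 : 0 < q w + 2 by have := q_ge0 w; lra.
  have : s ^+ 2 <= 0 by rewrite -(pmulr_lle0 _ q2).
  move=> s2; have /eqP : s ^+ 2 = 0 by apply/eqP; rewrite eq_le s2 sqr_ge0.
  rewrite sqrf_eq0 mulf_eq0 invr_eq0 (gt_eqF qw1) orbF => /eqP; exact.
by exists l => //; exact: ip_ortho.
Qed.

Lemma closed_projection (V : set E) : closed V -> V 0 ->
  (forall (a : C) u v, V u -> V v -> V (a *: u + v)) ->
  exists2 pr : 'L(E), forall x, V (pr x) & forall v, V v -> pr v = v.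
Proof.
move=> cV V0 VP.
have VB u v : V u -> V v -> V (u - v).
  by move=> Vu Vv; rewrite addrC -scaleN1r; exact: VP.
have /choice[f fP] : forall x, exists l, V l /\ forall v, V v -> ip (x - l) v = 0.
  by move=> x; have [l] := nearest_point x cV V0 VP; exists l.
have ip0l v : ip 0 v = 0 by rewrite -(scale0r 0) (ip_scale ipP) mul0r.
have ipN x v : ip (- x) v = - ip x v by rewrite -scaleN1r (ip_scale ipP) mulN1r.
have uniq x l : V l -> (forall v, V v -> ip (x - l) v = 0) -> f x = l.
  move=> Vl xl; have [Vf xf] := fP x; apply/eqP; rewrite -subr_eq0; apply/eqP/q_eq0.
  have Vd := VB _ _ Vf Vl; rewrite /q /re.
  have -> : f x - l = (x - l) - (x - f x) by rewrite opprB [RHS]addrC subrKA.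
  rewrite (ip_add ipP) ipN (_ : (x - l) - (x - f x) = f x - l); last first.
    by rewrite opprB [LHS]addrC subrKA.
  by rewrite xl // xf // subrr.
have flin : linear f.
  move=> a x y; have [Vx xf] := fP x; have [Vy yf] := fP y.
  apply: uniq => [|v Vv]; first exact: VP.
  by rewrite opprD addrACA -scalerBr (ip_add ipP) (ip_scale ipP) xf // yf // mulr0 addr0.
(* The squares satisfy the bound with constant [N], and [N <= (1 + N) ^+ 2]. *)
have fbound x : rnorm (f x) <= (1 + N) * rnorm x.
  have [Vf xf] := fP x.
  have qf : q (f x) <= q x.
    have -> : x = (x - f x) + 1%:C%C *: f x by rewrite rmorph1 scale1r subrK.
    rewrite [leRHS]qD.
    have -> : re (x - f x) (f x) = 0 by rewrite /re xf.
    rewrite rmorph1 scale1r subrK; have := q_ge0 (x - f x); lra.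
  have h : rnorm (f x) ^+ 2 <= N * rnorm x ^+ 2.
    apply: le_trans (ip_lower ipP _) _; rewrite ler_pM2l //.
    by apply: le_trans qf _; exact: (ip_upper ipP).
  rewrite -(ler_pXn2r (n := 2)) ?nnegrE ?mulr_ge0 ?rnorm_ge0 ?addr_ge0 ?(ltW N0) //.
  apply: le_trans h _; rewrite exprMn ler_wpM2r ?exprn_ge0 ?rnorm_ge0 //.
  by have := sqr_ge0 N; nra.
exists (mk_blin_bounded flin fbound) => [x|v Vv]; first by case: (fP x).
by apply: uniq => // w _; rewrite subrr ip0l.
Qed.

(** Project onto the range, take a preimage, and remove its kernel component. The result does not
    depend on the preimage, hence is linear, and the open mapping theorem bounds it. *)
Lemma generalized_inverse (T : 'L(E)) : closed (range T) ->
  exists S : 'L(E), T * S * T = T.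
Proof.
move=> cT.
have [pk pkV pkI] : exists2 pr : 'L(E), forall x, T (pr x) = 0 & forall v, T v = 0 -> pr v = v.
  apply: (@closed_projection [set x | T x = 0]).
  - exact: gr_closed_ker.
  - exact: blin0.
  - by move=> a u v /= Tu Tv; rewrite blinD blinZ Tu Tv scaler0 addr0.
have [pr prV prI] := @closed_projection (range T) cT (ex_intro2 _ _ 0 I (blin0 T))
  (fun a u v => ltac:(by move=> [u' _ <-] [v' _ <-]; exists (a *: u' + v'); rewrite ?blinD ?blinZ)).
have [M M0 TM] := open_mapping cT.
have /choice[g gP] : forall y, exists x, T x = pr y /\ rnorm x <= M * rnorm (pr y).
  by move=> y; have [x _ xy] := prV y; have [x' x'x x'M] := TM x; exists x'; rewrite -xy.
pose f y := g y - pk (g y).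
have fE y x : T x = pr y -> f y = x - pk x.
  move=> Tx; apply/eqP; rewrite -subr_eq0 /f opprB [pk x - x]addrC addrACA.
  have -> : - pk (g y) + pk x = - pk (g y - x) by rewrite blinB opprB addrC.
  by rewrite pkI ?subrr // blinB Tx; case: (gP y) => -> _; rewrite subrr.
have flin : linear f.
  move=> a x y; rewrite (fE _ (a *: g x + g y)).
    by rewrite blinD blinZ opprD addrACA -scalerBr.
  by rewrite !blinD !blinZ; case: (gP x) => -> _; case: (gP y) => -> _.
have fbound y : rnorm (f y) <= (1 + rnorm pk) * (M * rnorm pr) * rnorm y.
  apply: le_trans (rnormB _ _) _; have := opnormP pk (g y) => h1.
  have h2 : rnorm (g y) <= M * rnorm pr * rnorm y.
    have [_ h] := gP y; apply: le_trans h _; rewrite -mulrA ler_wpM2l //; exact: opnormP.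
  have h3 := ler_wpM2l (rnorm_ge0 pk) h2; rewrite mulrDl mul1r mulrDl; lra.
exists (mk_blin_bounded flin fbound); apply: blinP => x.
rewrite !mul_blinE -[mk_blin_bounded _ _ _]/(f (T x)) (fE _ x); last by rewrite prI.
by rewrite blinB pkV subr0.
Qed.

(** Closed ranges of the incoming and outgoing differentials have generalized inverses [S1] and
    [S0]. Then [u - S0 (D u)], up to projections, is a cycle, hence a boundary, with preimage given
    by [S1]. *)
Lemma hilbert_split n (D : 'L(E)) (P : int -> 'L(E)) p : graded_complex n D P ->
  gexact D P p -> gclosed D P p -> gsplit D P p.
Proof.
move=> gc ex cl; have [S0 S0P] := generalized_inverse cl.
have [|S1 S1P] := @generalized_inverse (D * P (p + 1)).
  suff -> : range (D * P (p + 1)) = [set z | (P p - 1) z = 0] `&` [set z | D z = 0].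
    by apply: closedI; exact: gr_closed_ker.
  apply/seteqP; split => [_ [w _ <-]|z [Pz Dz]].
    split; last exact: gr_diff_next gc _ _.
    change ((P p - 1) ((D * P (p + 1)) w) = 0).
    by rewrite sub_blinE one_blinE (gr_next gc) subrr.
  have {}Pz : P p z = z.
    by move: (Pz : (P p - 1) z = 0) => /eqP; rewrite sub_blinE one_blinE subr_eq0 => /eqP.
  have [w wz] := ex z Pz Dz; exists w => //.
  by rewrite mul_blinE (gr_diffS gc) wz.
have S0E u : D (P p (S0 (D (P p u)))) = D (P p u).
  by have := congr1 (fun T : 'L(E) => T u) S0P; rewrite !mul_blinE.
have S1E u : D (P (p + 1) (S1 (D (P (p + 1) u)))) = D (P (p + 1) u).
  by have := congr1 (fun T : 'L(E) => T u) S1P; rewrite !mul_blinE.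
pose H := P (p + 1) * S1 * (1 - P p * S0 * D) * P p + P p * S0 * P (p - 1).
have HE u : H u = P (p + 1) (S1 (P p u - P p (S0 (D (P p u))))) + P p (S0 (P (p - 1) u)).
  by rewrite /H add_blinE !mul_blinE sub_blinE one_blinE !mul_blinE.
have pp : p - 1 != p by rewrite -subr_eq0 addrAC subrr add0r oppr_eq0.
have DP u : P p u = u -> P (p - 1) (D u) = D u by move=> uP; rewrite -(gr_diffE gc) uP.
exists H => u uP; pose v := u - P p (S0 (D u)).
have vP : P p v = v by rewrite blinB uP (gr_idemE gc).
have Dv : D v = 0 by rewrite blinB -{2}uP S0E uP subrr.
have [w wv] := ex v vP Dv.
have vE : D (P (p + 1) w) = v by rewrite (gr_diffS gc) wv.
have -> : H u = P (p + 1) (S1 v).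
  have h : P (p - 1) u = 0 by rewrite -uP (gr_orthE gc).
  by rewrite HE h !blin0 addr0 uP.
have -> : H (D u) = P p (S0 (D u)).
  have h : P p (D u) = 0 by rewrite -DP // (gr_orthE gc) // eq_sym.
  by rewrite HE h DP // !blin0 subrr !blin0 add0r.
by rewrite -vE S1E vE subrK.
Qed.

End Projection.

(** The sum norm is compared with the Hilbert norm by the Cauchy-Schwarz inequality, with constant
    [#|I|]; the successor makes it positive for every [I]. *)
Lemma hilbert_inner_product (X : completeNormedModType C) (I : finType) :
  is_hilbert X -> exists ip, @inner_product {ffun I -> X} ip #|I|.+1%:R.
Proof.
move=> [dot dotP].
have dotB x y z : dot (x - y) z = dot x z - dot y z by exact: zmod_morphisml_subproof.
have dot0 z : dot 0 z = 0 by rewrite -(subrr 0) dotB subrr.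
have dotD x y z : dot (x + y) z = dot x z + dot y z.
  by rewrite -{1}[y]opprK dotB -[- y]sub0r dotB dot0 sub0r opprK.
have dotZ a x z : dot (a *: x) z = a * dot x z by exact: linearl_subproof.
have dotC x y : dot x y = Num.conj (dot y x).
  by rewrite (@hermitian_subproof _ _ false _ dot) mul1r.
have dotE x : complex.Re (dot x x) = rnorm x ^+ 2.
  by rewrite -dotP normE -rmorphXn.
exists (fun f g : {ffun I -> X} => \sum_i dot (f i) (g i)); split.
- by move=> f g h; rewrite -big_split; apply: eq_bigr => i _; rewrite ffunE dotD.
- by move=> a f h; rewrite mulr_sumr; apply: eq_bigr => i _; rewrite ffunE dotZ.
- by move=> f g; rewrite rmorph_sum; apply: eq_bigr => i _; rewrite dotC.
- move=> f; have -> : complex.Re (\sum_i dot (f i) (f i)) = \sum_i rnorm (f i) ^+ 2.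
    by rewrite raddf_sum; apply: eq_bigr => i _; exact: dotE.
  rewrite rnorm_ffun expr2 mulr_suml.
  have h (i j : I) : rnorm (f i) * rnorm (f j) <= (rnorm (f i) ^+ 2 + rnorm (f j) ^+ 2) / 2.
    have := sqr_ge0 (rnorm (f i) - rnorm (f j)); rewrite sqrrB -mulr_natr; lra.
  apply: le_trans (_ : \sum_i \sum_j (rnorm (f i) ^+ 2 + rnorm (f j) ^+ 2) / 2 <= _).
    by apply: ler_sum => i _; rewrite mulr_sumr; apply: ler_sum => j _.
  set S := \sum_i rnorm (f i) ^+ 2.
  have S0 : 0 <= S by apply: sumr_ge0 => i _; exact: sqr_ge0.
  have -> : \sum_i \sum_j (rnorm (f i) ^+ 2 + rnorm (f j) ^+ 2) / 2 = #|I|%:R * S.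
    under eq_bigr do rewrite -mulr_suml big_split /= sumr_const -/S.
    rewrite -mulr_suml big_split /= sumr_const sumrMnl -/S !cardT -mulrnDl -[_ *+ _]mulr_natl.
    by field.
  by rewrite ler_wpM2r // ler_nat.
- move=> f; have -> : complex.Re (\sum_i dot (f i) (f i)) = \sum_i rnorm (f i) ^+ 2.
    by rewrite raddf_sum; apply: eq_bigr => i _; exact: dotE.
  rewrite rnorm_ffun expr2 mulr_suml; apply: ler_sum => i _.
  rewrite expr2 ler_wpM2l ?rnorm_ge0 // (bigD1 i) //= lerDl sumr_ge0 // => j _.
  exact: rnorm_ge0.
Qed.

End InnerProducts.

(** * Joint spectra *)

Section SpectraDegreewise.
Variables (R : realType).
Local Notation C := R[i].

Variables (L : lieAlgType C) (X : completeNormedModType C) (rho : L -> 'L(X)).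
Hypothesis rep : is_representation rho.
Implicit Types (f : 'Hom(L, C^o)) (k : nat) (p : int).
Local Notation n := (\dim {:L}).

Definition exact_at f p := gexact (std_diff (rep_shift rho f)) (std_deg L X) p.
Definition closed_at f p := gclosed (std_diff (rep_shift rho f)) (std_deg L X) p.
Definition splits_at f p := gsplit (std_diff (rep_shift rho f)) (std_deg L X) p.

Let gc f (cf : is_character f) := std_graded_complex (rep_shift_representation rep cf).

Lemma sigma_deltaP k f : sigma_delta rho k f <->
  is_character f /\ exists2 p, 0 <= p <= k%:Z & ~ exact_at f p.
Proof.
split=> [[p pk [cf /(homology_gexact (rep_shift_representation rep cf)) nex]]|[cf [p pk nex]]].
  by split=> //; exists p.
exists p => //; split => //.
by apply/(homology_gexact (rep_shift_representation rep cf)).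
Qed.

(** The definition tests closedness in the lowest degree only. Above it, a range that is not closed
    in degree [p] entails inexactness in degree [p - 1], so the test may be made in every degree. *)
Lemma sigma_piP k f : sigma_pi rho k f <-> is_character f /\
  exists2 p, n%:Z - k%:Z <= p <= n%:Z & ~ (exact_at f p /\ closed_at f p).
Proof.
split=> [[[p pk [cf /(homology_gexact (rep_shift_representation rep cf)) nex]]|[cf ncl]]|].
- by split=> //; exists p => // -[].
- split=> //; exists (n%:Z - k%:Z); first by lia.
  by move=> [_ /(closed_gclosed (rep_shift_representation rep cf))].
- move=> [cf [p pk sing]].
  have [ex|nex] := pselect (exact_at f p); last first.
    left; exists p => //; split => //.
    by apply/(homology_gexact (rep_shift_representation rep cf)).
  have ncl : ~ closed_at f p by move=> cl; apply: sing.
  have [pE|pn] := eqVneq p (n%:Z - k%:Z).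
    right; split=> // cl; apply: ncl; rewrite pE.
    by apply/(closed_gclosed (rep_shift_representation rep cf)).
  left; exists (p - 1); first by rewrite /=; lia.
  split => //; apply/(homology_gexact (rep_shift_representation rep cf)) => ex1.
  apply: ncl; rewrite -[p](subrK 1); exact: (gexact_closed (gc cf)).
Qed.

Lemma spl_deltaP k f : spl_delta rho k f <->
  is_character f /\ exists2 p, 0 <= p <= k%:Z & ~ splits_at f p.
Proof.
split=> [[p pk [cf ns]]|[cf [p pk ns]]].
  by split=> //; exists p => // /(split_gsplit (rep_shift_representation rep cf)).
by exists p => //; split => // /(split_gsplit (rep_shift_representation rep cf)).
Qed.

Lemma spl_piP k f : spl_pi rho k f <->
  is_character f /\ exists2 p, n%:Z - k%:Z <= p <= n%:Z & ~ splits_at f p.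
Proof.
split=> [[p pk [cf ns]]|[cf [p pk ns]]].
  by split=> //; exists p => // /(split_gsplit (rep_shift_representation rep cf)).
by exists p => //; split => // /(split_gsplit (rep_shift_representation rep cf)).
Qed.

Lemma sigma_delta_spl k : sigma_delta rho k `<=` spl_delta rho k.
Proof.
move=> f /sigma_deltaP[cf [p pk nex]]; apply/spl_deltaP; split=> //; exists p => // sp.
by apply: nex; exact: (gsplit_exact sp).
Qed.

Lemma sigma_pi_spl k : sigma_pi rho k `<=` spl_pi rho k.
Proof.
move=> f /sigma_piP[cf [p pk sing]]; apply/spl_piP; split=> //; exists p => // sp.
by apply: sing; split; [exact: (gsplit_exact sp)|exact: (gsplit_closed (gc cf) sp)].
Qed.

Hypothesis hX : is_hilbert X.

Lemma hilbert_splits_at f p : is_character f -> exact_at f p -> closed_at f p -> splits_at f p.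
Proof.
move=> cf ex cl; have [ip ipP] := hilbert_inner_product {set 'I_n} hX.
exact: (hilbert_split (ltr0Sn R _) ipP (gc cf)).
Qed.

(** If splitting fails at [p] although the complex is exact there, the range in degree [p] is not
    closed, so exactness fails at [p - 1]. *)
Lemma hilbert_spl_delta k : spl_delta rho k `<=` sigma_delta rho k.
Proof.
move=> f /spl_deltaP[cf [p pk ns]]; apply/sigma_deltaP; split=> //.
have [ex|nex] := pselect (exact_at f p); last by exists p.
have ncl : ~ closed_at f p by move=> cl; apply: ns; exact: hilbert_splits_at.
(* In degree 0 the range is closed, because degree -1 is trivially exact. *)
have [p0|p0] := eqVneq p 0.
  exfalso; apply: ncl; rewrite p0 -[0](addNr 1); apply: (gexact_closed (gc cf)).
  exact: (gexact_neg (gc cf)).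
exists (p - 1); first by lia.
move=> ex1; apply: ncl; rewrite -[p](subrK 1); exact: (gexact_closed (gc cf)).
Qed.

Lemma hilbert_spl_pi k : spl_pi rho k `<=` sigma_pi rho k.
Proof.
move=> f /spl_piP[cf [p pk ns]]; apply/sigma_piP; split=> //; exists p => // -[ex cl].
by apply: ns; exact: hilbert_splits_at.
Qed.

End SpectraDegreewise.

Section TensorSpectra.
Variables (R : realType).
Local Notation C := R[i].
Variables (L1 L2 : lieAlgType C) (X1 X2 X : completeNormedModType C)
  (t : X1 -> X2 -> X) (tt : 'L(X1) -> 'L(X2) -> 'L(X)).
Hypothesis ts : tensor_structure t tt.
Variables (rho1 : L1 -> 'L(X1)) (rho2 : L2 -> 'L(X2)).
Hypotheses (rep1 : is_representation rho1) (rep2 : is_representation rho2).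
Local Notation L := (Datatypes_prod__canonical__Defs_LieAlgebra L1 L2).
Local Notation rho := (tensor_rep tt rho1 rho2).
Local Notation "f '|1'" := (f \o linfun (@lie_inl _ L1 L2))%VF (at level 2).
Local Notation "f '|2'" := (f \o linfun (@lie_inr _ L1 L2))%VF (at level 2).
Implicit Types (f : 'Hom(L, C^o)) (k : nat) (p q : int).

Let resE f (l : L) : f l = f|1 l.1 + f|2 l.2.
Proof.
rewrite !comp_lfunE !lfunE -linearD; congr (f _); case: l => a b.
by congr (_, _); rewrite /= ?addr0 ?add0r.
Qed.

Lemma is_character_prod f : is_character f <-> is_character f|1 /\ is_character f|2.
Proof.
split=> [cf|[c1 c2] l m]; last by rewrite resE c1 c2 addr0.
split=> l m; rewrite comp_lfunE lfunE /=.
  rewrite -(cf (lie_inl L2 l) (lie_inl L2 m)); congr (f _).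
  by congr (_, _); rewrite /= lie_alt.
rewrite -(cf (lie_inr L1 l) (lie_inr L1 m)); congr (f _).
by congr (_, _); rewrite /= lie_alt.
Qed.

Lemma rep_shift_tensor f :
  @rep_shift R L X rho f = tensor_rep tt (rep_shift rho1 f|1) (rep_shift rho2 f|2).
Proof.
apply: funext => l; rewrite /rep_shift /tensor_rep (tsBl ts) (tsBr ts) (tsZl ts) (tsZr ts).
rewrite -[bid X1]/(1 : 'L(X1)) -[bid X2]/(1 : 'L(X2)) (ts_one ts) addrACA -opprD -scalerDl.
by rewrite -resE.
Qed.

Lemma dim_prod_lie : \dim {:L} = (\dim {:L1} + \dim {:L2})%N.
Proof. by rewrite !dimvf. Qed.

Section AtCharacter.
Variable f : 'Hom(L, C^o).
Hypothesis cf : is_character f.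

Let r1 := rep_shift_representation rep1 (proj1 (proj1 (is_character_prod f) cf)).
Let r2 := rep_shift_representation rep2 (proj2 (proj1 (is_character_prod f) cf)).

Lemma tensor_splits_at p : ~ @splits_at R L X rho f p ->
  exists i j : int, [/\ 0 <= i <= (\dim {:L1})%:Z, 0 <= j <= (\dim {:L2})%:Z, i + j = p,
    ~ splits_at rho1 f|1 i & ~ splits_at rho2 f|2 j].
Proof.
rewrite /splits_at rep_shift_tensor => /(koszul_tensor_not_split ts r1 r2).
move=> [i [j [i1 j2 ij ni nj]]]; exists i, j; split => //; lia.
Qed.

Lemma tensor_exact_at p q : ~ exact_at rho1 f|1 p -> ~ exact_at rho2 f|2 q ->
  ~ @exact_at R L X rho f (p + q).
Proof. by rewrite [@exact_at _ L _ _ _]/exact_at rep_shift_tensor; exact: (koszul_tensor_inexact ts r1 r2). Qed.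

Lemma tensor_singular_at p q :
  ~ (exact_at rho1 f|1 p /\ closed_at rho1 f|1 p) ->
  ~ (exact_at rho2 f|2 q /\ closed_at rho2 f|2 q) ->
  ~ (@exact_at R L X rho f (p + q) /\ @closed_at R L X rho f (p + q)).
Proof.
rewrite [@exact_at _ L _ _ _]/exact_at [@closed_at _ L _ _ _]/closed_at rep_shift_tensor.
exact: (koszul_tensor_singular ts r1 r2).
Qed.

End AtCharacter.

Let rep := tensor_representation ts rep1 rep2.

Lemma tensor_sigma_delta k :
  spectra_prod (sigma_delta rho1) (sigma_delta rho2) k `<=` @sigma_delta R L X rho k.
Proof.
move=> f [[a b] /= abk [/(sigma_deltaP rep1)[c1 [p pa np]] /(sigma_deltaP rep2)[c2 [q qb nq]]]].
have cf : is_character f by apply/is_character_prod.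
apply/(sigma_deltaP rep); split => //; exists (p + q); first by lia.
exact: (tensor_exact_at cf).
Qed.

Lemma tensor_sigma_pi k :
  spectra_prod (sigma_pi rho1) (sigma_pi rho2) k `<=` @sigma_pi R L X rho k.
Proof.
move=> f [[a b] /= abk [/(sigma_piP rep1)[c1 [p pa np]] /(sigma_piP rep2)[c2 [q qb nq]]]].
have cf : is_character f by apply/is_character_prod.
apply/(sigma_piP rep); split => //; exists (p + q); first by rewrite dim_prod_lie; lia.
exact: (tensor_singular_at cf).
Qed.

Lemma tensor_spl_delta k :
  @spl_delta R L X rho k `<=` spectra_prod (spl_delta rho1) (spl_delta rho2) k.
Proof.
move=> f /(spl_deltaP rep)[cf [p pk ns]].
have [c1 c2] := proj1 (is_character_prod f) cf.
have [i [j [i1 j2 ij ni nj]]] := tensor_splits_at cf ns.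
(* The whole remainder [k - i] goes to the second factor; it is at least [j] since [i + j <= k]. *)
exists (absz i, k - absz i)%N; first by rewrite /=; lia.
split.
  by apply/(spl_deltaP rep1); split=> //; exists i => //=; lia.
by apply/(spl_deltaP rep2); split=> //; exists j => //=; lia.
Qed.

Lemma tensor_spl_pi k :
  @spl_pi R L X rho k `<=` spectra_prod (spl_pi rho1) (spl_pi rho2) k.
Proof.
move=> f /(spl_piP rep)[cf [p pk ns]]; rewrite dim_prod_lie in pk.
have [c1 c2] := proj1 (is_character_prod f) cf.
have [i [j [i1 j2 ij ni nj]]] := tensor_splits_at cf ns.
(* The first index is the codegree of [i]. It is at most [k] because the codegrees of [i] and [j]
   add up to that of [p], so the truncated subtractions are exact. *)
exists (\dim {:L1} - absz i, k - (\dim {:L1} - absz i))%N; first by rewrite /=; lia.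
split.
  by apply/(spl_piP rep1); split=> //; exists i => //=; lia.
by apply/(spl_piP rep2); split=> //; exists j => //=; lia.
Qed.

End TensorSpectra.

Lemma spectra_prodS (R : realType) (L1 L2 : lieAlgType R[i])
    (A1 B1 : nat -> set 'Hom(L1, R[i]^o)) (A2 B2 : nat -> set 'Hom(L2, R[i]^o)) k :
  (forall p, A1 p `<=` B1 p) -> (forall q, A2 q `<=` B2 q) ->
  spectra_prod A1 A2 k `<=` spectra_prod B1 B2 k.
Proof. by move=> AB1 AB2 f [pq pqk [f1 f2]]; exists pq => //; split; [exact: AB1|exact: AB2]. Qed.

Theorem theorem5p1 (R : realType) (L1 L2 : lieAlgType R[i])
    (X1 X2 X : completeNormedModType R[i])
    (t : {bilinear X1 -> X2 -> X})
    (tt : {bilinear 'L(X1) -> 'L(X2) -> 'L(X)})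
    (rho1 : L1 -> 'L(X1)) (rho2 : L2 -> 'L(X2))
    (solvable_L1 : lie_solvable L1) (solvable_L2 : lie_solvable L2)
    (rep_rho1 : is_representation rho1) (rep_rho2 : is_representation rho2)
    (tensor_X : is_tensor_product t tt) :
  let rho := tensor_rep tt rho1 rho2 in
  (forall k : nat,
    [/\ spectra_prod (sigma_delta rho1) (sigma_delta rho2) k
          `<=` sigma_delta rho k,
        sigma_delta rho k `<=` spl_delta rho k &
        spl_delta rho k
          `<=` spectra_prod (spl_delta rho1) (spl_delta rho2) k]
    /\
    [/\ spectra_prod (sigma_pi rho1) (sigma_pi rho2) k `<=` sigma_pi rho k,
        sigma_pi rho k `<=` spl_pi rho k &
        spl_pi rho k `<=` spectra_prod (spl_pi rho1) (spl_pi rho2) k])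
  /\
  (is_hilbert X1 -> is_hilbert X2 -> forall k : nat,
    [/\ spectra_prod (sigma_delta rho1) (sigma_delta rho2) k
          = sigma_delta rho k,
        sigma_delta rho k = spl_delta rho k &
        spl_delta rho k
          = spectra_prod (spl_delta rho1) (spl_delta rho2) k]
    /\
    [/\ spectra_prod (sigma_pi rho1) (sigma_pi rho2) k = sigma_pi rho k,
        sigma_pi rho k = spl_pi rho k &
        spl_pi rho k = spectra_prod (spl_pi rho1) (spl_pi rho2) k]).
Proof.
have ts := tensor_product_structure tensor_X.
have rep := tensor_representation ts rep_rho1 rep_rho2.
move=> rho; split=> [k|h1 h2 k].
  split; split.
  - exact: (tensor_sigma_delta ts rep_rho1 rep_rho2).
  - exact: (sigma_delta_spl rep).
  - exact: (tensor_spl_delta ts rep_rho1 rep_rho2).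
  - exact: (tensor_sigma_pi ts rep_rho1 rep_rho2).
  - exact: (sigma_pi_spl rep).
  - exact: (tensor_spl_pi ts rep_rho1 rep_rho2).
(* For Hilbert [X1] and [X2] the last set is contained in the first, which closes each chain of
   inclusions into a cycle. *)
have squeeze (T : Type) (A B C D : set T) : A `<=` B -> B `<=` C -> C `<=` D -> D `<=` A ->
    [/\ A = B, B = C & C = D].
  move=> AB BC CD DA; have CB := subset_trans CD (subset_trans DA AB).
  by split; apply/seteqP; split => // x; [move=> /BC/CD/DA|move=> /DA/AB/BC].
split; apply: squeeze.
- exact: (tensor_sigma_delta ts rep_rho1 rep_rho2).
- exact: (sigma_delta_spl rep).
- exact: (tensor_spl_delta ts rep_rho1 rep_rho2).
- by apply: spectra_prodS => p; [exact: hilbert_spl_delta|exact: hilbert_spl_delta].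
- exact: (tensor_sigma_pi ts rep_rho1 rep_rho2).
- exact: (sigma_pi_spl rep).
- exact: (tensor_spl_pi ts rep_rho1 rep_rho2).
- by apply: spectra_prodS => p; [exact: hilbert_spl_pi|exact: hilbert_spl_pi].
Qed.
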